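(* Let $n\in\{2,3\}$ and let $\Omega\subset\mathbb{R}^n$ be a bounded, simply connected, Lipschitz domain. Then there exists an orthonormal basis $(\phi_k)_{k\in\mathcal{I}}$ of $H^1_0(\Omega)$, indexed by a countable set $\mathcal{I}$, consisting of non-zero homogeneous-Dirichlet eigenvectors of $-\Delta$ in $\Omega$; and the family $(\boldsymbol{\phi}_k)_{k\in\mathcal{I}}$ defined by $$\boldsymbol{\phi}_k := \frac{\nabla\phi_k}{\|\nabla\phi_k\|_{[L^2(\Omega)]^n}},\qquad k\in\mathcal{I},$$ is an orthonormal basis of the subspace $\nabla H^1_0(\Omega)\subset H_0(\mathrm{curl},\Omega)$, where $\nabla H^1_0(\Omega)$ carries the inner product of $H(\mathrm{curl},\Omega)$.
   Context: All functions are real-valued. ''Orthonormal basis'' means a complete orthonormal system in the Hilbert space sense. Curl: for $n=3$, $\mathrm{curl}$ is the usual curl; for $n=2$, $\mathrm{curl}(\boldsymbol{u})=\partial_y u_1-\partial_x u_2$ (scalar). In both cases it is taken in the sense of distributions. Put $n'=1$ if $n=2$ and $n'=3$ if $n=3$. $H(\mathrm{curl},\Omega):=\{\boldsymbol{u}\in[L^2(\Omega)]^n:\mathrm{curl}(\boldsymbol{u})\in[L^2(\Omega)]^{n'}\}$ is a Hilbert space with inner product $(\boldsymbol{u},\boldsymbol{v})_{H(\mathrm{curl},\Omega)}=\int_\Omega \mathrm{curl}(\boldsymbol{u})\cdot\mathrm{curl}(\boldsymbol{v})+\boldsymbol{u}\cdot\boldsymbol{v}\,d\boldsymbol{x}$.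 $H_0(\mathrm{curl},\Omega):=\{\boldsymbol{u}\in H(\mathrm{curl},\Omega):\gamma_t(\boldsymbol{u})=0\}$, where $\gamma_t$ is the continuous extension to $H(\mathrm{curl},\Omega)$, with values in $H^{-1/2}(\partial\Omega)$ (componentwise), of the tangential trace $\boldsymbol{u}\mapsto\boldsymbol{u}|_{\partial\Omega}\times\mathbf{n}$, with $\mathbf{n}$ the outward unit normal; for $n=2$, $\boldsymbol{u}\times\boldsymbol{v}=u_1v_2-u_2v_1$. $H^1_0(\Omega)$ is equipped with the inner product $(u,v)_{H^1_0(\Omega)}=\int_\Omega\nabla u\cdot\nabla v\,d\boldsymbol{x}$, and $\nabla H^1_0(\Omega):=\{\nabla u:u\in H^1_0(\Omega)\}$. A homogeneous-Dirichlet eigenvector of $-\Delta$ in $\Omega$ is a function $\phi\in H^1_0(\Omega)$ with $-\Delta\phi=\lambda\phi$ in $\Omega$ for some $\lambda\in\mathbb{R}$, in the usual weak sense: $\int_\Omega\nabla\phi\cdot\nabla v\,d\boldsymbol{x}=\lambda\int_\Omega\phi v\,d\boldsymbol{x}$ for all $v\in H^1_0(\Omega)$. *)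

(* Defs.v *)
From HB Require Import structures.
From mathcomp Require Import all_boot all_order all_algebra.
From mathcomp Require Import all_classical all_reals all_analysis.

Set Implicit Arguments.
Unset Strict Implicit.
Unset Printing Implicit Defensive.

Import Order.TTheory GRing.Theory Num.Theory.
Import numFieldNormedType.Exports.

Local Open Scope classical_set_scope.
Local Open Scope ring_scope.

(* Functions (with Borel representatives in Omega) stand for their classes    *)
(* modulo equality almost everywhere.                                         *)
(* Weak derivatives are relations [is_weak_grad], [is_weak_curl]; [grad] and  *)
(* [curl] choose a representative, unique almost everywhere in [Omega].       *)

(** * Euclidean structure *)

(* The library norm on ['rV[R]_n] is the sup norm; it is used for the         *)
(* topology and for boundedness only.                                         *)
Definition dotv (R : realType) (n : nat) (u v : 'rV[R]_n) : R :=
  \sum_i u 0 i * v 0 i.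

Definition enorm (R : realType) (n : nat) (u : 'rV[R]_n) : R :=
  Num.sqrt (dotv u u).

(* Entry of a matrix at natural-number indices, 0 out of range.               *)
Definition entry (R : realType) (m n : nat) (A : 'M[R]_(m, n)) (i j : nat) : R :=
  if (insub i, insub j) is (Some i', Some j') then A i' j' else 0.

Definition curl_dim (n : nat) : nat := if n == 3%N then 3%N else 1%N.

(* Only meaningful for n = 2 and n = 3; indices are 0-based.                  *)
Definition cross (R : realType) (n : nat) (u v : 'rV[R]_n) :
    'rV[R]_(curl_dim n) :=
  \row_k if n == 3%N then
      entry u 0 (k.+1 %% 3)%N * entry v 0 (k.+2 %% 3)%N
      - entry u 0 (k.+2 %% 3)%N * entry v 0 (k.+1 %% 3)%N
    else entry u 0 0 * entry v 0 1 - entry u 0 1 * entry v 0 0.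

(* The curl as a linear expression in D i j = partial_i u_j; for n = 2 this   *)
(* is the convention partial_y u_1 - partial_x u_2.                           *)
Definition curl_of (R : realType) (n : nat) (D : 'M[R]_n) :
    'rV[R]_(curl_dim n) :=
  \row_k if n == 3%N then
      entry D (k.+1 %% 3)%N (k.+2 %% 3)%N - entry D (k.+2 %% 3)%N (k.+1 %% 3)%N
    else entry D 1 0 - entry D 0 1.

(** * Lebesgue measure on R^n *)

Definition matrix_display : measure_display.
Proof. exact: default_measure_display. Qed.

(* The sigma-algebra generated by the coordinates, which is the Borel one.    *)
Section matrix_measurable.
Context (R : realType) (m n : nat).

Definition matrix_coord_sets : set (set 'M[R]_(m, n)) :=
  [set A : set 'M[R]_(m, n) | exists i j, exists2 B : set (measurableTypeR R),
    measurable B & A = [set M | B (M i j)]].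

Let mx_set0 : <<s matrix_coord_sets >> set0.
Proof. exact: sigma_algebra0. Qed.

Let mx_setC A : <<s matrix_coord_sets >> A -> <<s matrix_coord_sets >> (~` A).
Proof. exact: sigma_algebraC. Qed.

Let mx_bigcup (F : (set 'M[R]_(m, n))^nat) :
  (forall i, <<s matrix_coord_sets >> (F i)) ->
  <<s matrix_coord_sets >> (\bigcup_i F i).
Proof. exact: sigma_algebra_bigcup. Qed.

HB.instance Definition _ := @isMeasurable.Build matrix_display
  'M[R]_(m, n) <<s matrix_coord_sets >> mx_set0 mx_setC mx_bigcup.

End matrix_measurable.

Definition row_snoc (R : realType) (n : nat)
    (p : 'rV[R]_n * measurableTypeR R) : 'rV[R]_n.+1 :=
  \row_i if unlift ord_max i is Some j then p.1 0 j else p.2.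

Lemma measurable_row_snoc (R : realType) (n : nat) :
  measurable_fun setT (@row_snoc R n).
Proof.
apply: (@measurability _ _ _ _ _ _ (@matrix_coord_sets R 1 n.+1)) => //.
move=> _ [_ [i [j [B mB ->]]] <-]; rewrite setTI.
case Ej: (unlift ord_max j) => [k|].
- rewrite (_ : _ @^-1` _ = fst @^-1` [set v : 'rV[R]_n | B (v 0 k)]).
    rewrite -[X in measurable X]setTI; apply: measurable_fst => //.
    by apply: sub_sigma_algebra; exists 0, k, B.
  by apply/seteqP; split => p /=; rewrite mxE Ej.
- rewrite (_ : _ @^-1` _ = snd @^-1` B).
    by rewrite -[X in measurable X]setTI; apply: measurable_snd.
  by apply/seteqP; split => p /=; rewrite mxE Ej.
Qed.

Section measure_snoc.
Context (R : realType) (n : nat) (mu : {measure set 'rV[R]_n -> \bar R}).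

Definition measure_snoc : set 'rV[R]_n.+1 -> \bar R :=
  pushforward (mu \x @lebesgue_measure R)%E (@row_snoc R n).

HB.instance Definition _ := Measure.copy measure_snoc
  (measure_function_pushforward__canonical__measure_function_Measure
     (mu \x @lebesgue_measure R)%E (@measurable_row_snoc R n)).

End measure_snoc.

Fixpoint lebesgue_rV (R : realType) (n : nat) :
    {measure set 'rV[R]_n -> \bar R} :=
  match n with
  | 0 => dirac (0 : 'rV[R]_0)
  | n'.+1 => measure_snoc (lebesgue_rV R n')
  end.

(** * Hausdorff measure *)

Section hausdorff.
Local Open Scope ereal_scope.
Context (R : realType) (n : nat).
Implicit Types (A : set 'rV[R]_n) (s : nat) (delta : R).

Definition ediam A : \bar R :=
  ereal_sup [set (enorm (x - y))%:E | x in A & y in A].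

(* Volume of the Euclidean unit ball of R^s, so that the s-dimensional        *)
(* Hausdorff measure agrees with s-dimensional area.                          *)
Definition ball_volume s : \bar R :=
  lebesgue_rV R s [set x | (enorm x <= 1)%R].

(* The value +oo excludes the sets of diameter > delta from the coverings.    *)
Definition hausdorff_gauge s delta A : \bar R :=
  if A == set0 then 0
  else if ediam A <= delta%:E then ball_volume s * (2^-1%:E * ediam A) ^+ s
  else +oo.

(* [mu_ext] takes coverings by Borel sets, which does not change the infimum  *)
(* since a set and its closure have the same diameter.                        *)
Definition hausdorff s A : \bar R :=
  ereal_sup [set mu_ext (hausdorff_gauge s delta) A |
               delta in [set delta : R | (0 < delta)%R]].

Let gauge0 s delta : hausdorff_gauge s delta set0 = 0.
Proof. by rewrite /hausdorff_gauge eqxx. Qed.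

Let gauge_ge0 s delta A : 0 <= hausdorff_gauge s delta A.
Proof.
rewrite /hausdorff_gauge; case: ifPn => // /set0P[x Ax].
case: ifPn => // _; rewrite mule_ge0 ?measure_ge0 // expe_ge0 // mule_ge0 //.
apply: (@le_trans _ _ (enorm (x - x))%:E).
  by rewrite lee_fin sqrtr_ge0.
by apply: ereal_sup_ubound; exists x => //; exists x.
Qed.

Section outer.
Variable s : nat.

Let hausdorff0 : hausdorff s set0 = 0.
Proof.
apply/eqP; rewrite eq_le; apply/andP; split.
  apply: ge_ereal_sup => _ [delta _ <-].
  by rewrite (mu_ext0 (gauge0 _ _) (gauge_ge0 _ _)).
apply: ereal_sup_ubound; exists 1%R => //=.
by rewrite (mu_ext0 (gauge0 _ _) (gauge_ge0 _ _)).
Qed.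

Let hausdorff_ge0 A : 0 <= hausdorff s A.
Proof.
apply: (@le_trans _ _ (mu_ext (hausdorff_gauge s 1) A)).
  exact: (mu_ext_ge0 (gauge_ge0 _ _)).
by apply: ereal_sup_ubound; exists 1%R => /=.
Qed.

Let le_hausdorff : {homo hausdorff s : A B / A `<=` B >-> A <= B}.
Proof.
move=> A B AB; apply: ge_ereal_sup => _ [delta d0 <-].
apply: (@le_trans _ _ (mu_ext (hausdorff_gauge s delta) B)).
  exact: le_mu_ext.
by apply: ereal_sup_ubound; exists delta.
Qed.

Let hausdorff_sigma_subadditive : sigma_subadditive (hausdorff s).
Proof.
move=> F; apply: ge_ereal_sup => _ [delta d0 <-].
apply: (@le_trans _ _ (\sum_(i <oo) mu_ext (hausdorff_gauge s delta) (F i))).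
  exact: (mu_ext_sigma_subadditive (gauge_ge0 _ _)).
apply: lee_nneseries => i *; first exact: (mu_ext_ge0 (gauge_ge0 _ _)).
by apply: ereal_sup_ubound; exists delta.
Qed.

HB.instance Definition _ := isOuterMeasure.Build R 'rV[R]_n (hausdorff s)
  hausdorff0 hausdorff_ge0 le_hausdorff hausdorff_sigma_subadditive.

End outer.
End hausdorff.

Definition surface_outer (R : realType) (n : nat) :
  {outer_measure set 'rV[R]_n -> \bar R} := @hausdorff R n n.-1.

(* The underlying type of [surface_type R n] is ['rV[R]_n].                   *)
Notation surface_type R n := (caratheodory_type (@surface_outer R n)).

Definition surface_measure (R : realType) (n : nat) :
    {measure set (surface_type R n) -> \bar R} :=
  [the measure _ _ of (surface_outer R n : set (surface_type R n) -> \bar R)].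

(** * Domains *)

Definition is_domain (R : realType) (n : nat) (Omega : set 'rV[R]_n) : Prop :=
  [/\ open Omega, connected Omega & Omega !=set0].

Definition unit_interval (R : realType) : set R := `[0, 1]%classic.

Definition simply_connected (R : realType) (n : nat) (Omega : set 'rV[R]_n) :
    Prop :=
  let I01 := @unit_interval R in
  (forall x y, Omega x -> Omega y -> exists gamma : R -> 'rV[R]_n,
     [/\ {within I01, continuous gamma}, gamma @` I01 `<=` Omega,
         gamma 0 = x & gamma 1 = y]) /\
  (forall gamma : R -> 'rV[R]_n,
     {within I01, continuous gamma} -> gamma @` I01 `<=` Omega ->
     gamma 0 = gamma 1 ->
     exists H : R * R -> 'rV[R]_n,
       [/\ {within I01 `*` I01, continuous H},
           H @` (I01 `*` I01) `<=` Omega,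
           forall s, I01 s -> H (s, 0) = gamma s /\ H (s, 1) = gamma 0 &
           forall t, I01 t -> H (0, t) = gamma 0 /\ H (1, t) = gamma 0]).

Definition boundary (R : realType) (n : nat) (Omega : set 'rV[R]_n) :
    set 'rV[R]_n :=
  closure Omega `\` interior Omega.

(* Near each boundary point, Omega lies below the graph, in some direction e, *)
(* of a Lipschitz function g on the hyperplane orthogonal to e.               *)
Definition lipschitz_domain (R : realType) (n : nat) (Omega : set 'rV[R]_n) :
    Prop :=
  forall x0, boundary Omega x0 ->
  exists (e : 'rV[R]_n) (g : 'rV[R]_n -> R),
    [/\ enorm e = 1, [lipschitz g y | y in [set y | dotv y e = 0]] &
        \forall x \near x0,
          Omega x <-> dotv x e < g (x - dotv x e *: e)].

(* Omega is, to first order at x, the half-space {y | (y - x) . nu < 0}.      *)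
Definition is_outward_normal (R : realType) (n : nat) (Omega : set 'rV[R]_n)
    (x nu : 'rV[R]_n) : Prop :=
  enorm nu = 1 /\
  forall eps : R, 0 < eps -> \forall y \near x,
    (dotv (y - x) nu < - (eps * enorm (y - x)) -> Omega y) /\
    (eps * enorm (y - x) < dotv (y - x) nu -> ~ Omega y).

(* For a Lipschitz domain it exists at almost every boundary point.           *)
Definition outward_normal (R : realType) (n : nat) (Omega : set 'rV[R]_n)
    (x : 'rV[R]_n) : 'rV[R]_n :=
  xget 0 [set nu | is_outward_normal Omega x nu].

(** * Smooth functions *)

Definition unit_vec (R : realType) (n : nat) (i : 'I_n) : 'rV[R]_n :=
  delta_mx 0 i.

Definition partial (R : realType) (n : nat) (i : 'I_n) (f : 'rV[R]_n -> R) :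
    'rV[R]_n -> R :=
  'D_(unit_vec R i) f.

Definition partials (R : realType) (n : nat) (s : seq 'I_n)
    (f : 'rV[R]_n -> R) : 'rV[R]_n -> R :=
  foldr (@partial R n) f s.

Definition smooth (R : realType) (n : nat) (f : 'rV[R]_n -> R) : Prop :=
  forall s : seq 'I_n,
    continuous (partials s f) /\
    forall i x, derivable (partials s f) x (unit_vec R i).

Definition smooth_field (R : realType) (n m : nat)
    (u : 'rV[R]_n -> 'rV[R]_m) : Prop :=
  forall j, smooth (fun x => u x 0 j).

Definition test_function (R : realType) (n : nat) (Omega : set 'rV[R]_n)
    (psi : 'rV[R]_n -> R) : Prop :=
  [/\ smooth psi, compact (closure [set x | psi x != 0]) &
      closure [set x | psi x != 0] `<=` Omega].

(** * Function spaces *)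

Section spaces.
Context (R : realType) (n : nat) (Omega : set 'rV[R]_n).

Local Notation mu := (lebesgue_rV R n).

Definition L2 (f : 'rV[R]_n -> R) : Prop := f \_ Omega \in Lfun mu 2%:E.

Definition L2_field (m : nat) (u : 'rV[R]_n -> 'rV[R]_m) : Prop :=
  forall j, L2 (fun x => u x 0 j).

Definition L2_dot (m : nat) (u v : 'rV[R]_n -> 'rV[R]_m) : R :=
  \int[mu]_(x in Omega) dotv (u x) (v x).

Definition L2_norm (m : nat) (u : 'rV[R]_n -> 'rV[R]_m) : R :=
  Num.sqrt (L2_dot u u).

Definition is_weak_grad (f : 'rV[R]_n -> R) (v : 'rV[R]_n -> 'rV[R]_n) :
    Prop :=
  L2_field v /\
  forall (psi : 'rV[R]_n -> R) (i : 'I_n), test_function Omega psi ->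
    \int[mu]_(x in Omega) (v x 0 i * psi x) =
    - \int[mu]_(x in Omega) (f x * partial i psi x).

Definition grad (f : 'rV[R]_n -> R) : 'rV[R]_n -> 'rV[R]_n :=
  xget 0 [set v | is_weak_grad f v].

Definition H1 (f : 'rV[R]_n -> R) : Prop :=
  L2 f /\ exists v, is_weak_grad f v.

Definition H1_norm (f : 'rV[R]_n -> R) : R :=
  Num.sqrt (\int[mu]_(x in Omega) (f x ^+ 2 + dotv (grad f x) (grad f x))).

(* The closure of the test functions in H^1.                                  *)
Definition H10 : set ('rV[R]_n -> R) :=
  [set f | H1 f /\ forall eps : R, 0 < eps ->
    exists2 psi, test_function Omega psi & H1_norm (f - psi) < eps].

Definition H10_dot (f g : 'rV[R]_n -> R) : R := L2_dot (grad f) (grad g).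

(* All the representatives of the gradients of H^1_0 functions.               *)
Definition grad_H10 : set ('rV[R]_n -> 'rV[R]_n) :=
  [set v | exists2 f, H10 f & is_weak_grad f v].

(* [curl_of] is applied to the matrix partial_i psi * u_j, since the          *)
(* distribution partial_i u_j maps psi to - \int u_j partial_i psi.           *)
Definition is_weak_curl (u : 'rV[R]_n -> 'rV[R]_n)
    (c : 'rV[R]_n -> 'rV[R]_(curl_dim n)) : Prop :=
  L2_field c /\
  forall (psi : 'rV[R]_n -> R) (k : 'I_(curl_dim n)), test_function Omega psi ->
    \int[mu]_(x in Omega) (c x 0 k * psi x) =
    - \int[mu]_(x in Omega)
        curl_of (\matrix_(i, j) (partial i psi x * u x 0 j)) 0 k.

Definition curl (u : 'rV[R]_n -> 'rV[R]_n) :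
    'rV[R]_n -> 'rV[R]_(curl_dim n) :=
  xget 0 [set c | is_weak_curl u c].

Definition Hcurl : set ('rV[R]_n -> 'rV[R]_n) :=
  [set u | L2_field u /\ exists c, is_weak_curl u c].

Definition Hcurl_dot (u v : 'rV[R]_n -> 'rV[R]_n) : R :=
  \int[mu]_(x in Omega)
    (dotv (curl u x) (curl v x) + dotv (u x) (v x)).

Definition Hcurl_norm (u : 'rV[R]_n -> 'rV[R]_n) : R :=
  Num.sqrt (Hcurl_dot u u).

(** * Tangential trace *)

Local Notation sigma := (surface_measure R n).

(* The square of the Sobolev-Slobodeckij norm of H^{1/2} of the boundary,     *)
(* whose dimension is n - 1: the exponent is (n - 1) + 2 * (1/2).             *)
Definition Hhalf_sq (m : nat) (g : 'rV[R]_n -> 'rV[R]_m) : \bar R :=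
  (\int[sigma]_(x in boundary Omega) (enorm (g x) ^+ 2)%:E
   + \int[sigma]_(x in boundary Omega) \int[sigma]_(y in boundary Omega)
       (enorm (g x - g y) ^+ 2 / enorm (x - y) ^+ n)%:E)%E.

Definition Hhalf (m : nat) : set ('rV[R]_n -> 'rV[R]_m) :=
  [set g : 'rV[R]_n -> 'rV[R]_m |
   (forall j, measurable_fun (boundary Omega : set (surface_type R n))
      ((fun x => g x 0 j) : surface_type R n -> R)) /\
   (Hhalf_sq g < +oo)%E].

Definition Hhalf_norm (m : nat) (g : 'rV[R]_n -> 'rV[R]_m) : R :=
  Num.sqrt (fine (Hhalf_sq g)).

(* w x n on the boundary, as an element of the dual of H^{1/2}.               *)
Definition smooth_trace (w : 'rV[R]_n -> 'rV[R]_n)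
    (g : 'rV[R]_n -> 'rV[R]_(curl_dim n)) : R :=
  \int[sigma]_(x in boundary Omega)
    dotv (cross (w x) (outward_normal Omega x)) (g x).

(* The extension of [smooth_trace] by continuity to H(curl): u has trace l    *)
(* when (u, l) is in the closure of the graph of [smooth_trace] for the norms *)
(* of H(curl) and of H^{-1/2}, the dual of H^{1/2}.                           *)
Definition tangential_trace (u : 'rV[R]_n -> 'rV[R]_n)
    (l : ('rV[R]_n -> 'rV[R]_(curl_dim n)) -> R) : Prop :=
  forall eps : R, 0 < eps -> exists w,
    [/\ smooth_field w, Hcurl_norm (u - w) < eps &
        forall g, Hhalf g ->
          `|smooth_trace w g - l g| <= eps * Hhalf_norm g].

Definition Hcurl0 : set ('rV[R]_n -> 'rV[R]_n) :=
  [set u | Hcurl u /\ tangential_trace u (fun _ => 0)].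

(** * Dirichlet eigenvectors *)

Definition dirichlet_eigenvector (phi : 'rV[R]_n -> R) : Prop :=
  H10 phi /\ exists lambda : R, forall v, H10 v ->
    \int[mu]_(x in Omega) dotv (grad phi x) (grad v x) =
    lambda * \int[mu]_(x in Omega) (phi x * v x).

End spaces.

(** * Orthonormal bases *)

(* e is orthonormal in H, and its finite linear combinations are dense in H   *)
(* for the norm of [dot].                                                     *)
Definition orthonormal_basis (R : realType) (V : lmodType R) (H : set V)
    (dot : V -> V -> R) (I : countType) (e : I -> V) : Prop :=
  [/\ forall i, H (e i),
      forall i j, dot (e i) (e j) = (i == j)%:R &
      forall v, H v -> forall eps : R, 0 < eps ->
        exists (s : seq I) (c : I -> R),
          let r := v - \sum_(i <- s) c i *: e i in Num.sqrt (dot r r) < eps].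

(* Main.v *)
From HB Require Import structures.
Require Import Defs.
From mathcomp Require Import all_boot all_order all_algebra.
From mathcomp Require Import all_classical all_reals all_analysis.
From mathcomp Require Import ring lra measurable_realfun.

Set Implicit Arguments.
Unset Strict Implicit.
Unset Printing Implicit Defensive.

Import Order.TTheory GRing.Theory Num.Theory.
Import numFieldNormedType.Exports.

Local Open Scope classical_set_scope.
Local Open Scope ring_scope.

(** The inclusion of H^1_0 into L^2 is compact, which gives an orthonormal basis
    of Dirichlet eigenvectors; gradients have no curl, so that the gradient is
    an isometry from H^1_0 onto its image in H(curl), which carries orthonormal
    bases to orthonormal bases.

    Let a(f, g) be the integral of grad f . grad g and b(f, g) that of f g.
    [spectral_theorem] is the abstract part: if a is complete and b is bounded
    by a and compact relative to a, then the quotient b(u, u) / a(u, u) attains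
    its supremum on the a-orthogonal complement of the eigenvectors found so
    far, and a maximiser is a new eigenvector. The eigenvalues tend to 0, so b
    vanishes on the limit of the residuals of any vector, and this limit is 0
    because b is definite. Functions are not identified when they agree almost
    everywhere, so all the forms are treated as semi-inner products.

    The hypotheses hold for H^1_0 of a bounded open set. Boundedness is the
    Friedrichs inequality [H10_bounded]. Compactness, [H10_compact], rests on
    [cell_inequality]: on a cube, the square integral of f is bounded by the
    squares of its integrals over finitely many cells, up to an arbitrarily
    small multiple of the square integral of the gradient. Both inequalities
    are proved for test functions and extended by density. Completeness,
    [H10_complete], follows from the Riesz-Fischer theorem. That a function
    determines its weak gradient is the fundamental lemma of the calculus of
    variations, proved by testing with bump functions and Dynkin's theorem.

    The curl of grad f, tested against psi, is the integral of f times a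
    difference of mixed second derivatives of psi, hence 0. Thus on gradients
    the inner product of H(curl) is that of L^2, and grad phi_k has norm 1. If
    test functions tend to f in H^1_0, their gradients tend to grad f in
    H(curl) and vanish on the boundary, hence the tangential trace of grad f
    is 0. *)

(** * Semi-inner products *)

Section semi_inner_products.
Context (R : realType) (V : lmodType R).
Implicit Types (H : set V) (a b : V -> V -> R) (x : nat -> V) (u v w : V).

Definition linear_subspace H : Prop :=
  H 0 /\ forall c u v, H u -> H v -> H (c *: u + v).

(** Only semidefinite, since functions that agree almost everywhere are kept
    distinct. *)
Definition semi_inner H a : Prop :=
  [/\ forall u v, H u -> H v -> a u v = a v u,
      forall c u v w, H u -> H v -> H w -> a (c *: u + v) w = c * a u w + a v w
    & forall u, H u -> 0 <= a u u].

Definition cauchy_for a x : Prop :=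
  forall eps : R, 0 < eps -> exists N, forall k l, (N <= k)%N -> (N <= l)%N ->
    a (x k - x l) (x k - x l) < eps.

Definition cvg_for a x u : Prop :=
  forall eps : R, 0 < eps -> exists N, forall k, (N <= k)%N ->
    a (x k - u) (x k - u) < eps.

Definition complete_for H a : Prop :=
  forall x, (forall k, H (x k)) -> cauchy_for a x ->
    exists2 u, H u & cvg_for a x u.

Definition bounded_for H a b : Prop :=
  exists C : R, 0 < C /\ forall u, H u -> b u u <= C * a u u.

(** Quantitative compactness of the inclusion of (H, a) into (H, b): up to an
    arbitrarily small multiple of a, the form b is controlled by finitely many
    bounded linear functionals. *)
Definition compact_for H a b : Prop :=
  forall eps : R, 0 < eps -> exists (K : finType) (l : K -> V -> R) (C : R),
    [/\ forall j u v, H u -> H v -> l j (u - v) = l j u - l j v,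
        forall j u, H u -> a u u <= 1 -> `|l j u| <= C
      & forall u, H u -> b u u <= \sum_j (l j u) ^+ 2 + eps * a u u].

Section theory.
Context H a (sH : linear_subspace H) (sa : semi_inner H a).

Lemma subspaceD u v : H u -> H v -> H (u + v).
Proof. by move=> Hu Hv; rewrite -[u]scale1r; apply: sH.2. Qed.

Lemma subspaceZ c u : H u -> H (c *: u).
Proof. by move=> Hu; rewrite -[_ *: _]addr0; apply: sH.2 => //; exact: sH.1. Qed.

Lemma subspaceN u : H u -> H (- u).
Proof. by move=> Hu; rewrite -scaleN1r; exact: subspaceZ. Qed.

Lemma subspaceB u v : H u -> H v -> H (u - v).
Proof. by move=> Hu Hv; apply: subspaceD => //; exact: subspaceN. Qed.

Lemma subspace_sum (I : Type) (s : seq I) (f : I -> V) :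
  (forall i, H (f i)) -> H (\sum_(i <- s) f i).
Proof.
move=> Hf; elim: s => [|i s ih]; first by rewrite big_nil; exact: sH.1.
by rewrite big_cons; exact: subspaceD.
Qed.

Lemma semi_innerC u v : H u -> H v -> a u v = a v u.
Proof. by case: sa => + _ _; exact. Qed.

Lemma semi_inner_ge0 u : H u -> 0 <= a u u.
Proof. by case: sa => _ _; exact. Qed.

Lemma semi_innerDl u v w : H u -> H v -> H w -> a (u + v) w = a u w + a v w.
Proof.
move=> Hu Hv Hw; case: sa => _ lin _.
by rewrite -[u in LHS]scale1r lin // mul1r.
Qed.

Lemma semi_inner0l u : H u -> a 0 u = 0.
Proof.
move=> Hu; have := semi_innerDl sH.1 sH.1 Hu.
by rewrite addr0 => /eqP; rewrite -subr_eq0 opprD addNKr oppr_eq0 => /eqP.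
Qed.

Lemma semi_innerZl c u v : H u -> H v -> a (c *: u) v = c * a u v.
Proof.
move=> Hu Hv; case: sa => _ lin _.
by rewrite -[_ *: _]addr0 lin ?semi_inner0l ?addr0 //; exact: sH.1.
Qed.

Lemma semi_innerNl u v : H u -> H v -> a (- u) v = - a u v.
Proof. by move=> Hu Hv; rewrite -scaleN1r semi_innerZl // mulN1r. Qed.

Lemma semi_innerBl u v w : H u -> H v -> H w -> a (u - v) w = a u w - a v w.
Proof.
by move=> Hu Hv Hw; rewrite semi_innerDl ?semi_innerNl //; exact: subspaceN.
Qed.

Lemma semi_innerDr u v w : H u -> H v -> H w -> a w (u + v) = a w u + a w v.
Proof.
move=> Hu Hv Hw; rewrite semi_innerC ?semi_innerDl ?(semi_innerC Hw) //.
exact: subspaceD.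
Qed.

Lemma semi_innerZr c u v : H u -> H v -> a u (c *: v) = c * a u v.
Proof.
by move=> Hu Hv; rewrite semi_innerC ?semi_innerZl ?(semi_innerC Hu) //;
  exact: subspaceZ.
Qed.

Lemma semi_innerBr u v w : H u -> H v -> H w -> a w (u - v) = a w u - a w v.
Proof.
by move=> Hu Hv Hw; rewrite semi_innerC ?semi_innerBl ?(semi_innerC Hw) //;
  exact: subspaceB.
Qed.

Lemma semi_inner_suml (I : Type) (s : seq I) (f : I -> V) u :
  (forall i, H (f i)) -> H u -> a (\sum_(i <- s) f i) u = \sum_(i <- s) a (f i) u.
Proof.
move=> Hf Hu; elim: s => [|i s ih]; first by rewrite !big_nil semi_inner0l.
by rewrite !big_cons semi_innerDl ?ih //; exact: subspace_sum.
Qed.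

Lemma semi_inner_sqrB u v : H u -> H v ->
  a (u - v) (u - v) = a u u - 2 * a u v + a v v.
Proof.
move=> Hu Hv; have HB := subspaceB Hu Hv.
rewrite semi_innerBl // !semi_innerBr // (semi_innerC Hv Hu).
by ring.
Qed.

Lemma semi_inner_sqrD u v : H u -> H v ->
  a (u + v) (u + v) = a u u + 2 * a u v + a v v.
Proof.
move=> Hu Hv; have HB := subspaceD Hu Hv.
rewrite semi_innerDl // !semi_innerDr // (semi_innerC Hv Hu).
by ring.
Qed.

Lemma semi_inner_leB u v : H u -> H v ->
  a (u - v) (u - v) <= 2 * a u u + 2 * a v v.
Proof.
move=> Hu Hv; have := semi_inner_ge0 (subspaceD Hu Hv).
by rewrite semi_inner_sqrB // semi_inner_sqrD //; lra.
Qed.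

Lemma semi_inner_leD u v : H u -> H v ->
  a (u + v) (u + v) <= 2 * a u u + 2 * a v v.
Proof.
move=> Hu Hv; have := semi_inner_ge0 (subspaceB Hu Hv).
by rewrite semi_inner_sqrB // semi_inner_sqrD //; lra.
Qed.

Lemma semi_inner_CS u v : H u -> H v -> (a u v) ^+ 2 <= a u u * a v v.
Proof.
move=> Hu Hv; have a0 := semi_inner_ge0 Hu; have b0 := semi_inner_ge0 Hv.
have key t : 0 <= t ^+ 2 * a u u - 2 * t * a u v + a v v.
  have /semi_inner_ge0 := subspaceB (subspaceZ t Hu) Hv.
  rewrite semi_inner_sqrB //; last exact: subspaceZ.
  rewrite !semi_innerZl // ?semi_innerZr //; last exact: subspaceZ.
  by rewrite expr2 !mulrA.
have [auu0|auu0] := eqVneq (a u u) 0.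
  rewrite auu0 mul0r; have [->|x0] := eqVneq (a u v) 0; first by rewrite expr0n.
  have := key ((1 + a v v) / a u v).
  by rewrite auu0 mulr0 add0r -mulrA mulfVK //; lra.
have := key (a u v / a u u).
have -> : (a u v / a u u) ^+ 2 * a u u - 2 * (a u v / a u u) * a u v + a v v
   = (a u u * a v v - (a u v) ^+ 2) / a u u by field.
by rewrite pmulr_lge0 ?invr_gt0 ?lt_def ?auu0 // subr_ge0.
Qed.

Lemma semi_inner_eq0 u v : H u -> H v -> a u u = 0 -> a u v = 0.
Proof.
move=> Hu Hv u0; have := semi_inner_CS Hu Hv; rewrite u0 mul0r.
by rewrite le_eqVlt ltNge sqr_ge0 orbF sqrf_eq0 => /eqP.
Qed.

Lemma semi_inner_congr u u' v : H u -> H u' -> H v ->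
  a (u - u') (u - u') = 0 -> a u v = a u' v.
Proof.
move=> Hu Hu' Hv z; apply/eqP; rewrite -subr_eq0 -semi_innerBl //.
by rewrite (semi_inner_eq0 (subspaceB Hu Hu') Hv z).
Qed.

End theory.
End semi_inner_products.

(** * The spectral theorem for a form that is compact relative to another *)

Section spectral.
Context (R : realType) (V : lmodType R).
Implicit Types (H K : set V) (a b : V -> V -> R) (x : nat -> V) (u v w : V).

Let inv_small (eps : R) : 0 < eps ->
  exists N, forall k, (N <= k)%N -> k.+1%:R^-1 < eps.
Proof.
move=> eps0; have [N hN] := ltr_add_invr (eps0 : 0 < eps).
exists N => k Nk; rewrite add0r in hN; apply: le_lt_trans hN.
by rewrite lef_pV2 ?posrE ?ltr0n // ler_nat ltnS.
Qed.

(** Along an ultrafilter finer than the filter at infinity, all the bounded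
    functionals, for all eps at once, converge; this replaces a diagonal
    extraction. *)
Lemma cauchy_subsequence H a b x : linear_subspace H -> semi_inner H a ->
  compact_for H a b -> (forall k, H (x k)) -> (forall k, a (x k) (x k) <= 1) ->
  exists2 s : nat -> nat, (forall k, k <= s k)%N & cauchy_for b (x \o s).
Proof.
move=> sH sa cab Hx ax.
have [U [UU sU]] := ultraFilterLemma eventually_filter.
have UP : ProperFilter U := @ultra_proper _ _ UU.
have small eps : 0 < eps -> exists2 A, U A & forall k l, A k -> A l ->
    b (x k - x l) (x k - x l) < eps.
  move=> eps0.
  (* The differences have a-norm at most 4, so that the remainder contributes at
     most eps / 4; the functionals will contribute another eps / 4. *)
  have [|I [l [C [lB lC bl]]]] := cab (eps / 16); first by lra.
  have lim j : exists p : R, l j \o x @ U --> p.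
    have UI : UltraFilter (l j \o x @ U).
      apply: Build_UltraFilter => G GP UG; rewrite predeqE => A; split; last exact: UG.
      move=> GA; have [//|UnA] := in_ultra_setVsetC ((l j \o x) @^-1` A) UU.
      have /UG GnA : (l j \o x @ U) (~` A) by [].
      by have /filter_ex[? []] : G (A `&` ~` A) by apply: filterI.
    have := @segment_compact R (- C) C; rewrite compact_ultra => /(_ _ UI) [].
      rewrite /fmap /=; apply: (filterS _ (filterT : U setT)) => k _ /=.
      by rewrite in_itv /= -ler_norml; exact: lC.
    by move=> p [_ /= hp]; exists p.
  have [p hp] := choice lim.
  pose d := Num.sqrt (eps / (16 * #|I|.+1%:R)).
  have d0 : 0 < d by rewrite sqrtr_gt0 divr_gt0 // mulr_gt0.
  have d2 : d ^+ 2 * #|I|%:R <= eps / 16.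
    rewrite sqr_sqrtr; last by rewrite divr_ge0 ?mulr_ge0 // ltW.
    have mM : #|I|%:R <= #|I|.+1%:R :> R by rewrite ler_nat.
    by rewrite mulrAC ler_pdivrMr ?mulr_gt0 //; nra.
  exists [set k | forall j, `|p j - l j (x k)| < d].
    apply: filter_forall => j.
    by have /cvgrPdist_lt /(_ d d0) := hp j.
  move=> k i hk hi; apply: (le_lt_trans (bl _ (subspaceB sH (Hx k) (Hx i)))).
  have : \sum_j l j (x k - x i) ^+ 2 <= \sum_(j in I) 4 * d ^+ 2.
    apply: ler_sum => j _; rewrite lB //.
    have := hk j; have := hi j; rewrite !ltr_norml => /andP[? ?] /andP[? ?].
    by nra.
  rewrite sumr_const -mulr_natr.
  have := semi_inner_leB sH sa (Hx k) (Hx i); have := ax k; have := ax i.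
  have := semi_inner_ge0 sa (subspaceB sH (Hx k) (Hx i)).
  move: (a _ _) (a _ _) (a _ _) d2 (\sum_j _) => A B D d2 S.
  by nra.
have pickA m : exists A : set nat, U A /\
    forall k l, A k -> A l -> b (x k - x l) (x k - x l) < m.+1%:R^-1.
  by have [|A UA hA] := small m.+1%:R^-1; [rewrite invr_gt0 | exists A].
have [A hA] := choice pickA.
have pick m : exists k, (m <= k)%N /\ forall i : 'I_m.+1, A i k.
  have : U ([set k | (m <= k)%N] `&` [set k | forall i : 'I_m.+1, A i k]).
    apply: filterI; first by apply: sU; exists m.
    by apply: filter_forall => i; case: (hA i).
  by move=> /filter_ex[k [h1 h2]]; exists k.
have [s hs] := choice pick; exists s; first by move=> k; case: (hs k).
move=> eps /inv_small[N hN]; exists N => k l Nk Nl.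
apply: lt_trans (hN N (leqnn _)); apply: (hA N).2.
- have Nk' : (N < k.+1)%N by rewrite ltnS.
  exact: ((hs k).2 (Ordinal Nk')).
- have Nl' : (N < l.+1)%N by rewrite ltnS.
  exact: ((hs l).2 (Ordinal Nl')).
Qed.

(** The quotient of b by a attains its supremum mu: since q := mu a - b is a
    semi-inner product, a maximising sequence that is Cauchy for b is Cauchy
    for a, and its limit lies in the kernel of q. *)
Lemma top_eigenvector K a b : linear_subspace K -> semi_inner K a ->
  semi_inner K b -> complete_for K a -> compact_for K a b -> bounded_for K a b ->
  ~ (forall v, K v -> b v v = 0) ->
  exists (e : V) (mu : R), [/\ K e, a e e = 1, 0 < mu,
    forall v, K v -> b e v = mu * a e v & forall v, K v -> b v v <= mu * a v v].
Proof.
move=> sK sa sb ca cab [C [C0 bC]] /existsNP[w /not_implyP[Kw bw]].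
have {}bw : 0 < b w w.
  by rewrite lt_neqAle eq_sym (semi_inner_ge0 sb Kw) andbT; apply/eqP.
have normalise u : K u -> 0 < a u u -> exists2 v, K v &
    a v v = 1 /\ b v v = b u u / a u u.
  move=> Ku au; exists ((Num.sqrt (a u u))^-1 *: u); first exact: subspaceZ.
  have Kc := subspaceZ sK (Num.sqrt (a u u))^-1 Ku.
  rewrite (semi_innerZl sK sa) // (semi_innerZr sK sa) // mulrA -expr2.
  rewrite (semi_innerZl sK sb) // (semi_innerZr sK sb) // mulrA -expr2.
  by rewrite exprVn sqr_sqrtr ?(ltW au) // mulVf ?gt_eqF // mulrC.
pose S : set R := [set r | exists2 u, K u & a u u = 1 /\ b u u = r].
have aw : 0 < a w w by have := bC w Kw; nra.
have S1 : S !=set0 by have [v Kv [v1 v2]] := normalise w Kw aw; exists (b v v), v.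
have SC : has_ubound S by exists C => _ [u Ku [u1 <-]]; have := bC u Ku; nra.
have supS : has_sup S by [].
pose mu := sup S.
have bmu v : K v -> b v v <= mu * a v v.
  move=> Kv; have [av|av] := eqVneq (a v v) 0.
    by have := bC v Kv; rewrite av !mulr0.
  have {}av : 0 < a v v by rewrite lt_neqAle eq_sym av (semi_inner_ge0 sa Kv).
  rewrite -ler_pdivrMr //; apply: ub_le_sup => //.
  by have [v' Kv' [? ?]] := normalise v Kv av; exists v'.
have mu0 : 0 < mu by have := bmu w Kw; nra.
pose q u v := mu * a u v - b u v.
have sq : semi_inner K q.
  split=> [u v Ku Kv|c u v z Ku Kv Kz|u Ku]; rewrite /q.
  - by rewrite (semi_innerC sa) // (semi_innerC sb).
  - by case: sa sb => _ -> // _ [_ -> // _]; ring.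
  - by rewrite subr_ge0 bmu.
have pick k : exists u, [/\ K u, a u u = 1 & q u u < k.+1%:R^-1].
  have [||r [u Ku [au <-]] hr] := @sup_adherent _ S k.+1%:R^-1; rewrite ?invr_gt0 //.
  by exists u; split=> //; rewrite /q au mulr1 ltrBlDl -ltrBlDr.
have [x hx] := choice pick.
have [||s sk bs] := cauchy_subsequence sK sa cab (x := x); try by move=> k; case: (hx k) => // ? ->.
have Kxs k : K (x (s k)) by case: (hx (s k)).
have qs k : q (x (s k)) (x (s k)) < k.+1%:R^-1.
  case: (hx (s k)) => _ _ h; apply: lt_le_trans h _.
  by rewrite lef_pV2 ?posrE ?ltr0n // ler_nat ltnS.
have as1 k : a (x (s k)) (x (s k)) = 1 by case: (hx (s k)).
have [e Ke xe] : exists2 e, K e & cvg_for a (x \o s) e.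
  apply: ca => [k|]; first exact: Kxs.
  move=> eps eps0.
  have [N1 h1] := bs (eps * mu / 2) ltac:(by rewrite divr_gt0 ?mulr_gt0).
  have [N2 h2] := @inv_small (eps * mu / 8) ltac:(by rewrite divr_gt0 ?mulr_gt0).
  exists (maxn N1 N2) => k l; rewrite !geq_max => /andP[k1 k2] /andP[l1 l2].
  rewrite /= -(ltr_pM2l mu0).
  have := h1 k l k1 l1; have := semi_inner_leB sK sq (Kxs k) (Kxs l).
  have := h2 k k2; have := h2 l l2; have := qs k; have := qs l; rewrite /q /=.
  move: (k.+1%:R^-1) (l.+1%:R^-1) (a _ _) (b _ _) (a _ _) (b _ _) (a _ _) (b _ _).
  by move=> ? ? ? ? ? ? ? ? ? ? ? ? ?; nra.
have ae0 : a e e != 0.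
  apply/eqP => ae0; have [|N /(_ N (leqnn N))/= hN] := xe (1 / 4); first by lra.
  have Kd := subspaceB sK (Kxs N) Ke.
  have := semi_inner_leD sK sa Kd Ke; rewrite subrK as1 ae0; lra.
have {}ae0 : 0 < a e e by rewrite lt_neqAle eq_sym ae0 (semi_inner_ge0 sa Ke).
have qe : q e e = 0.
  apply/eqP; rewrite eq_le (semi_inner_ge0 sq Ke) andbT; apply/ler_addgt0Pr => eps eps0.
  have [N1 h1] := xe (eps / (4 * mu)) ltac:(by rewrite divr_gt0 ?mulr_gt0).
  have [N2 h2] := @inv_small (eps / 4) ltac:(by rewrite divr_gt0).
  pose k := maxn N1 N2.
  have := h1 k (leq_maxl _ _); have := h2 k (leq_maxr _ _) => /= h3 h4.
  have Kd := subspaceB sK (Kxs k) Ke.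
  have qd : q (x (s k) - e) (x (s k) - e) <= mu * a (x (s k) - e) (x (s k) - e).
    by rewrite lerBlDr lerDl (semi_inner_ge0 sb Kd).
  have := semi_inner_leB sK sq (Kxs k) Kd; rewrite opprB addrC subrK.
  have := lt_trans (qs k) h3; move: h4; rewrite ltr_pdivlMr ?mulr_gt0 //.
  by lra.
have be v : K v -> b e v = mu * a e v.
  by move=> Kv; have /eqP := semi_inner_eq0 sK sq Ke Kv qe; rewrite subr_eq0 => /eqP.
have [e' Ke' [ae' _]] := normalise e Ke ae0.
pose c := (Num.sqrt (a e e))^-1.
exists (c *: e), mu; split=> //.
- exact: subspaceZ.
- rewrite (semi_innerZl sK sa) ?(semi_innerZr sK sa) //; last exact: subspaceZ.
  by rewrite mulrA -expr2 exprVn sqr_sqrtr ?(ltW ae0) // mulVf ?gt_eqF.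
- move=> v Kv; rewrite (semi_innerZl sK sb) // (semi_innerZl sK sa) // be //.
  by rewrite mulrCA.
Qed.

Section spectral_theorem.
Context H a b (sH : linear_subspace H) (sa : semi_inner H a)
  (sb : semi_inner H b) (ca : complete_for H a) (cab : compact_for H a b)
  (bC : bounded_for H a b) (inj : forall u, H u -> b u u = 0 -> a u u = 0).

Definition orthocomplement (s : seq V) : set V :=
  [set v | H v /\ forall e, e \in s -> a e v = 0].

Definition top_eigenvector_of (s : seq V) e : Prop :=
  exists mu, [/\ orthocomplement s e, a e e = 1, 0 < mu,
    forall v, orthocomplement s v -> b e v = mu * a e v
  & forall v, orthocomplement s v -> b v v <= mu * a v v].

(** The default value 0 stands for the end of the process, when b vanishes on
    the orthocomplement. *)
Definition next_eigenvector (s : seq V) : V :=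
  xget 0 [set e | top_eigenvector_of s e].

Fixpoint eigenvectors n : seq V :=
  if n is m.+1 then next_eigenvector (eigenvectors m) :: eigenvectors m
  else [::].

Let e n := next_eigenvector (eigenvectors n).
Let K n : set V := [set v | H v /\ forall k, (k < n)%N -> a (e k) v = 0].

Let KE n : orthocomplement (eigenvectors n) = K n.
Proof.
have mem n' (y : V) : (y \in eigenvectors n') <-> exists2 k, (k < n')%N & y = e k.
  elim: n' => [|m ih]; first by split=> // -[].
  rewrite /= inE; split.
    move=> /orP[/eqP ->|]; first by exists m.
    move/ih => [k km ->].
    by exists k => //; exact: ltnW.
  move=> [k]; rewrite ltnS leq_eqVlt => /orP[/eqP -> ->|km yk].
    by rewrite eqxx.
  by apply/orP; right; apply/ih; exists k.
apply/seteqP; split=> v [Hv hv]; split=> //.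
  by move=> k kn; apply: hv; apply/mem; exists k.
by move=> y /mem[k kn ->]; exact: hv.
Qed.

Let dichotomy n : (e n = 0 /\ forall v, K n v -> b v v = 0) \/
  exists mu, [/\ K n (e n), a (e n) (e n) = 1, 0 < mu,
    forall v, K n v -> b (e n) v = mu * a (e n) v
  & forall v, K n v -> b v v <= mu * a v v].
Proof.
have KH m v : K m v -> H v by case.
suff He : forall m, (forall k, (k < m)%N -> H (e k)) ->
    H (e m) /\ ((e m = 0 /\ forall v, K m v -> b v v = 0) \/
  exists mu, [/\ K m (e m), a (e m) (e m) = 1, 0 < mu,
    forall v, K m v -> b (e m) v = mu * a (e m) v
  & forall v, K m v -> b v v <= mu * a v v]).
  suff : forall m, forall k, (k < m)%N -> H (e k) by move=> h; case: (He n (h n)).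
  elim=> // m ih k; rewrite ltnS leq_eqVlt => /orP[/eqP->|]; last exact: ih.
  by case: (He m ih).
move=> m Hm.
have sK : linear_subspace (K m).
  split; first split; first exact: sH.1.
    move=> k km; rewrite (semi_innerC sa) ?(semi_inner0l sH sa) //; try exact: Hm.
    exact: sH.1.
  move=> c u v [Hu hu] [Hv hv]; split; first exact: sH.2.
  move=> k km; rewrite (semi_innerDr sH sa) ?(semi_innerZr sH sa) ?hu ?hv //;
    try exact: Hm; last exact: subspaceZ.
  by rewrite mulr0 addr0.
have restr c : semi_inner H c -> semi_inner (K m) c.
  by case=> h1 h2 h3; split=> [u v [? _] [? _]|? u v w [? _] [? _] [? _]|u [? _]]; auto.
have cK : complete_for (K m) a.
  move=> x Kx /ca[k|u Hu xu]; first exact: KH (Kx k).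
  exists u => //; split=> // k km.
  have : (a (e k) u) ^+ 2 <= 0.
    apply/ler_addgt0Pr => eps eps0.
    have Hk := Hm k km; have ek0 := semi_inner_ge0 sa Hk.
    have [|N /(_ N (leqnn N)) hN] := xu (eps / (1 + a (e k) (e k))).
      by rewrite divr_gt0 //; lra.
    have [HxN /(_ k km) hx] := Kx N.
    have := semi_inner_CS sH sa Hk (subspaceB sH HxN Hu).
    rewrite (semi_innerBr sH sa) // hx sub0r sqrrN add0r => /le_trans; apply.
    move: hN; rewrite ltr_pdivlMr; last by lra.
    have := semi_inner_ge0 sa (subspaceB sH HxN Hu); nra.
  by rewrite le_eqVlt ltNge sqr_ge0 orbF sqrf_eq0 => /eqP.
have cabK : compact_for (K m) a b.
  move=> eps /cab[p [l [C [h1 h2 h3]]]]; exists p, l, C; split.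
  - by move=> j u v /KH ? /KH ?; exact: h1.
  - by move=> j u /KH; exact: h2.
  - by move=> u /KH; exact: h3.
have bCK : bounded_for (K m) a b.
  by have [C [C0 h]] := bC; exists C; split=> // u /KH; exact: h.
have [b0|b0] := pselect (forall v, K m v -> b v v = 0).
  suff e0 : e m = 0 by split; [rewrite e0; exact: sH.1 | left].
  rewrite /e /next_eigenvector xgetPN // => v [mu [Kv v1 mu0 bv _]].
  have Kv' : K m v by rewrite -KE.
  by have := bv v Kv; rewrite v1 mulr1 b0 // => mu00; rewrite -mu00 ltxx in mu0.
have [v [mu [Kv v1 mu0 bv bv']]] :=
  top_eigenvector sK (restr a sa) (restr b sb) cK cabK bCK b0.
have : top_eigenvector_of (eigenvectors m) (e m).
  by apply: (@xgetPex _ 0 [set e | top_eigenvector_of (eigenvectors m) e]);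
    exists v; exists mu; rewrite KE.
move=> [nu]; rewrite KE => h; split; first by case: h => -[].
by right; exists nu.
Qed.

Let He n : H (e n).
Proof. by case: (dichotomy n) => [[-> _]|[mu [[]]]] //; exact: sH.1. Qed.

Let orth i j : a (e i) (e j) = (i == j)%:R * a (e i) (e i).
Proof.
have lt k l : (k < l)%N -> a (e k) (e l) = 0.
  move=> kl; case: (dichotomy l) => [[-> _]|[mu [[_ + _ _ _ _]]]]; last exact.
  by rewrite (semi_innerC sa) ?(semi_inner0l sH sa) //; exact: sH.1.
have [->|/eqP] := eqVneq i j; first by rewrite mul1r.
rewrite mul0r => /eqP; rewrite neq_ltn => /orP[/lt//|/lt].
by rewrite (semi_innerC sa).
Qed.

Let proj n v : V := \sum_(k < n) a (e k) v *: e k.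

Let H_proj n v : H (proj n v).
Proof. by apply: subspace_sum => // k; exact: subspaceZ. Qed.

Let K_proj n v : H v -> K n (v - proj n v).
Proof.
move=> Hv; split; first exact: subspaceB.
move=> k kn; rewrite (semi_innerBr sH sa) //.
rewrite (semi_innerC sa (He k) (H_proj n v)) (semi_inner_suml sH sa) //; last first.
  by move=> i; exact: subspaceZ.
rewrite (bigD1 (Ordinal kn)) //= big1 ?addr0; last first.
  move=> i ik; rewrite (semi_innerZl sH sa) // orth.
  suff -> : (i == k :> nat) = false by rewrite mul0r mulr0.
  by apply/negbTE; apply: contra ik => /eqP ik; apply/eqP/val_inj.
rewrite (semi_innerZl sH sa) //; case: (dichotomy k) => [[-> _]|[mu [_ -> _ _ _]]].
  by rewrite !(semi_inner0l sH sa) ?mulr0 ?subr0 //; exact: sH.1.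
by rewrite mulr1 subrr.
Qed.

(** The eigenvalue equation holds against the orthocomplement of the previous
    eigenvectors; against those themselves both sides vanish, by induction and
    symmetry. *)
Let eigen n : exists mu, forall v, H v -> b (e n) v = mu * a (e n) v.
Proof.
elim/ltn_ind: n => n ih.
case: (dichotomy n) => [[-> _]|[mu [Kn n1 mu0 bn _]]].
  by exists 0 => v Hv; rewrite (semi_inner0l sH sb) ?mul0r.
exists mu => v Hv; rewrite -[v](subrK (proj n v)).
have [Hr _] := K_proj n Hv.
have K0 c k : (k < n)%N -> semi_inner H c -> c (e k) (e n) = 0 ->
  c (e n) (a (e k) v *: e k) = 0.
  by move=> kn sc ck; rewrite (semi_innerZr sH sc) // (semi_innerC sc) // ck mulr0.
have proj0 c : semi_inner H c -> (forall k, (k < n)%N -> c (e k) (e n) = 0) ->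
    c (e n) (proj n v) = 0.
  move=> sc h; rewrite (semi_innerC sc) // (semi_inner_suml sH sc) //.
    by apply: big1 => k _; rewrite (semi_innerC sc) ?K0 ?h //; exact: subspaceZ.
  by move=> k; exact: subspaceZ.
have orthn k : (k < n)%N -> a (e k) (e n) = 0 by case: Kn => _; exact.
rewrite (semi_innerDr sH sa) // (semi_innerDr sH sb) // bn; last exact: K_proj.
rewrite (proj0 a) // (proj0 b) ?addr0 // => k kn.
by have [nu ->] := ih k kn; rewrite ?orthn ?mulr0.
Qed.

Let residual_pythagoras m n v : H v -> (m <= n)%N ->
  a (v - proj m v) (v - proj m v) = a (v - proj n v) (v - proj n v) +
    a (proj n v - proj m v) (proj n v - proj m v).
Proof.
move=> Hv mn; set r := v - proj n v.
have -> : v - proj m v = r + (proj n v - proj m v) by rewrite /r addrA subrK.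
have [Hr Kr] : K n r by exact: K_proj.
rewrite (semi_inner_sqrD sH sa) //; last exact: subspaceB.
have proj0 k : (k <= n)%N -> a r (proj k v) = 0.
  move=> kn; rewrite (semi_innerC sa) // (semi_inner_suml sH sa) //.
    apply: big1 => i _; rewrite (semi_innerZl sH sa) // Kr ?mulr0 //.
    exact: leq_trans (ltn_ord i) kn.
  by move=> i; exact: subspaceZ.
by rewrite (semi_innerBr sH sa) // !proj0 // subrr mulr0 addr0.
Qed.

(** The residuals converge, since their norms decrease to a limit. If every e n
    is nonzero, two far members of a b-Cauchy subsequence show that the
    eigenvalues b (e n) (e n) come arbitrarily close to 0, so that b vanishes on
    the limit of the residuals. *)
Let dense v (eps : R) : H v -> 0 < eps ->
  exists n, a (v - proj n v) (v - proj n v) < eps.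
Proof.
move=> Hv eps0; have [[n [n0 bn]]|/forallNP good] :=
  pselect (exists n, e n = 0 /\ forall v, K n v -> b v v = 0).
  by exists n; have Kr := K_proj n Hv; rewrite inj ?bn //; case: Kr.
have {}good n : exists mu, [/\ K n (e n), a (e n) (e n) = 1, 0 < mu,
    forall v, K n v -> b (e n) v = mu * a (e n) v
  & forall v, K n v -> b v v <= mu * a v v] by case: (dichotomy n) => // /good.
pose r n := v - proj n v.
have Hr n : H (r n) by case: (K_proj n Hv).
have [rl Hrl rlim] : exists2 u, H u & cvg_for a r u.
  apply: ca => // d d0.
  have hI : has_inf (range (fun n => a (r n) (r n))).
    split; first by exists (a (r 0) (r 0)); exists 0.
    by exists 0 => _ [n _ <-]; exact: (semi_inner_ge0 sa (Hr n)).
  have [_ [N _ <-] hN] := inf_adherent d0 hI.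
  have key k l : (N <= k)%N -> (k <= l)%N -> a (r k - r l) (r k - r l) < d.
    move=> Nk kl; have := residual_pythagoras Hv kl; rewrite -/(r k) -/(r l).
    have -> : proj l v - proj k v = r k - r l.
      by rewrite /r opprB [RHS]addrC addrA subrK.
    have /(ge_inf hI.2) : range (fun n => a (r n) (r n)) (a (r l) (r l)) by exists l.
    have := residual_pythagoras Hv Nk; rewrite -/(r N) -/(r k).
    have := semi_inner_ge0 sa (subspaceB sH (H_proj k v) (H_proj N v)).
    by lra.
  exists N => k l Nk Nl; have [kl|lk] := leqP k l; first exact: key.
  have Hlk := subspaceB sH (Hr l) (Hr k).
  rewrite -opprB (semi_innerNl sH sa) ?(semi_innerC sa Hlk) //;
    try exact: subspaceN.
  by rewrite (semi_innerNl sH sa) // opprK key // ltnW.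
have Krl n : K n rl.
  split=> // k kn; have : (a (e k) rl) ^+ 2 <= 0.
    apply/ler_addgt0Pr => d d0; have [N hN] := rlim d d0.
    have Nm := leq_maxl N k.+1; have km := leq_maxr N k.+1.
    have := semi_inner_CS sH sa (He k) (subspaceB sH (Hr (maxn N k.+1)) Hrl).
    have [_ /(_ k km) hk] := K_proj (maxn N k.+1) Hv.
    rewrite (semi_innerBr sH sa) // hk sub0r sqrrN add0r.
    have [mu [_ -> _ _ _]] := good k; rewrite mul1r => /le_trans; apply.
    by apply/ltW/hN.
  by rewrite le_eqVlt ltNge sqr_ge0 orbF sqrf_eq0 => /eqP.
have brl : b rl rl = 0.
  apply/eqP; rewrite eq_le (semi_inner_ge0 sb) // andbT.
  apply/ler_addgt0Pr => d d0; rewrite add0r.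
  have [k|s sk bs] := cauchy_subsequence sH sa cab He.
    by case: (good k) => mu [_ ->].
  have al := semi_inner_ge0 sa Hrl.
  have [|N hN] := bs (d / (1 + a rl rl)); first by rewrite divr_gt0 //; lra.
  pose M := maxn N (s N).+1.
  have NM : (s N < s M)%N by apply: leq_trans (sk M); exact: leq_maxr.
  have := hN N M (leqnn N) (leq_maxl _ _); rewrite /= (semi_inner_sqrB sH sb) //.
  have [mu1 [K1 n1 mu10 b1 h1]] := good (s N).
  have [mu2 [K2 n2 mu20 b2 h2]] := good (s M).
  rewrite (semi_innerC sb) // [b (e (s M)) (e (s N))](semi_innerC sb) //.
  have -> : b (e (s N)) (e (s M)) = 0.
    have [nu ->] := eigen (s N) => //.
    by case: K2 => _ ->; rewrite ?mulr0.
  rewrite b1 // b2 // n1 n2 !mulr1 mulr0 subr0 ltr_pdivlMr; last by lra.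
  have := h1 rl (Krl _); nra.
have arl := inj Hrl brl.
have [|N hN] := rlim (eps / 4); first by lra.
exists N; rewrite -/(r N); have := hN N (leqnn N).
have := semi_inner_leD sH sa (subspaceB sH (Hr N) Hrl) Hrl; rewrite subrK arl; lra.
Qed.

(** The family is indexed by the n with e n nonzero, which makes it finite or
    infinite as the dimension requires. *)
Theorem spectral_theorem : exists (I : countType) (phi : I -> V),
  orthonormal_basis H a phi /\
  forall k, exists lambda, forall v, H v -> a (phi k) v = lambda * b (phi k) v.
Proof.
exists {n : nat | a (e n) (e n) == 1}, (fun i => e (val i)); split; last first.
  move=> [n /= /eqP n1]; have [mu hmu] := eigen n; exists mu^-1 => v Hv.
  rewrite hmu // mulrA mulVf ?mul1r //; apply/eqP => mu0.
  have := hmu _ (He n); rewrite mu0 mul0r => /(inj (He n)).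
  by rewrite n1 => /eqP; rewrite oner_eq0.
split=> [i|i j|v Hv eps eps0]; first exact: He.
  rewrite orth val_eqE; have [->|] := eqVneq i j; last by rewrite mul0r.
  by rewrite mul1r; exact/eqP/(valP j).
have [|N hN] := @dense v (eps ^+ 2) Hv; first exact: exprn_gt0.
exists (pmap insub (iota 0 N)), (fun i => a (e (val i)) v) => /=.
set S := \sum_(_ <- _) _; suff -> : S = proj N v.
  by rewrite -[ltRHS](ger0_norm (ltW eps0)) -sqrtr_sqr ltr_sqrt // exprn_gt0.
rewrite /S /proj -(big_mkord xpredT (fun k => a (e k) v *: e k)) /index_iota subn0.
elim: (iota 0 N) => [|k t ih]; first by rewrite !big_nil.
rewrite /= big_cons -ih; case: insubP => [i _ <-|] /=; first by rewrite big_cons.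
case: (dichotomy k) => [[-> _ _]|[mu [_ ->]]]; last by rewrite eqxx.
by rewrite scaler0 add0r.
Qed.

End spectral_theorem.
End spectral.

(** * Boxes, measurability and Fubini's theorem in R^n *)

Section measurable_rV.
Context (R : realType) (n : nat).
Implicit Types (a b x : 'rV[R]_n) (U : set 'rV[R]_n).

Definition open_box a b : set 'rV[R]_n :=
  [set x | forall i, a 0 i < x 0 i < b 0 i].

Definition closed_box a b : set 'rV[R]_n :=
  [set x | forall i, a 0 i <= x 0 i <= b 0 i].

Lemma measurable_coord (i : 'I_n) :
  measurable_fun setT (fun x : 'rV[R]_n => x 0 i : measurableTypeR R).
Proof.
move=> _ B mB; rewrite setTI; apply: sub_sigma_algebra.
by exists 0, i, B.
Qed.

Lemma measurable_forall_coord (B : 'I_n -> set R) :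
  (forall i, measurable (B i)) -> measurable [set x : 'rV[R]_n | forall i, B i (x 0 i)].
Proof.
move=> mB.
have -> : [set x : 'rV[R]_n | forall i, B i (x 0 i)] =
    \bigcap_(i in [set: 'I_n]) [set x : 'rV[R]_n | B i (x 0 i)].
  by apply/seteqP; split=> x /= h i; [move=> _|]; exact: h.
apply: fin_bigcap_measurable => [|i _]; first exact: finite_finset.
by rewrite -[X in measurable X]setTI; exact: (measurable_coord i) measurableT _ (mB i).
Qed.

Lemma measurable_open_box a b : measurable (open_box a b).
Proof.
apply: (@measurable_forall_coord (fun i => [set t | a 0 i < t < b 0 i])) => i.
rewrite [X in measurable X](_ : _ = `]a 0 i, b 0 i[%classic); first exact: measurable_itv.
by apply/seteqP; split=> t; rewrite /= in_itv.
Qed.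

Lemma measurable_closed_box a b : measurable (closed_box a b).
Proof.
apply: (@measurable_forall_coord (fun i => [set t | a 0 i <= t <= b 0 i])) => i.
rewrite [X in measurable X](_ : _ = `[a 0 i, b 0 i]%classic); first exact: measurable_itv.
by apply/seteqP; split=> t; rewrite /= in_itv.
Qed.

(** The box is rational so that countably many suffice, and its closure lies in
    U so that it supports bump functions. *)
Lemma open_rational_box U x : open U -> U x ->
  exists pq : 'rV[rat]_n * 'rV[rat]_n,
    open_box (map_mx ratr pq.1) (map_mx ratr pq.2) x /\
    closed_box (map_mx ratr pq.1) (map_mx ratr pq.2) `<=` U.
Proof.
move=> oU Ux; have /nbhs_ballP[e /= e0 eU] : nbhs x U by exact: open_nbhs_nbhs.
have pick1 i : exists q : rat, x 0 i - e < ratr q < x 0 i.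
  have [|q] := @rat_in_itvoo R (x 0 i - e) (x 0 i); first by rewrite gtrBl.
  by rewrite in_itv; exists q.
have pick2 i : exists q : rat, x 0 i < ratr q < x 0 i + e.
  have [|q] := @rat_in_itvoo R (x 0 i) (x 0 i + e); first by rewrite ltrDl.
  by rewrite in_itv; exists q.
have [p hp] := choice pick1; have [q hq] := choice pick2.
exists (\row_i p i, \row_i q i); split=> [i|y hy] /=.
  by rewrite !mxE; have /andP[_ ->] := hp i; have /andP[-> _] := hq i.
apply: eU; split=> // i j; have := hy j; rewrite !mxE (ord1 i) => /andP[h1 h2].
have /andP[h3 h4] := hp j; have /andP[h5 h6] := hq j.
by rewrite /ball /= ltr_norml; apply/andP; split; lra.
Qed.

Lemma open_rV_measurable U : open U -> measurable U.
Proof.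
move=> oU; pose box (pq : 'rV[rat]_n * 'rV[rat]_n) : set 'rV[R]_n :=
  open_box (map_mx ratr pq.1) (map_mx ratr pq.2).
rewrite (_ : U = \bigcup_pq (if `[< box pq `<=` U >] then box pq else set0)).
  apply: countable_bigcupT_measurable; first exact: countableP.
  by move=> pq; case: ifP => // _; exact: measurable_open_box.
apply/seteqP; split=> x; last by move=> [pq _]; case: asboolP => // + h; exact.
move=> Ux; have [pq [h1 h2]] := open_rational_box oU Ux.
exists pq => //; case: asboolP => // -[]; apply: (subset_trans _ h2) => y hy i.
by have /andP[/ltW -> /ltW ->] := hy i.
Qed.

Lemma continuous_rV_measurable (f : 'rV[R]_n -> R) :
  continuous f -> measurable_fun setT f.
Proof.
move=> /continuousP cf; apply: (measurability _ (measurable_realfun.RGenOpens.measurableE R)).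
move=> _ [_ [a [b ->] <-]]; rewrite setTI; apply: open_rV_measurable.
exact/cf/interval_open.
Qed.

Lemma coord_le_norm x i : `|x 0 i| <= `|x|.
Proof.
rewrite [leRHS]/Num.norm /= mx_normrE.
exact: (le_bigmax _ (fun ij : 'I_1 * 'I_n => `|x ij.1 ij.2|) (0, i)).
Qed.

End measurable_rV.

Section sigma_finite.
Context (R : realType).

Definition cube n (L : R) : set 'rV[R]_n := [set x | forall i, - L <= x 0 i <= L].
Arguments cube : clear implicits.

Lemma measurable_cube n L : measurable (cube n L).
Proof.
rewrite (_ : cube n L = closed_box (const_mx (- L)) (const_mx L)).
  exact: measurable_closed_box.
by apply/seteqP; split=> x h i; have := h i; rewrite !mxE.
Qed.

Lemma row_snoc_lift n (x : 'rV[R]_n) t i : row_snoc (x, t) 0 (lift ord_max i) = x 0 i.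
Proof. by rewrite mxE liftK. Qed.

Lemma row_snoc_max n (x : 'rV[R]_n) t : row_snoc (x, t) 0 ord_max = t.
Proof. by rewrite mxE unlift_none. Qed.

Lemma cubeS n L : (@row_snoc R n) @^-1` cube n.+1 L = cube n L `*` `[- L, L]%classic.
Proof.
apply/seteqP; split=> -[x t] /=.
  move=> h; split=> [i /=|]; first by have := h (lift ord_max i); rewrite row_snoc_lift.
  by have := h ord_max; rewrite row_snoc_max in_itv.
move=> -[h]; rewrite /= in_itv /= => ht i.
by case: (unliftP ord_max i) => [j|] ->; rewrite ?row_snoc_lift ?row_snoc_max.
Qed.

Lemma cube_lty n L : (lebesgue_rV R n (cube n L) < +oo)%E.
Proof.
elim: n => [|n ih] /=; first by rewrite /dirac indicE ltry.
rewrite /measure_snoc /pushforward cubeS product_measure1E //; last exact: measurable_cube.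
by rewrite lte_mul_pinfty // ?ge0_fin_numE //= lebesgue_measure_itv; case: ifP => _; rewrite ?ltry //= -?EFinB ltry.
Qed.

Lemma sigma_finite_lebesgue_rV n : sigma_finite setT (lebesgue_rV R n).
Proof.
exists (fun k => cube n k%:R).
  apply/seteqP; split=> // x _; exists (Num.bound `|x|) => // i.
  rewrite -ler_norml; apply: le_trans (coord_le_norm x i) _.
  exact/ltW/archi_boundP.
by move=> k; split; [exact: measurable_cube|exact: cube_lty].
Qed.

(** The same set function as [lebesgue_rV], under a name that can carry the
    sigma-finite structure required by Fubini's theorem. *)
Definition sigma_finite_rV n : set 'rV[R]_n -> \bar R := lebesgue_rV R n.
Arguments sigma_finite_rV : clear implicits.

HB.instance Definition _ n := Measure.on (sigma_finite_rV n).
HB.instance Definition _ n := Measure_isSigmaFinite.Build _ _ _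
  (sigma_finite_rV n) (sigma_finite_lebesgue_rV n).

Local Open Scope ereal_scope.

Lemma measurable_snoc_comp n d (T : measurableType d) (f : 'rV[R]_n.+1 -> T) :
  measurable_fun setT f -> measurable_fun setT (f \o @row_snoc R n).
Proof. by move=> mf; apply: measurableT_comp => //; exact: measurable_row_snoc. Qed.

Lemma measurable_snocr n (x : 'rV[R]_n) :
  measurable_fun setT (fun t : measurableTypeR R => row_snoc (x, t)).
Proof.
apply: (measurableT_comp (@measurable_row_snoc R n)).
exact: measurable_pair1.
Qed.

Section fubini.
Context n (f : 'rV[R]_n.+1 -> \bar R).
Local Notation mu := (lebesgue_rV R).

Lemma ge0_integral_snocE : measurable_fun setT f -> (forall x, 0 <= f x) ->
  \int[mu n.+1]_x f x = \int[(mu n \x @lebesgue_measure R)]_p f (row_snoc p).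
Proof.
move=> mf f0.
by rewrite /= /measure_snoc ge0_integral_pushforward //; exact: measurable_row_snoc.
Qed.

Lemma ge0_integral_snoc12 : measurable_fun setT f -> (forall x, 0 <= f x) ->
  \int[mu n.+1]_x f x = \int[mu n]_x \int[@lebesgue_measure R]_t f (row_snoc (x, t)).
Proof.
move=> mf f0; rewrite ge0_integral_snocE //.
rewrite (@fubini_tonelli1 _ _ _ _ _ (sigma_finite_rV n)) //=.
exact: measurable_snoc_comp.
Qed.

Lemma ge0_integral_snoc21 : measurable_fun setT f -> (forall x, 0 <= f x) ->
  \int[mu n.+1]_x f x = \int[@lebesgue_measure R]_t \int[mu n]_x f (row_snoc (x, t)).
Proof.
move=> mf f0; rewrite ge0_integral_snocE //.
rewrite (@fubini_tonelli2 _ _ _ _ _ (sigma_finite_rV n)) //=.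
exact: measurable_snoc_comp.
Qed.

Lemma integrable_snocE : (mu n.+1).-integrable setT f ->
  (mu n \x @lebesgue_measure R).-integrable setT (f \o @row_snoc R n).
Proof.
move=> /integrableP[mf fi]; apply/integrableP; split; first exact: measurable_snoc_comp.
move: fi; rewrite /= /measure_snoc ge0_integral_pushforward //.
  exact: measurable_row_snoc.
exact: measurableT_comp.
Qed.

Lemma integral_snoc12 : (mu n.+1).-integrable setT f ->
  \int[mu n.+1]_x f x = \int[mu n]_x \int[@lebesgue_measure R]_t f (row_snoc (x, t)).
Proof.
move=> fi; have := @integral12_prod_meas1 _ _ _ _ _ (sigma_finite_rV n) _ _ (integrable_snocE fi).
rewrite /fubini_F => ->.
rewrite /= /measure_snoc integral_pushforward //.
- exact: measurable_row_snoc.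
- by case/integrableP: fi.
- exact: integrable_snocE.
Qed.

Lemma integral_snoc21 : (mu n.+1).-integrable setT f ->
  \int[mu n.+1]_x f x = \int[@lebesgue_measure R]_t \int[mu n]_x f (row_snoc (x, t)).
Proof.
move=> fi; have := @integral21_prod_meas1 _ _ _ _ _ (sigma_finite_rV n) _ _ (integrable_snocE fi).
rewrite /fubini_G => ->.
rewrite /= /measure_snoc integral_pushforward //.
- exact: measurable_row_snoc.
- by case/integrableP: fi.
- exact: integrable_snocE.
Qed.
End fubini.

End sigma_finite.
Arguments cube {R} n L.
Arguments sigma_finite_rV R n : clear implicits.

(** * Square-integrable functions *)

Section square_integrable.
Context d (T : measurableType d) (R : realType).
Context (mu : {measure set T -> \bar R}) (D : set T) (mD : measurable D).
Implicit Types (f g : T -> R).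

Definition sq_integrable : set (T -> R) :=
  [set f : T -> R | measurable_fun D f /\ mu.-integrable D (EFin \o (fun x => f x ^+ 2))].

Definition int_mul f g : R := \int[mu]_(x in D) (f x * g x).

Lemma sq_integrable_mul f g : sq_integrable f -> sq_integrable g ->
  mu.-integrable D (EFin \o (fun x => f x * g x)).
Proof.
move=> [mf f2] [mg g2].
have := @integrableD _ _ _ mu D mD _ _ f2 g2; apply: le_integrable => //.
  by apply/measurable_EFinP; exact: measurable_funM.
move=> x Dx; rewrite /= lee_fin [leRHS]ger0_norm ?addr_ge0 ?sqr_ge0 //.
by rewrite ler_norml; apply/andP; split; nra.
Qed.

Lemma sq_integrable_subspace : linear_subspace sq_integrable.
Proof.
split.
  split; first exact: measurable_cst.
  rewrite (_ : _ \o _ = cst 0%E); first exact: integrable0.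
  by apply/funext => x /=; rewrite expr0n.
move=> c f g [mf f2] [mg g2].
have mfg : measurable_fun D (c *: f + g).
  by apply: measurable_funD => //; exact: measurable_funM.
split=> //.
have i1 := @integrableZl _ _ _ mu D mD (2 * c ^+ 2) _ f2.
have i2 := @integrableZl _ _ _ mu D mD 2 _ g2.
have := @integrableD _ _ _ mu D mD _ _ i1 i2; apply: le_integrable => //.
  by apply/measurable_EFinP; exact: measurable_funX.
have key (a b : R) : (c * a + b) ^+ 2 <= 2 * c ^+ 2 * a ^+ 2 + 2 * b ^+ 2.
  by have := sqr_ge0 (c * a - b); nra.
move=> x Dx; rewrite /= lee_fin ger0_norm ?sqr_ge0 //.
exact: le_trans (key (f x) (g x)) (ler_norm _).
Qed.

Lemma int_mul_semi_inner : semi_inner sq_integrable int_mul.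
Proof.
split=> [f g Hf Hg|c f g h Hf Hg Hh|f Hf].
- by apply: eq_Rintegral => x _; rewrite mulrC.
- rewrite /int_mul -RintegralZl //; last exact: sq_integrable_mul.
  rewrite -RintegralD //; last exact: sq_integrable_mul.
    by apply: eq_Rintegral => x _; rewrite mulrDl -mulrA.
  exact: (@integrableZl _ _ _ mu D mD c _ (sq_integrable_mul Hf Hh)).
- by apply: Rintegral_ge0 => x _; rewrite -expr2 sqr_ge0.
Qed.

Lemma int_mul_sqrE f : sq_integrable f ->
  (\int[mu]_(x in D) (f x ^+ 2)%:E)%E = (int_mul f f)%:E.
Proof.
move=> [mf f2]; rewrite /int_mul /Rintegral fineK; first by [].
by apply: integrable_fin_num => //; have := f2; apply: eq_integrable.
Qed.

Lemma sq_integrable_le f (C : R) : measurable_fun D f ->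
  (\int[mu]_(x in D) (f x ^+ 2)%:E <= C%:E)%E ->
  sq_integrable f /\ int_mul f f <= C.
Proof.
move=> mf fC; suff Hf : sq_integrable f by split=> //; rewrite -lee_fin -int_mul_sqrE.
split=> //; apply/integrableP; split.
  by apply/measurable_EFinP; exact: measurable_funX.
apply: le_lt_trans (ltry C); apply: le_trans fC.
apply: ge0_le_integral => //=.
- apply/measurable_EFinP; apply: measurableT_comp; first exact: normr_measurable.
  exact: measurable_funX.
- by apply/measurable_EFinP; exact: measurable_funX.
- by move=> x _; rewrite lee_fin ger0_norm ?sqr_ge0.
Qed.

(** The Riesz-Fischer theorem: if the steps of the sequence decrease
    geometrically, the weighted sum of their squares is integrable, hence finite
    almost everywhere, which forces pointwise convergence; Fatou's lemma turns
    this into convergence in mean square. *)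
Theorem sq_integrable_complete : complete_for sq_integrable int_mul.
Proof.
move=> u Hu cu.
have sH := sq_integrable_subspace; have sa := int_mul_semi_inner.
(* Squared steps below 8^-m remain summable with the weights 4^m, which in turn
   bound each step by a multiple of 2^-m. *)
have step m : exists N, forall k l, (N <= k)%N -> (N <= l)%N ->
    int_mul (u k - u l) (u k - u l) < (8 ^+ m)^-1.
  by apply: cu; rewrite invr_gt0 exprn_gt0.
have [N hN] := choice step.
pose s m := (m + \sum_(i < m.+1) N i)%N.
have Ns m : (N m <= s m)%N by rewrite /s big_ord_recr /= addnA leq_addl.
have sS m : (s m <= s m.+1)%N.
  by rewrite /s leq_add // [leqRHS]big_ord_recr /= leq_addr.
pose v m := u (s m); have Hv m : sq_integrable (v m) by exact: Hu.
pose w m x := v m.+1 x - v m x.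
have Hw m : sq_integrable (w m) by exact: (subspaceB sH (Hv m.+1) (Hv m)).
have wle m : int_mul (w m) (w m) <= (8 ^+ m)^-1.
  by apply/ltW/hN; [exact: leq_trans (Ns m) (sS m)|exact: Ns].
pose F x := (\sum_(m <oo) (4 ^+ m * w m x ^+ 2)%:E)%E.
have mw2 m : measurable_fun D (fun x => (4 ^+ m * w m x ^+ 2)%:E).
  apply/measurable_EFinP; apply: measurable_funM.
    exact: measurable_cst.
  by apply: measurable_funX; have [] := Hw m.
have F0 m x : D x -> (0 <= (4 ^+ m * w m x ^+ 2)%:E)%E.
  by move=> _; rewrite lee_fin mulr_ge0 ?sqr_ge0 ?exprn_ge0.
have iF : mu.-integrable D F.
  apply/integrableP; split.
    apply: (ge0_emeasurable_sum (P := xpredT)) => [k x Dx _|k _ //]; exact: F0.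

  rewrite (eq_integral F); last first.
    by move=> x /set_mem Dx; rewrite gee0_abs //; apply: nneseries_ge0 => m _ _; exact: F0.
  rewrite integral_nneseries //.
  apply: (@le_lt_trans _ _ (\sum_(m <oo) ((2^-1) ^+ m)%:E)%E).
    apply: lee_nneseries => [m _ _|m _]; first by apply: integral_ge0 => x; exact: F0.
    under eq_integral do rewrite EFinM.
    rewrite ge0_integralZl //; last 2 first.
    - by apply/measurable_EFinP; apply: measurable_funX; case: (Hw m).
    - by move=> x _; rewrite lee_fin sqr_ge0.
    rewrite int_mul_sqrE // -EFinM lee_fin.
    have -> : (2^-1 : R) ^+ m = 4 ^+ m * (8 ^+ m)^-1.
      by rewrite -exprVn -exprMn; congr (_ ^+ _); field.
    by rewrite ler_pM2l ?exprn_gt0.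
  have cg : cvgn (series (geometric 1 (2^-1 : R))).
    by apply: is_cvg_geometric_series; rewrite ger0_norm ?invf_lt1 ?invr_ge0 ?ltr1n.
  rewrite (_ : (fun n => _) = EFin \o series (geometric 1 (2^-1 : R))); last first.
    apply/funext => n /=; rewrite /series /= -sumEFin.
    by apply: eq_bigr => i _; rewrite /geometric /= mul1r.
  by rewrite EFin_lim // ltry.
pose lim0 x := limn_esup (fun m => (v m x)%:E).
pose f x := fine (lim0 x).
have mf : measurable_fun D f.
  apply: (measurableT_comp (@fine_measurable R setT measurableT)).
  by apply: measurable_fun_limn_esup => m; apply/measurable_EFinP; case: (Hv m).
have cvgv : {ae mu, forall x, D x -> v ^~ x @ \oo --> f x}.
  apply: filterS (integrable_ae mD iF) => x Fx Dx.
  have {}Fx := Fx Dx.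
  suff : cvgn (v ^~ x).
    move=> cx; suff -> : f x = limn (v ^~ x) by [].
    have cE : (EFin \o (v ^~ x)) @ \oo --> (limn (v ^~ x))%:E.
      by apply: cvg_EFin; first exact: nearW.
    by rewrite /f /lim0; have [_ ->] := cvg_limn_einf_sup cE.
  have -> : v ^~ x = (fun n => series (w ^~ x) n + v 0%N x).
    apply/funext => n; rewrite /series /= /w telescope_sumr // subrK //.
  apply: is_cvgD; last exact: is_cvg_cst.
  apply: normed_cvg; pose C := fine (F x).
  have wC m : `|w m x| <= (1 + C) * 2^-1 ^+ m.
    have h : ((4 ^+ m * w m x ^+ 2)%:E <= F x)%E.
      apply: le_trans (@nneseries_lim_ge R _ xpredT 0%N m.+1 _); last first.
        by move=> n _ _; exact: F0.
      by rewrite big_nat_recr //= leeDr // sume_ge0 // => i _; exact: F0.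
    have C0 : 0 <= C by apply: fine_ge0; apply: nneseries_ge0 => n _ _; exact: F0.
    have hC : w m x ^+ 2 <= C * (2^-1 ^+ m) ^+ 2.
      move: h; rewrite -(fineK Fx) lee_fin -/C => h.
      have -> : (2^-1 ^+ m) ^+ 2 = (4 ^+ m)^-1 :> R.
        by rewrite -exprM mulnC exprM -exprVn; congr (_ ^+ _); field.
      by rewrite ler_pdivlMr ?exprn_gt0 // mulrC.
    have p0 : 0 <= 2^-1 ^+ m :> R by rewrite exprn_ge0 ?invr_ge0.
    rewrite -(@ler_pXn2r _ 2) ?nnegrE ?normr_ge0 ?mulr_ge0 ?addr_ge0 //.
    rewrite real_normK ?num_real // exprMn; apply: le_trans hC _.
    by rewrite ler_wpM2r ?sqr_ge0 //; nra.
  apply: (series_le_cvg _ _ wC) => [n|n|].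
  - exact: normr_ge0.
  - by apply: le_trans (wC n).
  - apply: (@is_cvg_geometric_series _ (1 + C)).
    by rewrite ger0_norm ?invf_lt1 ?invr_ge0 ?ltr1n.
have sle (eps : R) n : (forall k l, (n <= k)%N -> (n <= l)%N ->
    int_mul (u k - u l) (u k - u l) <= eps) ->
    forall k, (n <= k)%N -> sq_integrable (u k - f) /\
      int_mul (u k - f) (u k - f) <= eps.
  move=> hn k nk; have [mk _] := Hu k.
  have mkf : measurable_fun D (u k - f) by exact: measurable_funB.
  apply: sq_integrable_le => //.
  have mvk m : measurable_fun D (fun x => ((u k x - v m x) ^+ 2)%:E).
    apply/measurable_EFinP; apply: measurable_funX; apply: measurable_funB => //.
    by case: (Hv m).
  apply: (@le_trans _ _ (\int[mu]_(x in D)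
      limn_einf (fun m => ((u k x - v m x) ^+ 2)%:E))%E).
    apply: ae_ge0_le_integral => //.
    - by move=> x _; rewrite lee_fin sqr_ge0.
    - by apply/measurable_EFinP; exact: measurable_funX.
    - move=> x _; rewrite limn_einf_lim; apply: lime_ge; first exact: is_cvg_einfs.
      by near=> m; apply: le_ereal_inf_tmp => _ [i _ <-]; rewrite lee_fin sqr_ge0.
    - rewrite /limn_einf; apply: measurableT_comp => //.
      apply: (measurable_fun_limn_esup
        (f := fun m x => (- ((u k x - v m x) ^+ 2)%:E)%E)) => m.
      exact: measurableT_comp.
    apply: filterS cvgv => x cx Dx.
    have cE : (fun m => ((u k x - v m x) ^+ 2)%:E) @ \oo --> ((u k x - f x) ^+ 2)%:E.
      apply: cvg_EFin; first exact: nearW.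
      by rewrite /comp /= expr2; apply: cvgM; (apply: cvgB; [exact: cvg_cst|exact: cx]).
    by have [-> _] := cvg_limn_einf_sup cE.
  have pos m x : D x -> (0 <= ((u k x - v m x) ^+ 2)%:E)%E.
    by move=> _; rewrite lee_fin sqr_ge0.
  apply: (le_trans (fatou mu mD mvk pos)).
  rewrite limn_einf_lim; apply: lime_le; first exact: is_cvg_einfs.
  near=> m; apply: (@le_trans _ _ (int_mul (u k - v (maxn m n)) (u k - v (maxn m n)))%:E).
    apply: ereal_inf_lbound; exists (maxn m n); first exact: leq_maxl.
    by rewrite -int_mul_sqrE //; exact: (subspaceB sH (Hu k) (Hv _)).
  rewrite lee_fin hn // /s; apply: leq_trans (leq_addr _ _); exact: leq_maxr.
have Hf : sq_integrable f.
  have [M hM] := cu 1 ltr01.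
  have hM1 k l : (M <= k)%N -> (M <= l)%N -> int_mul (u k - u l) (u k - u l) <= 1.
    by move=> ? ?; exact/ltW/hM.
  have [h _] := sle 1 M hM1 M (leqnn M).
  by rewrite -[f](subKr (u M)); exact: (subspaceB sH (Hu M) h).
exists f => // eps eps0; have [|M hM] := cu (eps / 2); first by rewrite divr_gt0.
exists M => k Mk; apply: (@le_lt_trans _ _ (eps / 2)); last by lra.
by apply: (sle _ M _ k Mk).2 => // i j Mi Mj; exact/ltW/hM.
Unshelve. all: by end_near. Qed.

End square_integrable.

(** * Continuously differentiable functions *)

Section continuously_differentiable.
Context (R : realType).
Implicit Types (n : nat).

Definition C1 n (f : 'rV[R]_n -> R) : Prop :=
  continuous f /\
  forall i, (forall x, derivable f x (unit_vec R i)) /\ continuous (partial i f).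

Lemma smooth_C1 n (f : 'rV[R]_n -> R) : smooth f -> C1 f.
Proof.
move=> sf; split; first by case: (sf [::]).
by move=> i; split; [case: (sf [::])|case: (sf [:: i])].
Qed.

Lemma continuous_snocl n (t : R) : continuous (fun x : 'rV[R]_n => row_snoc (x, t)).
Proof.
move=> x A /nbhs_ballP[e /= e0 eA]; apply/nbhs_ballP; exists e => //.
move=> y [_ hy]; apply: eA; split=> // i j; rewrite !mxE.
by case: (unlift _ _) => [k|] /=; [exact: hy|exact: ballxx].
Qed.

Lemma continuous_snocr n (x : 'rV[R]_n) : continuous (fun t : R => row_snoc (x, t)).
Proof.
move=> t A /nbhs_ballP[e /= e0 eA]; apply/nbhs_ballP; exists e => //.
move=> y hy; apply: eA; split=> // i j; rewrite !mxE.
by case: (unlift _ _) => [k|] /=; [exact: ballxx|exact: hy].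
Qed.

Lemma row_snocDl n (x : 'rV[R]_n) t h j :
  row_snoc (h *: unit_vec R j + x, t) =
  h *: unit_vec R (lift ord_max j) + row_snoc (x, t).
Proof.
apply/rowP => i; case: (unliftP ord_max i) => [k|] ->.
  rewrite [RHS]mxE row_snoc_lift row_snoc_lift !mxE /=.
  by rewrite (inj_eq lift_inj).
rewrite [RHS]mxE row_snoc_max row_snoc_max !mxE /=.
by rewrite (negbTE (neq_lift _ _)) mulr0 add0r.
Qed.

Lemma row_snocDr n (x : 'rV[R]_n) t h :
  row_snoc (x, h + t) = h *: unit_vec R ord_max + row_snoc (x, t).
Proof.
apply/rowP => i; case: (unliftP ord_max i) => [k|] ->.
  rewrite [RHS]mxE row_snoc_lift row_snoc_lift !mxE /=.
  by rewrite eq_sym (negbTE (neq_lift _ _)) mulr0 add0r.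
by rewrite [RHS]mxE row_snoc_max row_snoc_max !mxE /= eqxx mulr1.
Qed.

Section sections.
Context n (f : 'rV[R]_n.+1 -> R).

Let quotientl x t j :
  (fun h => h^-1 *: (((fun x => f (row_snoc (x, t))) \o shift x) (h *: unit_vec R j)
     - f (row_snoc (x, t)))) =
  (fun h => h^-1 *: ((f \o shift (row_snoc (x, t))) (h *: unit_vec R (lift ord_max j))
     - f (row_snoc (x, t)))).
Proof. by apply/funext => h /=; rewrite row_snocDl. Qed.

Let quotientr x t :
  (fun h : R => h^-1 *: (((fun t : R => f (row_snoc (x, t))) \o shift t) (h *: 1)
     - f (row_snoc (x, t)))) =
  (fun h => h^-1 *: ((f \o shift (row_snoc (x, t))) (h *: unit_vec R ord_max)
     - f (row_snoc (x, t)))).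
Proof. by apply/funext => h /=; rewrite -row_snocDr [_ *: 1]mulr1. Qed.

Lemma partial_snocl t j :
  partial j (fun x => f (row_snoc (x, t))) =
  (fun x => partial (lift ord_max j) f (row_snoc (x, t))).
Proof. by apply/funext => x; rewrite /partial /derive quotientl. Qed.

Lemma derivable_snocr x t : derivable f (row_snoc (x, t)) (unit_vec R ord_max) ->
  derivable (fun t : R => f (row_snoc (x, t))) t 1.
Proof. by rewrite /derivable quotientr. Qed.

Lemma derive_snocr x t :
  derive1 (fun t : R => f (row_snoc (x, t))) t = partial ord_max f (row_snoc (x, t)).
Proof. by rewrite derive1E /partial /derive quotientr. Qed.

Lemma C1_snocl t : C1 f -> C1 (fun x => f (row_snoc (x, t))).
Proof.
move=> [cf df]; split.
  by move=> x; apply: continuous_comp; [exact: continuous_snocl|exact: cf].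
move=> j; have [dfj cfj] := df (lift ord_max j); split.
  by move=> x; rewrite /derivable quotientl; exact: dfj.
rewrite partial_snocl => x.
by apply: continuous_comp; [exact: continuous_snocl|exact: cfj].
Qed.

Lemma continuous_section_r (g : 'rV[R]_n.+1 -> R) x : continuous g ->
  continuous (fun t : R => g (row_snoc (x, t))).
Proof.
by move=> cg t; apply: continuous_comp; [exact: continuous_snocr|exact: cg].
Qed.

Lemma C1_FTC x (a b : R) : C1 f -> a < b ->
  (\int[lebesgue_measure]_(t in `[a, b]) (partial ord_max f (row_snoc (x, t)))%:E
   = (f (row_snoc (x, b)) - f (row_snoc (x, a)))%:E)%E.
Proof.
move=> [cf df] ab; have [dfm cfm] := df ord_max.
have cs : continuous (fun t : R => f (row_snoc (x, t))) := continuous_section_r cf.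
rewrite (@continuous_FTC2 _ _ (fun t : R => f (row_snoc (x, t)))) //.
- by apply: continuous_subspaceT; exact: continuous_section_r.
- split.
  + by move=> t _; exact: derivable_snocr.
  + exact: cvg_at_right_filter (cs a).
  + exact: cvg_at_left_filter (cs b).
- by move=> t _; rewrite derive_snocr.
Qed.

End sections.

Section bounded_support.
Context n.
Local Notation mu := (lebesgue_rV R n).

Lemma compact_cube (L : R) : compact (cube n L).
Proof.
exact: (@rV_compact R n (fun=> `[- L, L]%classic) (fun=> @segment_compact _ _ _)).
Qed.

Lemma continuous_bounded_cube (g : 'rV[R]_n -> R) L : continuous g ->
  exists2 C, 0 <= C & forall x, cube n L x -> `|g x| <= C.
Proof.
move=> cg; have [M [_ hM]] : bounded_set (g @` cube n L).
  apply: compact_bounded; apply: continuous_compact; last exact: compact_cube.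
  exact: continuous_subspaceT.
exists (`|M| + 1); first by rewrite addr_ge0.
by move=> x Lx; apply: (hM _ _ (g x)); [rewrite (le_lt_trans (ler_norm _)) ?ltrDl|exists x].
Qed.

Lemma integrable_continuous_cube (g : 'rV[R]_n -> R) L B : continuous g ->
  measurable B -> B `<=` cube n L -> mu.-integrable B (EFin \o g).
Proof.
move=> cg mB BL; have [C C0 hC] := continuous_bounded_cube L cg.
have iC : mu.-integrable B (EFin \o cst C).
  apply/integrableP; split; first by apply/measurable_EFinP; exact: measurable_cst.
  rewrite /= integral_cst // lte_mul_pinfty ?lee_fin //.
  by apply: le_lt_trans (@cube_lty R n L); apply: le_measure; rewrite ?inE //; exact: measurable_cube.
apply: le_integrable iC => //.
  by apply/measurable_EFinP; apply: measurable_funTS; exact: continuous_rV_measurable.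
by move=> x Bx; rewrite /= lee_fin [leRHS]ger0_norm // hC //; exact: BL.
Qed.

Lemma sq_integrable_continuous_cube (g : 'rV[R]_n -> R) L B : continuous g ->
  measurable B -> B `<=` cube n L -> sq_integrable mu B g.
Proof.
move=> cg mB BL; split.
  by apply: measurable_funTS; exact: continuous_rV_measurable.
apply: integrable_continuous_cube BL => //.
by move=> x; exact: (cvgM (cg x) (cg x)).
Qed.

(** Vanishing on the boundary of the cube as well as outside it, so that
    one-dimensional sections vanish at both endpoints. *)
Definition supported_in (L : R) (f : 'rV[R]_n -> R) : Prop :=
  forall x : 'rV[R]_n, (exists i, L <= `|x 0 i|) -> f x = 0.

End bounded_support.

Lemma open_notin_cube n (L : R) : open (~` cube n L).
Proof.
apply: closed_openC; apply: compact_closed; last exact: compact_cube.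
exact: norm_hausdorff.
Qed.

(** Partial derivatives are local. *)
Lemma partial_eq0 n (f : 'rV[R]_n -> R) i (A : set 'rV[R]_n) x :
  open A -> A x -> (forall y, A y -> f y = 0) -> partial i f x = 0.
Proof.
move=> oA Ax f0; rewrite /partial -(derive_cst (0 : R) x (unit_vec R i)).
by apply: near_eq_derive; exact: (filterS _ (open_nbhs_nbhs (conj oA Ax))).
Qed.

Lemma supported_notin_cube n (L : R) (f : 'rV[R]_n -> R) x :
  supported_in L f -> ~ cube n L x -> f x = 0.
Proof.
move=> fL /existsNP[i /negP hi]; apply: fL; exists i.
by rewrite leNgt; apply: contra hi => hi; rewrite -ler_norml ltW.
Qed.

Lemma partial_notin_cube n (L : R) (f : 'rV[R]_n -> R) i x :
  supported_in L f -> ~ cube n L x -> partial i f x = 0.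
Proof.
move=> fL nx; have out y : (~` cube n L) y -> f y = 0 by exact: supported_notin_cube.
exact: (@partial_eq0 n f i _ x (@open_notin_cube n L) nx out).
Qed.

Lemma supported_snocl n (L : R) (f : 'rV[R]_n.+1 -> R) (t : R) :
  supported_in L f -> supported_in L (fun x => f (row_snoc (x, t))).
Proof.
by move=> fL x [i xi]; apply: fL; exists (lift ord_max i); rewrite row_snoc_lift.
Qed.

Lemma integrable_supported n (L : R) (g : 'rV[R]_n -> R) : continuous g ->
  (forall x, ~ cube n L x -> g x = 0) ->
  (lebesgue_rV R n).-integrable setT (EFin \o g).
Proof.
move=> cg g0; have mQ := @measurable_cube R n L.
have := integrable_continuous_cube cg mQ (@subset_refl _ _).
rewrite (integrable_mkcond _ mQ) (_ : _ \_ _ = EFin \o g) //.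
by apply/funext => x; rewrite patchE; case: ifPn => //; rewrite notin_setE => /g0 /= ->.
Qed.

(** Fubini's theorem brings the coordinate of differentiation inside, where the
    fundamental theorem of calculus applies; the other coordinates are reached
    by induction on the dimension. *)
Lemma integral_partial_eq0 n (L : R) (f : 'rV[R]_n -> R) i : 0 < L -> C1 f ->
  supported_in L f -> (\int[lebesgue_rV R n]_x (partial i f x)%:E = 0)%E.
Proof.
move=> L0; elim: n f i => [f [] //|n ih f i] f1 fL.
have iP : (lebesgue_rV R n.+1).-integrable setT (EFin \o partial i f).
  apply: (@integrable_supported _ L); first by have [_ /(_ i)[]] := f1.
  by move=> x; exact: partial_notin_cube.
case: (unliftP ord_max i) => [j|] ij; rewrite ij in iP *.
  rewrite integral_snoc21 //; apply: integral0_eq => t _.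
  rewrite (eq_integral (fun x => (partial j (fun x => f (row_snoc (x, t))) x)%:E));
    last by move=> x _; rewrite partial_snocl.
  apply: ih; first exact: C1_snocl.
  exact: supported_snocl.
rewrite integral_snoc12 //; apply: integral0_eq => x _.
have mI : measurable `[- L, L]%classic by exact: measurable_itv.
transitivity (\int[lebesgue_measure]_(t in `[(- L)%R, L])
    (partial ord_max f (row_snoc (x, t)))%:E)%E; last first.
  rewrite C1_FTC //; last by lra.
  by rewrite !fL ?subrr //; exists ord_max; rewrite row_snoc_max ?normrN ger0_norm // ltW.
rewrite [RHS]integral_mkcond; apply: eq_integral => t _.
rewrite patchE; case: ifPn => // /negP tL; congr EFin.
apply: (@partial_notin_cube n.+1 L f ord_max _ fL) => h; apply: tL; apply/mem_set.
by have := h ord_max; rewrite row_snoc_max /= in_itv.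
Qed.

End continuously_differentiable.

(** * Integration by parts and the Friedrichs inequality *)

Section integral_inequalities.
Context (R : realType).
Local Notation leb := (@lebesgue_measure R).

Lemma C1_mul n (f g : 'rV[R]_n -> R) : C1 f -> C1 g -> C1 (f * g) /\
  forall i, partial i (f * g) = (fun x => partial i f x * g x + f x * partial i g x).
Proof.
move=> [cf f1] [cg g1].
have dM i : partial i (f * g) = (fun x => partial i f x * g x + f x * partial i g x).
  apply/funext => x; rewrite /partial deriveM; [|exact: (f1 i).1|exact: (g1 i).1].
  by rewrite addrC; congr (_ + _); rewrite [LHS]mulrC.
split=> //; split; first by move=> x; exact: (cvgM (cf x) (cg x)).
move=> i; split; first by move=> x; apply: derivableM; [exact: (f1 i).1|exact: (g1 i).1].
rewrite dM => x.
exact: (cvgD (cvgM ((f1 i).2 x) (cg x)) (cvgM (cf x) ((g1 i).2 x))).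
Qed.

Lemma integration_by_parts_rV n (L : R) (f g : 'rV[R]_n -> R) i : 0 < L -> C1 f -> C1 g ->
  supported_in L f ->
  \int[lebesgue_rV R n]_x (partial i f x * g x) =
  - \int[lebesgue_rV R n]_x (f x * partial i g x).
Proof.
move=> L0 f1 g1 fL; have [fg1 dM] := C1_mul f1 g1.
move: f1 g1 => [cf /(_ i)[df cdf]] [cg /(_ i)[dg cdg]].
have i1 : (lebesgue_rV R n).-integrable setT (EFin \o (fun x => partial i f x * g x)).
  apply: (@integrable_supported _ _ L) => [x|x nx]; first exact: (cvgM (cdf x) (cg x)).
  by rewrite (@partial_notin_cube _ _ _ _ _ _ fL nx) mul0r.
have i2 : (lebesgue_rV R n).-integrable setT (EFin \o (fun x => f x * partial i g x)).
  apply: (@integrable_supported _ _ L) => [x|x nx]; first exact: (cvgM (cf x) (cdg x)).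
  by rewrite (@supported_notin_cube _ _ _ _ _ fL nx) mul0r.
apply/eqP; rewrite -addr_eq0 -RintegralD //; apply/eqP.
rewrite /Rintegral -[RHS]/(fine 0%E) -(@integral_partial_eq0 R n L (f * g) i) // ?dM //.
by move=> x hx; rewrite [LHS](_ : _ = f x * g x) // fL ?mul0r.
Qed.

Lemma Rintegral_sqr_le d (T : measurableType d) (mu : {measure set T -> \bar R}) D
    (g : T -> R) : measurable D -> (mu D < +oo)%E -> sq_integrable mu D g ->
  (\int[mu]_(x in D) g x) ^+ 2 <= fine (mu D) * \int[mu]_(x in D) (g x ^+ 2).
Proof.
move=> mD Doo Hg.
have H1 : sq_integrable mu D (cst 1).
  split; first exact: measurable_cst.
  apply/integrableP; split; first by apply/measurable_EFinP; apply: measurable_funX; exact: measurable_cst.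
  under eq_integral do rewrite /= expr1n normr1.
  by rewrite integral_cst // mul1e.
have := semi_inner_CS (sq_integrable_subspace mu mD) (int_mul_semi_inner mu mD) H1 Hg.
rewrite /int_mul.
have -> : \int[mu]_(x in D) (cst 1 x * g x) = \int[mu]_(x in D) g x.
  by apply: eq_Rintegral => x _; rewrite mul1r.
have -> : \int[mu]_(x in D) (cst 1 x * cst 1 x) = fine (mu D) :> R.
  by under eq_Rintegral do rewrite /= mulr1; rewrite Rintegral_cst // mul1r.
by under [X in _ <= _ * X]eq_Rintegral do rewrite -expr2.
Qed.

(** The fundamental theorem of calculus combined with the Cauchy-Schwarz
    inequality. *)
Lemma C1_increment n (f : 'rV[R]_n.+1 -> R) x (a b s t : R) : C1 f -> a <= s <= b -> a <= t <= b ->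
  (((f (row_snoc (x, t)) - f (row_snoc (x, s))) ^+ 2)%:E <=
   (b - a)%:E * \int[leb]_(r in `[a, b]) (partial ord_max f (row_snoc (x, r)) ^+ 2)%:E)%E.
Proof.
move=> f1; wlog st : s t / s <= t.
  move=> h hs ht; have [/h|/ltW/h] := leP s t; first by apply.
  by rewrite -sqrrN opprB; apply.
move=> /andP[as_ sb] /andP[at_ tb].
have I0 u v : (0 <= \int[leb]_(r in `[u, v]) (partial ord_max f (row_snoc (x, r)) ^+ 2)%:E)%E.
  by apply: integral_ge0 => r _; rewrite lee_fin sqr_ge0.
move: st; rewrite le_eqVlt => /predU1P[->|st].
  rewrite subrr expr0n mule_ge0 // lee_fin subr_ge0; exact: le_trans tb.
pose p r := partial ord_max f (row_snoc (x, r)).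
have cp : continuous p by apply: continuous_section_r; case: f1 => _ /(_ ord_max)[].
have mp2 : measurable_fun setT (fun r => (p r ^+ 2)%:E).
  by apply/measurable_EFinP; apply: measurable_funX; exact: continuous_measurable_fun.
have mI u v : measurable (`[u, v]%classic : set (measurableTypeR R)) by exact: measurable_itv.
have Hp : sq_integrable leb `[s, t] p.
  split; first by apply: measurable_funTS; exact: continuous_measurable_fun.
  apply: continuous_compact_integrable; first exact: segment_compact.
  by apply: continuous_subspaceT => r; exact: (cvgM (cp r) (cp r)).
have lst : leb `[s, t]%classic = (t - s)%:E.
  by rewrite lebesgue_measure_itv /= lte_fin st -EFinB.
have ltoo : (leb `[s, t]%classic < +oo)%E by rewrite lst ltry.
have := Rintegral_sqr_le (mI s t) ltoo Hp.
rewrite (_ : fine _ = t - s); last exact: (congr1 fine lst).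
have -> : \int[leb]_(r in `[s, t]) p r = f (row_snoc (x, t)) - f (row_snoc (x, s)).
  by rewrite /Rintegral (C1_FTC x f1 st).
move=> h; apply: (@le_trans _ _ ((t - s)%:E * \int[leb]_(r in `[s, t]) (p r ^+ 2)%:E)%E).
  rewrite (int_mul_sqrE (mI s t) Hp) -EFinM lee_fin; apply: le_trans h _.
  by under [X in _ * X <= _]eq_Rintegral do rewrite expr2.
apply: lee_pmul => //; first by rewrite lee_fin; lra.
- by rewrite lee_fin; lra.
apply: ge0_subset_integral => //.
- exact: measurable_funTS.
- by move=> r _; rewrite lee_fin sqr_ge0.
- by move=> r; rewrite /= !in_itv /=; lra.
Qed.

(** Along the last coordinate f vanishes at the ends of [-L, L], so that its
    square is at most 2 L times the integral of the square of its derivative;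
    integrating over the cube gives the Friedrichs inequality. *)
Lemma friedrichs n (L : R) (f : 'rV[R]_n.+1 -> R) : 0 < L -> C1 f -> supported_in L f ->
  (\int[lebesgue_rV R n.+1]_x (f x ^+ 2)%:E <=
   ((2 * L) ^+ 2)%:E * \int[lebesgue_rV R n.+1]_x (partial ord_max f x ^+ 2)%:E)%E.
Proof.
move=> L0 f1 fL; have [cf /(_ ord_max)[_ cdf]] := f1.
have msq (g : 'rV[R]_n.+1 -> R) : continuous g ->
    measurable_fun setT (fun x => (g x ^+ 2)%:E).
  move=> cg; apply/measurable_EFinP; apply: measurable_funX.
  exact: continuous_rV_measurable.
have sq0 (g : 'rV[R]_n.+1 -> R) x : (0%R <= (g x ^+ 2)%:E)%E by rewrite lee_fin sqr_ge0.
have mI : measurable (`[- L, L]%classic : set (measurableTypeR R)) by exact: measurable_itv.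
have msec (g : 'rV[R]_n.+1 -> R) x : continuous g ->
    measurable_fun setT (fun t : measurableTypeR R => (g (row_snoc (x, t)) ^+ 2)%:E).
  move=> cg; apply: (measurableT_comp (msq g cg)); exact: measurable_snocr.
rewrite !ge0_integral_snoc12 //; try exact: msq; try by move=> x; exact: sq0.
have mJ : measurable_fun setT (fun x : 'rV[R]_n =>
    (\int[leb]_t (partial ord_max f (row_snoc (x, t)) ^+ 2)%:E)%E).
  apply: (@measurable_fun_fubini_tonelli_F _ _ _ _ _ leb
    (fun p => (partial ord_max f (row_snoc p) ^+ 2)%:E)) => //.
  by apply: (@measurable_snoc_comp R n _ _ (fun x => (partial ord_max f x ^+ 2)%:E)); exact: msq.
have J0 x : (0 <= \int[leb]_t (partial ord_max f (row_snoc (x, t)) ^+ 2)%:E)%E.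
  by apply: integral_ge0 => t _; exact: sq0.
rewrite -ge0_integralZl //; last by rewrite lee_fin sqr_ge0.
apply: ge0_le_integral => //.
- by move=> x _; apply: integral_ge0 => t _; exact: sq0.
- apply: (@measurable_fun_fubini_tonelli_F _ _ _ _ _ leb
    (fun p => (f (row_snoc p) ^+ 2)%:E)) => //.
  by apply: (@measurable_snoc_comp R n _ _ (fun x => (f x ^+ 2)%:E)); exact: msq.
- exact: measurable_funeM.
move=> x _.
have LL : (- L <= - L <= L) by lra.
set J := (\int[leb]_t (partial ord_max f (row_snoc (x, t)) ^+ 2)%:E)%E.
have fb t : `[- L, L]%classic t ->
    ((f (row_snoc (x, t)) ^+ 2)%:E <= (2 * L)%:E * J)%E.
  rewrite /= in_itv /= => tI; have := C1_increment x f1 LL tI.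
  rewrite [f (row_snoc (x, - L))]fL ?subr0; last first.
    by exists ord_max; rewrite row_snoc_max normrN ger0_norm // ltW.
  move=> /le_trans; apply; have -> : L - - L = 2 * L by rewrite opprK; ring.
  apply: lee_wpmul2l; first by rewrite lee_fin; lra.
  by apply: ge0_subset_integral => //; exact: msec.
apply: (@le_trans _ _ (\int[leb]_(t in `[(- L)%R, L]) (f (row_snoc (x, t)) ^+ 2)%:E)%E).
  rewrite [leRHS]integral_mkcond le_eqVlt; apply/orP; left; apply/eqP.
  apply: eq_integral => t _; rewrite patchE; case: ifPn => // /negP tL.
  rewrite (@supported_notin_cube _ _ L f) ?expr0n // => h; apply: tL; apply/mem_set.
  by have := h ord_max; rewrite row_snoc_max /= in_itv.
apply: (@le_trans _ _ (\int[leb]_(t in `[(- L)%R, L]) ((2 * L)%:E * J))%E).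
  apply: ge0_le_integral => //; try exact: measurable_funTS; try exact: msec.
  by apply: measurable_funTS; exact: msec.
have lI : leb `[- L, L]%classic = (2 * L)%:E.
  rewrite lebesgue_measure_itv /= lte_fin ifT; last by lra.
  by rewrite -EFinB opprK; congr EFin; ring.
rewrite integral_cst // [X in (_ * X <= _)%E](_ : _ = (2 * L)%:E); last exact: lI.
by rewrite muleAC -EFinM expr2.
Qed.

End integral_inequalities.

(** * Integrals over cells *)

Section cells.
Context (R : realType).
Local Notation leb := (@lebesgue_measure R).
Local Notation mu := (lebesgue_rV R).

Definition row_init n (z : 'rV[R]_n.+1) : 'rV[R]_n := \row_i z 0 (lift ord_max i).

Lemma row_init_snoc n (x : 'rV[R]_n) t : row_init (row_snoc (x, t)) = x.
Proof. by apply/rowP => i; rewrite mxE row_snoc_lift. Qed.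

Lemma measurable_row_init n : measurable_fun setT (@row_init n).
Proof.
apply: (@measurability _ _ _ _ _ _ (@matrix_coord_sets R 1 n)) => //.
move=> _ [_ [i [j [B mB ->]]] <-]; rewrite setTI (ord1 i).
rewrite (_ : _ @^-1` _ = setT `&` (fun z : 'rV[R]_n.+1 => z 0 (lift ord_max j)) @^-1` B).
  exact: (measurable_coord (lift ord_max j)) measurableT B mB.
by rewrite setTI; apply/seteqP; split=> z /=; rewrite mxE.
Qed.

Definition snoc_set n (A : set 'rV[R]_n) (J : set R) : set 'rV[R]_n.+1 :=
  [set z | A (row_init z) /\ J (z 0 ord_max)].

Lemma snoc_setE n (A : set 'rV[R]_n) (J : set R) x t :
  snoc_set A J (row_snoc (x, t)) <-> A x /\ J t.
Proof. by rewrite /snoc_set /= row_init_snoc row_snoc_max. Qed.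

Lemma measurable_snoc_set n (A : set 'rV[R]_n) (J : set (measurableTypeR R)) :
  measurable A -> measurable J -> measurable (snoc_set A J).
Proof.
move=> mA mJ; rewrite (_ : snoc_set A J = (setT `&` @row_init n @^-1` A) `&`
   (setT `&` (fun z : 'rV[R]_n.+1 => z 0 ord_max) @^-1` J)).
  apply: measurableI; first exact: measurable_row_init measurableT A mA.
  exact: (measurable_coord ord_max) measurableT J mJ.
by rewrite !setTI.
Qed.

Lemma patch_snoc_set n (A : set 'rV[R]_n) (J : set R) (f : 'rV[R]_n.+1 -> \bar R) x t :
  (f \_ (snoc_set A J)) (row_snoc (x, t)) =
  ((fun t => ((fun x => f (row_snoc (x, t))) \_ A) x) \_ J) t.
Proof.
rewrite !patchE; case: ifPn => [/set_mem/snoc_setE[Ax Jt]|].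
  by rewrite !mem_set.
move=> h; case: ifPn => // Jt; case: ifPn => // Ax; exfalso; move/negP: h; apply.
by apply/mem_set/snoc_setE; split; exact: set_mem.
Qed.

Lemma ge0_integral_snoc_set n (A : set 'rV[R]_n) (J : set (measurableTypeR R))
    (f : 'rV[R]_n.+1 -> \bar R) : measurable A -> measurable J ->
  measurable_fun setT f -> (forall x, 0 <= f x)%E ->
  (\int[mu n.+1]_(z in snoc_set A J) f z =
   \int[leb]_(t in J) \int[mu n]_(x in A) f (row_snoc (x, t)))%E.
Proof.
move=> mA mJ mf f0; have mAJ := measurable_snoc_set mA mJ.
rewrite integral_mkcond ge0_integral_snoc21; last 2 first.
- by apply/(measurable_restrictT _ mAJ); exact: measurable_funTS.
- by move=> x; rewrite patchE; case: ifP.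
rewrite [RHS]integral_mkcond; apply: eq_integral => t _.
under eq_integral do rewrite patch_snoc_set.
rewrite patchE; case: ifPn => Jt.
  by rewrite [RHS]integral_mkcond; apply: eq_integral => x _; rewrite !patchE Jt.
by apply: integral0_eq => x _; rewrite !patchE (negbTE Jt).
Qed.

(** The sections are integrable everywhere, and not only almost everywhere, so
    that their integrals are real numbers. *)
Lemma Rintegral_snoc_set n (A : set 'rV[R]_n) (J : set (measurableTypeR R))
    (f : 'rV[R]_n.+1 -> R) : measurable A -> measurable J ->
  (mu n.+1).-integrable (snoc_set A J) (EFin \o f) ->
  (forall t, J t -> (mu n).-integrable A (EFin \o (fun x => f (row_snoc (x, t))))) ->
  let g := fun t => \int[mu n]_(x in A) f (row_snoc (x, t)) in
  measurable_fun J g /\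
  \int[mu n.+1]_(z in snoc_set A J) f z = \int[leb]_(t in J) g t.
Proof.
move=> mA mJ fi fs g; have mAJ := measurable_snoc_set mA mJ.
have fi' : (mu n.+1).-integrable setT ((EFin \o f) \_ (snoc_set A J)).
  by rewrite -integrable_mkcond.
pose G t := (\int[mu n]_x ((EFin \o f) \_ (snoc_set A J)) (row_snoc (x, t)))%E.
have GE t : G t = ((EFin \o g) \_ J) t.
  rewrite /G; under eq_integral do rewrite patch_snoc_set.
  rewrite patchE; case: ifPn => Jt.
    rewrite /= /g /Rintegral fineK; last first.
      by apply: integrable_fin_num => //; exact/fs/set_mem.
    by rewrite [RHS]integral_mkcond; apply: eq_integral => x _; rewrite !patchE Jt.
  by apply: integral0_eq => x _; rewrite !patchE (negbTE Jt).
split.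
  apply/measurable_EFinP; apply/(measurable_restrictT _ mJ).
  rewrite (_ : _ \_ _ = G); last by apply/funext => t; rewrite GE.
  exact: (@measurable_fubini_G _ _ _ _ _ (sigma_finite_rV R n) leb _ (integrable_snocE fi')).
rewrite /Rintegral integral_mkcond integral_snoc21 //; congr fine.
by rewrite [RHS]integral_mkcond; apply: eq_integral => t _; rewrite -GE.
Qed.

Lemma ge0_integral_cover (a h : R) N (u : R -> \bar R) : 0 <= h ->
  measurable_fun `[a, a + N%:R * h] u -> (forall t, 0 <= u t)%E ->
  (\int[leb]_(t in `[a, (a + N%:R * h)%R]) u t <=
   \sum_(k < N) \int[leb]_(t in `[(a + k%:R * h)%R, (a + k.+1%:R * h)%R]) u t)%E.
Proof.
move=> h0 mu_ u0; have mI v w : measurable (`[v, w]%classic : set (measurableTypeR R)).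
  exact: measurable_itv.
elim: N mu_ => [|N ih] mu_; first by rewrite big_ord0 mul0r addr0 set_itv1 integral_set1.
have NS : a + N%:R * h <= a + N.+1%:R * h by rewrite lerD2l ler_wpM2r // ler_nat.
have aN : a <= a + N%:R * h by rewrite lerDl mulr_ge0.
have mS v w : a <= v -> w <= a + N.+1%:R * h -> measurable_fun `[v, w] u.
  move=> av wN; apply: measurable_funS mu_; first exact: mI.
  by move=> t; rewrite /= !in_itv /=; lra.
rewrite big_ord_recr /=; apply: (@le_trans _ _ (\int[leb]_(t in `[a, (a + N%:R * h)%R]) u t +
    \int[leb]_(t in `[(a + N%:R * h)%R, (a + N.+1%:R * h)%R]) u t)%E).
  pose A : set (measurableTypeR R) := `[a, a + N%:R * h]%classic.
  pose B : set (measurableTypeR R) := `[a + N%:R * h, a + N.+1%:R * h]%classic.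
  have AB : A `|` (B `\` A) = `[a, a + N.+1%:R * h]%classic.
    apply/seteqP; split=> t; rewrite /A /B /= !in_itv /=.
      by move=> [|[]]; lra.
    move=> /andP[at_ tb]; have [h1|h1] := leP t (a + N%:R * h); first by left; lra.
    by right; split; [lra|apply/negP; lra].
  rewrite -AB ge0_integral_setU //; last 4 first.
  - exact: mI.
  - by apply: measurableD; exact: mI.
  - by rewrite AB; exact: mS.
  - by apply/disj_setPS => t [h1 [_ h2]].
  rewrite leeD2l //; apply: ge0_subset_integral => //.
  - by apply: measurableD; exact: mI.
  - exact: mS.
by rewrite leeD2r // ih //; exact: mS.
Qed.

Let sqr_le_mean (a I h D : R) : 0 < h -> (a * h - I) ^+ 2 <= h * (h * D) ->
  a ^+ 2 <= 2 / h ^+ 2 * I ^+ 2 + 2 * D.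
Proof.
move=> h0 h1; have h2 : 0 < h ^+ 2 by rewrite exprn_gt0.
rewrite -(ler_pM2l h2).
have -> : h ^+ 2 * (2 / h ^+ 2 * I ^+ 2 + 2 * D) = 2 * I ^+ 2 + 2 * (h * (h * D)).
  by field; lra.
have := sqr_ge0 (a * h - 2 * I); nra.
Qed.

(** On an interval where the square of the oscillation of g is at most D, the
    values of g differ from its mean by at most the square root of D. *)
Lemma interval_sqr_le_mean (c h D : R) (g : R -> R) : 0 < h -> measurable_fun `[c, c + h] g ->
  (forall s t, c <= s <= c + h -> c <= t <= c + h -> (g t - g s) ^+ 2 <= D) ->
  (\int[leb]_(t in `[c, (c + h)%R]) (g t ^+ 2)%:E <=
   (2 / h * (\int[leb]_(t in `[c, (c + h)%R]) g t) ^+ 2 + 2 * h * D)%:E)%E.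
Proof.
move=> h0 mg osc; pose J : set (measurableTypeR R) := `[c, c + h]%classic.
have mJ : measurable J by exact: measurable_itv.
have cJ : c <= c <= c + h by lra.
have lJ : leb J = h%:E.
  by rewrite lebesgue_measure_itv /= lte_fin ifT; [rewrite -EFinB addrAC subrr add0r|lra].
have lJoo : (leb J < +oo)%E by rewrite lJ ltry.
have lJf : fine (leb J) = h by rewrite lJ.
have sqJ (u : R -> R) C : measurable_fun J u -> (forall t, J t -> u t ^+ 2 <= C) ->
    sq_integrable leb J u /\ int_mul leb J u u <= h * C.
  move=> mu_ uC; apply: sq_integrable_le => //.
  apply: (@le_trans _ _ (\int[leb]_(t in J) C%:E)%E).
    apply: ge0_le_integral => //.
    - by move=> t _; rewrite lee_fin sqr_ge0.
    - by apply/measurable_EFinP; exact: measurable_funX.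
  rewrite integral_cst // [X in (_ * X)%E](_ : _ = h%:E); last exact: lJ.
  by rewrite -EFinM lee_fin mulrC.
have [Hg _] : sq_integrable leb J g /\ int_mul leb J g g <= h * (2 * g c ^+ 2 + 2 * D).
  apply: sqJ => // t; rewrite /J /= in_itv /= => tJ.
  have := osc _ _ cJ tJ; have := sqr_ge0 (2 * g c - g t); nra.
have H1 k : sq_integrable leb J (cst k).
  by have [] := sqJ (cst k) (k ^+ 2) (@measurable_cst _ _ _ _ _ _).
have gi : leb.-integrable J (EFin \o g).
  have := sq_integrable_mul mJ Hg (H1 1); apply: eq_integrable => // t _.
  by rewrite /= mulr1.
set I := \int[leb]_(t in J) g t.
have gI t : J t -> (g t ^+ 2 <= 2 / h ^+ 2 * I ^+ 2 + 2 * D).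
  move=> tJ; have tJ' : c <= t <= c + h by move: tJ; rewrite /J /= in_itv.
  pose u s := g t - g s.
  have [Hu Du] : sq_integrable leb J u /\ int_mul leb J u u <= h * D.
    apply: sqJ; first by apply: measurable_funB => //; exact: measurable_cst.
    by move=> s; rewrite /J /= in_itv /= => sJ; exact: osc.
  have := Rintegral_sqr_le mJ lJoo Hu.
  rewrite [fine _](_ : _ = h); last exact: lJf.
  have -> : \int[leb]_(s in J) u s = g t * h - I.
    rewrite /u RintegralB //; last first.
      have := sq_integrable_mul mJ (H1 (g t)) (H1 1); apply: eq_integrable => // s _.
      by rewrite /= mulr1.
    by rewrite Rintegral_cst // [fine _](_ : _ = h); last exact: lJf.
  have -> : \int[leb]_(s in J) (u s ^+ 2) = int_mul leb J u u.
    by apply: eq_Rintegral => s _; rewrite expr2.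
  by move=> h1; apply: sqr_le_mean => //; apply: le_trans h1 _; rewrite ler_pM2l.
apply: (@le_trans _ _ (\int[leb]_(t in J) (2 / h ^+ 2 * I ^+ 2 + 2 * D)%:E)%E).
  apply: ge0_le_integral => //.
  - by move=> t _; rewrite lee_fin sqr_ge0.
  - by apply/measurable_EFinP; apply: measurable_funX.
rewrite integral_cst // [X in (_ * X)%E](_ : _ = h%:E); last exact: lJ.
rewrite -EFinM lee_fin le_eqVlt; apply/orP; left; apply/eqP.
by field; lra.
Qed.

Lemma measurable_section_integral n (A : set 'rV[R]_n) (f : 'rV[R]_n.+1 -> \bar R) :
  measurable A -> measurable_fun setT f -> (forall x, 0 <= f x)%E ->
  measurable_fun setT (fun t => \int[mu n]_(x in A) f (row_snoc (x, t)))%E.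
Proof.
move=> mA mf f0; pose F := f \_ (snoc_set A setT).
have mF : measurable_fun setT F.
  apply/(measurable_restrictT _ (measurable_snoc_set mA measurableT)).
  exact: measurable_funTS.
rewrite (_ : (fun t => _) = fubini_G (mu n) (F \o @row_snoc R n)).
  apply: (@measurable_fun_fubini_tonelli_G _ _ _ _ _ (sigma_finite_rV R n)).
    exact: measurable_snoc_comp.
  by move=> p; rewrite /= /F patchE; case: ifP.
apply/funext => t; rewrite /fubini_G [LHS]integral_mkcond; apply: eq_integral => x _.
by rewrite /= /F patch_snoc_set [in RHS]patchE in_setT.
Qed.

Lemma cube_snoc_set n (L : R) : cube n.+1 L = snoc_set (cube n L) `[- L, L].
Proof.
apply/seteqP; split=> z /=; rewrite /cube /snoc_set /= in_itv /=.
  by move=> h; split; [move=> i; rewrite mxE; exact: h|exact: h].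
move=> [h1 h2] i; case: (unliftP ord_max i) => [j|] -> //.
by have := h1 j; rewrite mxE.
Qed.

End cells.

(** * The cell inequality *)

Section cell_inequality.
Context (R : realType).
Local Notation leb := (@lebesgue_measure R).
Local Notation mu := (lebesgue_rV R).

Lemma ge0_integral_snoc_set12 n (A : set 'rV[R]_n) (J : set (measurableTypeR R))
    (f : 'rV[R]_n.+1 -> \bar R) : measurable A -> measurable J ->
  measurable_fun setT f -> (forall x, 0 <= f x)%E ->
  (\int[mu n.+1]_(z in snoc_set A J) f z =
   \int[mu n]_(x in A) \int[leb]_(t in J) f (row_snoc (x, t)))%E.
Proof.
move=> mA mJ mf f0; have mAJ := measurable_snoc_set mA mJ.
rewrite integral_mkcond ge0_integral_snoc12; last 2 first.
- by apply/(measurable_restrictT _ mAJ); exact: measurable_funTS.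
- by move=> x; rewrite patchE; case: ifP.
rewrite [RHS]integral_mkcond; apply: eq_integral => x _.
under eq_integral do rewrite patch_snoc_set.
rewrite patchE; case: ifPn => Ax.
  by rewrite [RHS]integral_mkcond; apply: eq_integral => t _; rewrite !patchE Ax.
by apply: integral0_eq => t _; rewrite !patchE (negbTE Ax); case: ifP.
Qed.

Lemma sum_lift_max n (F : 'I_n.+1 -> R) :
  \sum_i F i = \sum_i F (lift ord_max i) + F ord_max.
Proof.
rewrite big_ord_recr; congr (_ + _); apply: eq_bigr => i _.
by congr F; apply: val_inj; exact/esym/lift_max.
Qed.

Let layers_total (a h L D : R) : a * h = 2 * L -> a * (2 * h * D) = 4 * L * D.
Proof.
move=> e; have -> : a * (2 * h * D) = 2 * (a * h) * D by ring.
by rewrite e; ring.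
Qed.

Let step_constant (C k L M G a : R) :
  C * (k * (4 * L * (M * (2 * L / a * G)))) = C * k * (8 * L ^+ 2 * M) / a * G.
Proof. by ring. Qed.

Let step_total (C h S T k e G1 G2 : R) : C * (k * T) <= e * G2 ->
  C * (h * S + k * T) + e * G1 <= C * h * S + e * (G1 + G2).
Proof. by move=> H; lra. Qed.

Section step.
Context n (L : R) (L0 : 0 < L) (f : 'rV[R]_n.+1 -> R) (f1 : C1 f).
Let Q := cube n L.
Let Q' := cube n.+1 L.
Let M := fine (mu n Q).
Let G i := int_mul (mu n.+1) Q' (partial i f) (partial i f).
Let I : set (measurableTypeR R) := `[- L, L]%classic.

Let mI v w : measurable (`[v, w]%classic : set (measurableTypeR R)).
Proof. exact: measurable_itv. Qed.

Let mQ : measurable Q. Proof. exact: measurable_cube. Qed.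

Let msq m (g : 'rV[R]_m -> R) : continuous g ->
  measurable_fun setT (fun x => (g x ^+ 2)%:E).
Proof.
move=> cg; apply/measurable_EFinP; apply: measurable_funX.
exact: continuous_rV_measurable.
Qed.

Let sq0 (x : R) : (0%R <= (x ^+ 2)%:E)%E.
Proof. by rewrite lee_fin sqr_ge0. Qed.

Let Gsq m (g : 'rV[R]_m -> R) : continuous g ->
  (\int[mu m]_(x in cube m L) (g x ^+ 2)%:E)%E =
  (int_mul (mu m) (cube m L) g g)%:E.
Proof.
move=> cg; have mC := @measurable_cube R m L; apply: int_mul_sqrE => //.
exact: (@sq_integrable_continuous_cube _ _ _ L).
Qed.

(** The increments of f along the last coordinate between the two slices are
    integrated over B by means of the Cauchy-Schwarz inequality. *)
Lemma slice_oscillation (B : set 'rV[R]_n) (a b s t : R) : measurable B -> B `<=` Q ->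
  - L <= a -> b <= L -> a <= s <= b -> a <= t <= b ->
  (\int[mu n]_(x in B) f (row_snoc (x, t)) - \int[mu n]_(x in B) f (row_snoc (x, s))) ^+ 2
  <= M * ((b - a) * G ord_max).
Proof.
move=> mB BQ La bL sab tab.
have [cf /(_ ord_max)[_ cdf]] := f1.
have cs r : continuous (fun x => f (row_snoc (x, r))) by case: (C1_snocl r f1).
have muB : (mu n B <= mu n Q)%E by apply: le_measure; rewrite ?inE.
have Qoo : (mu n Q < +oo)%E := @cube_lty R n L.
have Boo : (mu n B < +oo)%E := le_lt_trans muB Qoo.
have BM : fine (mu n B) <= M by apply: fine_le; rewrite ?ge0_fin_numE.
rewrite -RintegralB //; try exact: (@integrable_continuous_cube _ _ _ L).
pose u x := f (row_snoc (x, t)) - f (row_snoc (x, s)).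
have cu : continuous u by move=> x; exact: (cvgB (cs t x) (cs s x)).
have Hu := @sq_integrable_continuous_cube _ _ u L B cu mB BQ.
have ba : 0 <= b - a by lra.
apply: (le_trans (Rintegral_sqr_le mB Boo Hu)).
apply: ler_pM => //.
  by apply: Rintegral_ge0 => x _; exact: sqr_ge0.
have -> : \int[mu n]_(x in B) (u x ^+ 2) = int_mul (mu n) B u u.
  by apply: eq_Rintegral => x _; rewrite expr2.
rewrite -lee_fin -int_mul_sqrE // EFinM /G -Gsq // cube_snoc_set.
have p0 x : (0 <= (partial ord_max f x ^+ 2)%:E)%E by exact: sq0.
have mp := msq cdf.
rewrite ge0_integral_snoc_set12 //.
have mJ : measurable_fun setT (fun x : 'rV[R]_n =>
    (\int[leb]_(r in I) (partial ord_max f (row_snoc (x, r)) ^+ 2)%:E)%E).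
  rewrite (_ : (fun x => _) = fubini_F leb
     (((fun x => (partial ord_max f x ^+ 2)%:E) \_ (snoc_set setT I)) \o @row_snoc R n)).
    apply: measurable_fun_fubini_tonelli_F.
      apply: measurable_snoc_comp.
      apply/(measurable_restrictT _ (measurable_snoc_set measurableT (mI _ _))).
      exact: measurable_funTS.
    by move=> p; rewrite /= patchE; case: ifP.
  apply/funext => x; rewrite /fubini_F [LHS]integral_mkcond; apply: eq_integral => r _.
  by rewrite /= patch_snoc_set !patchE in_setT.
have J0 x : (0 <= \int[leb]_(r in I) (partial ord_max f (row_snoc (x, r)) ^+ 2)%:E)%E.
  by apply: integral_ge0 => r _; exact: sq0.
rewrite -ge0_integralZl //; last exact: measurable_funTS.
apply: (@le_trans _ _ (\int[mu n]_(x in B)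
    ((b - a)%:E * \int[leb]_(r in I) (partial ord_max f (row_snoc (x, r)) ^+ 2)%:E))%E).
  apply: ge0_le_integral => //.
  - by apply: measurable_funTS; exact: msq.
  - by apply: measurable_funeM; exact: measurable_funTS.
  move=> x Bx; apply: (le_trans (C1_increment x f1 sab tab)).
  apply: lee_wpmul2l; first by rewrite lee_fin.
  apply: ge0_subset_integral => //; try exact: mI.
    apply: measurable_funTS; apply: (measurableT_comp mp); exact: measurable_snocr.
  by move=> r; rewrite /I /= !in_itv /=; lra.
apply: ge0_subset_integral => //.
- by apply: measurable_funeM; exact: measurable_funTS.
- by move=> x _; apply: mule_ge0.
Qed.

Context (K : finType) (B : K -> set 'rV[R]_n) (C eps : R) (N : nat).
Context (C0 : 0 <= C) (e0 : 0 < eps).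
Hypothesis hB : forall k, measurable (B k) /\ B k `<=` Q.
Hypothesis ih : forall g, C1 g -> int_mul (mu n) Q g g <=
  C * \sum_k (\int[mu n]_(x in B k) g x) ^+ 2 +
  eps * \sum_i int_mul (mu n) Q (partial i g) (partial i g).
Hypothesis hN : C * #|K|%:R * (8 * L ^+ 2 * M) <= eps * N.+1%:R.

Let h := 2 * L / N.+1%:R.
Let J (j : 'I_N.+1) : set (measurableTypeR R) :=
  `[- L + j%:R * h, - L + j.+1%:R * h]%classic.
Let g k t := \int[mu n]_(x in B k) f (row_snoc (x, t)).
Let X k j := \int[mu n.+1]_(x in snoc_set (B k) (J j)) f x.
Let D := M * (h * G ord_max).

Let h0 : 0 < h. Proof. by rewrite divr_gt0 // mulr_gt0. Qed.

Let Nh : N.+1%:R * h = 2 * L. Proof. by rewrite /h mulrC divfK ?pnatr_eq0. Qed.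

Let J_bounds (j : 'I_N.+1) : - L <= - L + j%:R * h /\ - L + j.+1%:R * h <= L.
Proof.
split; first by rewrite lerDl mulr_ge0 // ltW.
have : j.+1%:R * h <= N.+1%:R * h by rewrite ler_wpM2r ?ler_nat // ltW.
rewrite Nh; lra.
Qed.

Let slice (J' : set (measurableTypeR R)) k : measurable J' -> J' `<=` I ->
  measurable_fun J' (g k) /\
  \int[mu n.+1]_(z in snoc_set (B k) J') f z = \int[leb]_(t in J') g k t.
Proof.
move=> mJ' J'I; have [mB BQ] := hB k; have [cf _] := f1.
apply: Rintegral_snoc_set => //.
  apply: (@integrable_continuous_cube _ _ _ L) => //; first exact: measurable_snoc_set.
  by rewrite cube_snoc_set => z [h1 h2]; split; [exact: BQ|exact: J'I].
move=> t _; apply: (@integrable_continuous_cube _ _ _ L) => //.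
by case: (C1_snocl t f1).
Qed.

Let slice_sq k : (\int[leb]_(t in I) (g k t ^+ 2)%:E <=
  (\sum_j (2 / h * X k j ^+ 2 + 2 * h * D))%:E)%E.
Proof.
have IE : I = `[- L, - L + N.+1%:R * h]%classic by rewrite Nh /I (_ : - L + 2 * L = L) //; ring.
have [mg _] := slice k (mI _ _) (@subset_refl _ I).
rewrite IE; apply: (le_trans (ge0_integral_cover (ltW h0) _ _)) => //.
  by rewrite -IE; apply/measurable_EFinP; exact: measurable_funX.
rewrite -sumEFin; apply: lee_sum => j _.
have [La bL] := J_bounds j.
have SE : - L + j.+1%:R * h = - L + j%:R * h + h by rewrite -natr1; ring.
have JI : J j `<=` I by move=> t; rewrite /J /I /= !in_itv /=; lra.
have [mgj XE] := slice k (mI _ _) JI.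
rewrite /X XE /J SE; apply: interval_sqr_le_mean => //.
  by rewrite -SE.
move=> s t; rewrite -SE => hs ht; have [mB BQ] := hB k.
apply: (le_trans (slice_oscillation mB BQ La bL hs ht)).
by rewrite /D (_ : - L + j.+1%:R * h - _ = h) // SE; ring.
Qed.

(** The induction hypothesis is applied to the slices of f and integrated over
    the last coordinate. The averages of a slice over the cells B k then become
    averages over the thicker cells, at the cost of the oscillation of the
    slices, which is small as N is large. *)
Lemma cell_inequality_step : int_mul (mu n.+1) Q' f f <=
  C * (2 / h) * \sum_p (X p.1 p.2) ^+ 2 + eps * \sum_i G i.
Proof.
have [cf df] := f1.
have mI0 : measurable I by exact: mI.
have [M0 G0] : 0 <= M /\ forall i, 0 <= G i.
  split; first exact: fine_ge0.
  by move=> i; apply: Rintegral_ge0 => x _; rewrite -expr2 sqr_ge0.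
have mg k : measurable_fun I (g k) := (slice k (mI _ _) (@subset_refl _ I)).1.
pose P i t := (\int[mu n]_(x in Q) (partial (lift ord_max i) f (row_snoc (x, t)) ^+ 2)%:E)%E.
have mP i : measurable_fun setT (P i).
  by apply: (@measurable_section_integral R n Q
    (fun x => (partial (lift ord_max i) f x ^+ 2)%:E)) => //; exact: msq (df _).2.
have P0 i t : (0 <= P i t)%E by apply: integral_ge0 => x _; exact: sq0.
have PG i : (\int[leb]_(t in I) P i t = (G (lift ord_max i))%:E)%E.
  rewrite /G -Gsq; last exact: (df _).2.
  by rewrite cube_snoc_set ge0_integral_snoc_set //; exact: msq (df _).2.
have main : ((int_mul (mu n.+1) Q' f f)%:E <=
    (\sum_k \int[leb]_(t in I) (C%:E * (g k t ^+ 2)%:E)) +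
    \sum_i \int[leb]_(t in I) (eps%:E * P i t))%E.
  rewrite -Gsq // cube_snoc_set ge0_integral_snoc_set //; last exact: msq.
  have mC k : measurable_fun I (fun t => (C%:E * (g k t ^+ 2)%:E)%E).
    by apply: measurable_funeM; apply/measurable_EFinP; exact: measurable_funX.
  have pC k t : (0 <= C%:E * (g k t ^+ 2)%:E)%E by rewrite mule_ge0.
  have mE i : measurable_fun I (fun t => (eps%:E * P i t)%E).
    by apply: measurable_funeM; exact: measurable_funTS.
  have pE i t : (0 <= eps%:E * P i t)%E by rewrite mule_ge0 // lee_fin ltW.
  rewrite -(ge0_integral_sum leb mI0 mC (fun k t _ => pC k t)).
  rewrite -(ge0_integral_sum leb mI0 mE (fun i t _ => pE i t)).
  rewrite -ge0_integralD //; last 4 first.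
  - by move=> t _; apply: sume_ge0 => k _; exact: pC.
  - exact: emeasurable_sum.
  - by move=> t _; apply: sume_ge0 => i _; exact: pE.
  - exact: emeasurable_sum.
  apply: ge0_le_integral => //.
  - by move=> t _; apply: integral_ge0 => x _; exact: sq0.
  - apply: measurable_funTS; apply: (@measurable_section_integral R n Q
      (fun x => (f x ^+ 2)%:E)) => //; exact: msq.
  - by apply: emeasurable_funD; exact: emeasurable_sum.
  move=> t tI; have ft1 := C1_snocl t f1.
  rewrite (Gsq (g := fun x => f (row_snoc (x, t)))); last by case: ft1.
  have PE i : P i t = (int_mul (mu n) Q (partial i (fun x => f (row_snoc (x, t))))
      (partial i (fun x => f (row_snoc (x, t)))))%:E.
    by rewrite -Gsq; [rewrite partial_snocl|case: ft1 => _ /(_ i)[]].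
  under [X in (_ <= _ + X)%E]eq_bigr do rewrite PE -EFinM.
  under [X in (_ <= X + _)%E]eq_bigr do rewrite -EFinM.
  rewrite !sumEFin -EFinD lee_fin; apply: le_trans (ih ft1) _.
  by rewrite !mulr_sumr.
have main2 : int_mul (mu n.+1) Q' f f <=
    C * (\sum_k \sum_j (2 / h * X k j ^+ 2 + 2 * h * D)) +
    eps * \sum_i G (lift ord_max i).
  rewrite -lee_fin; apply: (le_trans main); rewrite EFinD; apply: leeD.
    rewrite mulr_sumr -sumEFin; apply: lee_sum => k _.
    rewrite ge0_integralZl //; last by apply/measurable_EFinP; exact: measurable_funX.
    by rewrite EFinM; apply: lee_wpmul2l => //; exact: slice_sq.
  rewrite mulr_sumr -sumEFin; apply: lee_sum => i _.
  rewrite ge0_integralZl //; [|exact: measurable_funTS|by rewrite lee_fin ltW].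
  by rewrite PG EFinM.
apply: (le_trans main2).
rewrite sum_lift_max.
have -> : \sum_k \sum_j (2 / h * X k j ^+ 2 + 2 * h * D) =
    2 / h * (\sum_p X p.1 p.2 ^+ 2) + #|K|%:R * (4 * L * D).
  rewrite -(pair_bigA _ (fun k j => X k j ^+ 2)) /= mulr_sumr.
  rewrite (_ : #|K|%:R * _ = \sum_(k in K) (4 * L * D)); last first.
    by rewrite sumr_const mulr_natl.
  rewrite -big_split /=; apply: eq_bigr => k _.
  rewrite big_split /= mulr_sumr; congr (_ + _).
  rewrite sumr_const card_ord -[_ *+ N.+1]mulr_natl.
  exact: layers_total Nh.
apply: step_total; rewrite /D /h step_constant.
by rewrite ler_wpM2r // ler_pdivrMr ?ltr0n.
Qed.

End step.

(** The dimension is increased one coordinate at a time, each cell being cut into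
    layers so thin that, up to a small multiple of the gradient, a slice of f
    does not change within a layer. *)
Theorem cell_inequality n (L eps : R) : 0 < L -> 0 < eps ->
  exists (K : finType) (B : K -> set 'rV[R]_n) (C : R),
    [/\ 0 <= C, forall k, measurable (B k) /\ B k `<=` cube n L
      & forall f, C1 f -> int_mul (mu n) (cube n L) f f <=
          C * \sum_k (\int[mu n]_(x in B k) f x) ^+ 2 +
          eps * \sum_i int_mul (mu n) (cube n L) (partial i f) (partial i f)].
Proof.
move=> L0 e0; elim: n => [|n [K [B [C [C0 hB ih]]]]].
  exists unit, (fun=> cube 0 L), 1; split=> [//|_|f f1].
    by split=> //; exact: measurable_cube.
  have mQ := @measurable_cube R 0 L.
  have fE x : f x = f 0 by rewrite (thinmx0 x).
  have Q1 : fine (mu 0 (cube 0 L)) = 1.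
    by rewrite /= /dirac indicE mem_set // => -[].
  have intE c : \int[mu 0]_(x in cube 0 L) (cst c) x = c.
    by rewrite Rintegral_cst // Q1 mulr1.
  rewrite big_ord0 mulr0 addr0 mul1r (bigD1 tt) //= big1 ?addr0; last by case.
  rewrite /int_mul (@eq_Rintegral _ _ _ _ _ (cst (f 0 * f 0))) ?intE; last first.
    by move=> x _; rewrite fE.
  by rewrite (@eq_Rintegral _ _ _ _ _ (cst (f 0))) ?intE ?expr2 // => x _; rewrite fE.
have [N hN] : exists N : nat, C * #|K|%:R * (8 * L ^+ 2 * fine (mu n (cube n L)))
    <= eps * N.+1%:R.
  pose r := C * #|K|%:R * (8 * L ^+ 2 * fine (mu n (cube n L))) / eps.
  exists (Num.bound `|r|); rewrite [leRHS]mulrC -ler_pdivrMr //; apply/ltW.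
  apply: lt_le_trans (_ : (Num.bound `|r|)%:R <= _); last by rewrite ler_nat.
  exact: le_lt_trans (ler_norm r) (archi_boundP (normr_ge0 r)).
exists (K * 'I_N.+1)%type.
pose h := 2 * L / N.+1%:R.
exists (fun p : K * 'I_N.+1 => snoc_set (B p.1) `[- L + p.2%:R * h, - L + p.2.+1%:R * h]%classic).
exists (C * (2 / h)); split.
- by rewrite mulr_ge0 // divr_ge0 // divr_ge0 ?mulr_ge0 // ltW.
- move=> [k j]; have [mB BQ] := hB k; split=> /=.
    by apply: measurable_snoc_set => //; exact: measurable_itv.
  rewrite cube_snoc_set => z [h1]; rewrite /= in_itv /= => /andP[h2 h3].
  split; first exact: BQ.
  have h0 : 0 < h by rewrite divr_gt0 // mulr_gt0.
  have Nh : N.+1%:R * h = 2 * L by rewrite /h mulrC divfK ?pnatr_eq0.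
  have j0 : 0 <= j%:R * h by rewrite mulr_ge0 // ltW.
  have jN : j.+1%:R * h <= N.+1%:R * h by rewrite ler_wpM2r ?ler_nat // ltW.
  by rewrite /= in_itv /=; lra.
- by move=> f f1; exact: (cell_inequality_step L0 f1 C0 e0 hB ih hN).
Qed.

End cell_inequality.

(** * Smooth bump functions *)

Section flat_functions.
Context (R : realType).

(** These functions span the derivatives of exp(-1/t), extended by 0. *)
Definition flat (k : nat) (t : R) : R :=
  if 0 < t then t^-1 ^+ k * expR (- t^-1) else 0.

Lemma flat_ge0 k t : 0 <= flat k t.
Proof.
rewrite /flat; case: ltP => // t0.
by rewrite mulr_ge0 ?expR_ge0 // exprn_ge0 // invr_ge0 ltW.
Qed.

(** From exp s >= (s / (k + 1))^(k + 1) with s = 1 / t. Its consequence is that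
    all the derivatives vanish at 0. *)
Lemma flat_le k t : 0 <= t -> flat k t <= k.+1%:R ^+ k.+1 * t.
Proof.
rewrite /flat le_eqVlt => /predU1P[<-|t0]; first by rewrite ltxx mulr0.
rewrite t0 expRN ler_pdivrMr ?expR_gt0 //.
have k0 : (0 : R) < k.+1%:R by rewrite ltr0n.
have h : (t^-1 / k.+1%:R) ^+ k.+1 <= expR t^-1.
  have -> : expR t^-1 = expR (t^-1 / k.+1%:R) ^+ k.+1.
    by rewrite -expRM_natl mulrCA mulfV ?mulr1 // gt_eqF.
  rewrite lerXn2r ?nnegrE ?divr_ge0 ?invr_ge0 ?(ltW t0) ?expR_ge0 //.
  by apply: le_trans (expR_ge1Dx _); rewrite lerDr.
apply: le_trans (ler_wpM2l _ h); last by rewrite mulr_ge0 ?exprn_ge0 ?(ltW t0).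
rewrite expr_div_n [t^-1 ^+ k.+1]exprS le_eqVlt; apply/orP; left; apply/eqP.
have := expf_neq0 k.+1 (lt0r_neq0 k0); move: (_ ^+ k.+1) (t^-1 ^+ k) => P s P0.
by field; rewrite P0 gt_eqF.
Qed.

Let derivative_value (s E : R) k :
  s ^+ k * (E * s ^+ 2) + E * - (k%:R * s ^+ k.+1) =
  s ^+ k.+2 * E - k%:R * (s ^+ k.+1 * E).
Proof. by rewrite !exprS; ring. Qed.

Lemma is_derive_flat k (t : R) :
  is_derive t 1 (flat k) (flat k.+2 t - k%:R * flat k.+1 t).
Proof.
have [t0|t0|<-] := ltgtP 0 t.
- rewrite /flat t0.
  have near0 : \near t, t^-1 ^+ k * expR (- t^-1) = flat k t.
    near=> s; rewrite /flat ifT //; near: s; exact: lt_nbhsr.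
  apply: (near_eq_is_derive near0).
  have dV : is_derive t 1 (fun y : R => y^-1) (- t ^- 2).
    apply: is_derive_eq; first exact: (is_deriveV (lt0r_neq0 t0)).
    by rewrite [LHS]mulr1.
  have dX : is_derive t 1 (fun y : R => y^-1 ^+ k) (- (k%:R * t^-1 ^+ k.+1)).
    rewrite (_ : (fun y => _) = (fun y : R => y^-1) ^+ k); last by rewrite exprfctE.
    apply: is_derive_eq.
    transitivity (k%:R * t^-1 ^+ k.-1 * - (t ^+ 2)^-1); first by [].
    rewrite -[(t ^+ 2)^-1]exprVn mulrN -mulrA; congr (- _).
    case: k {near0} => [|k]; first by rewrite !mul0r.
    by rewrite -exprD addn2.
  have dE : is_derive t 1 (fun y : R => expR (- y^-1)) (expR (- t^-1) * t^-1 ^+ 2).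
    have dN := is_deriveN dV.
    have dC := @is_derive1_comp R expR (fun y : R => - y^-1) t _ _ (is_derive_expR _) dN.
    apply: (is_derive_eq dC).
    transitivity (expR (- t^-1) * - - (t ^+ 2)^-1); first by [].
    by rewrite opprK exprVn.
  have dP := @is_deriveM _ _ _ _ t 1 _ _ dX dE; apply: (is_derive_eq dP).
  exact: derivative_value.
- rewrite /flat !ifF ?mulr0 ?subr0 ?ltNge ?(ltW t0) //.
  have near0 : \near t, cst 0 t = flat k t.
    near=> s; rewrite /flat ifF //; apply/negbTE; rewrite -leNgt ltW //.
    by near: s; exact: lt_nbhsl.
  by apply: (near_eq_is_derive near0).
have f0 n : flat n 0 = 0 by rewrite /flat ltxx.
rewrite !f0 mulr0 subr0.
have lim0 : h^-1 *: ((flat k \o shift 0) (h *: (1 : R)) - flat k 0) @[h --> 0^'] --> (0 : R).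
  apply/cvgrPdist_le => e e0; pose c : R := k.+2%:R ^+ k.+2.
  have c0 : 0 < c by rewrite exprn_gt0.
  near=> h; have h0 : h != 0 by near: h; exact: nbhs_dnbhs_neq.
  have hd : `|h| < e / c.
    near: h; apply: dnbhs0_lt; exact: divr_gt0.
  rewrite sub0r normrN /= addr0 f0 subr0 [h *: 1]mulr1 [_ *: _]mulrC.
  have [hp|hn] := ltP 0 h; last first.
    by rewrite /flat ltNge hn mul0r normr0 ltW.
  have -> : flat k h * h^-1 = flat k.+1 h by rewrite /flat hp exprS; ring.
  rewrite ger0_norm ?flat_ge0 //; apply: le_trans (flat_le _ (ltW hp)) _.
  rewrite -/c mulrC -ler_pdivlMr //; apply: ltW; apply: le_lt_trans hd.
  exact: ler_norm.
by apply: DeriveDef; [exact: cvgP lim0|exact: cvg_lim lim0].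
Unshelve. all: by end_near. Qed.

Lemma continuous_flat k : continuous (flat k).
Proof.
move=> t; apply/differentiable_continuous/derivable1_diffP.
by case: (is_derive_flat k t).
Qed.

End flat_functions.

Section bump_functions.
Context (R : realType) (n : nat).
Implicit Types (f g : 'rV[R]_n -> R) (a b x : 'rV[R]_n) (i j : 'I_n).

Lemma is_derive_coord (phi : R -> R) i j x (d : R) :
  is_derive (x 0 i) 1 phi d ->
  is_derive x (unit_vec R j) (fun x => phi (x 0 i)) ((i == j)%:R * d).
Proof.
move=> [dphi <-].
have shiftE h : (h *: unit_vec R j + x) 0 i = h * (i == j)%:R + x 0 i.
  by rewrite !mxE eqxx.
have [ij|ij] := eqVneq i j; last first.
  have q0 : (fun h => h^-1 *: (((fun x => phi (x 0 i)) \o shift x) (h *: unit_vec R j) -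
      phi (x 0 i))) = cst 0.
    by apply/funext => h /=; rewrite shiftE (negbTE ij) mulr0 add0r subrr scaler0.
  rewrite mul0r; apply: DeriveDef; first by rewrite /derivable q0; exact: is_cvg_cst.
  by rewrite /derive q0; exact: cvg_lim (cvg_cst _).
have qE : (fun h => h^-1 *: (((fun x => phi (x 0 i)) \o shift x) (h *: unit_vec R j) -
      phi (x 0 i))) =
    (fun h : R => h^-1 *: ((phi \o shift (x 0 i)) (h *: 1) - phi (x 0 i))).
  by apply/funext => h /=; rewrite shiftE ij eqxx.
by rewrite mul1r; apply: DeriveDef; rewrite /derivable /derive qE.
Qed.

(** A class of functions stable under products and partial derivatives, hence
    made of smooth functions, that contains bump functions. *)
Inductive elementary : ('rV[R]_n -> R) -> Prop :=
| elementary_cst c : elementary (fun=> c)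
| elementary_flat k i (c d : R) : elementary (fun x => flat k (c * x 0 i + d))
| elementary_add f g : elementary f -> elementary g ->
    elementary (fun x => f x + g x)
| elementary_mul f g : elementary f -> elementary g ->
    elementary (fun x => f x * g x).

Let continuous_cst (c : R) : continuous (fun _ : 'rV[R]_n => c).
Proof. by move=> x; exact: cst_continuous. Qed.

Let continuous_coord i : continuous (fun x : 'rV[R]_n => x 0 i).
Proof. by move=> x; exact: coord_continuous. Qed.

Let partial_cst c j : partial j (fun=> c : R) = (fun=> 0).
Proof. by apply/funext => x; exact: derive_cst. Qed.

Let affine_flat k (c d t : R) : is_derive t 1 (fun t => flat k (c * t + d))
  ((flat k.+2 (c * t + d) - k%:R * flat k.+1 (c * t + d)) * c).
Proof.
have dA : is_derive t 1 (fun t => c * t + d) c.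
  have dZ := @is_deriveD _ _ _ (fun t => c * t) (cst d) t 1 _ _
    (is_deriveZ c (is_derive_id t 1)) (is_derive_cst d t 1).
  by apply: (is_derive_eq dZ); rewrite addr0 [LHS]mulr1.
have dC := @is_derive1_comp R (flat k) (fun t => c * t + d) t _ _
  (is_derive_flat k (c * t + d)) dA.
exact: dC.
Qed.

Lemma partial_flat k i c d j : partial j (fun x => flat k (c * x 0 i + d)) =
  (fun x => (i == j)%:R * c *
    (flat k.+2 (c * x 0 i + d) + - k%:R * flat k.+1 (c * x 0 i + d))).
Proof.
apply/funext => x; rewrite /partial.
have [_ ->] := is_derive_coord j (affine_flat k c d (x 0 i)).
by rewrite mulNr; ring.
Qed.

Lemma partial_add f g j : C1 f -> C1 g ->
  partial j (fun x => f x + g x) = (fun x => partial j f x + partial j g x).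
Proof.
move=> [_ /(_ j)[df _]] [_ /(_ j)[dg _]]; apply/funext => x.
exact: (deriveD (df x) (dg x)).
Qed.

Lemma partial_mul f g j : C1 f -> C1 g ->
  partial j (fun x => f x * g x) = (fun x => partial j f x * g x + f x * partial j g x).
Proof. by move=> f1 g1; have [_ /(_ j)] := C1_mul f1 g1. Qed.

Lemma elementary_partial f : elementary f -> C1 f /\ forall j, elementary (partial j f).
Proof.
elim=> [c|k i c d|{}f g _ [f1 pf] _ [g1 pg]|{}f g ef [f1 pf] eg [g1 pg]].
- have pc j : partial j (fun=> c : R) = (fun=> 0) by exact: partial_cst.
  split=> [|j]; last by rewrite pc; exact: elementary_cst.
  split=> [|j]; first by move=> x; exact: continuous_cst.
  by split=> [x|]; [case: (is_derive_cst c x (unit_vec R j))|rewrite pc => x; exact: continuous_cst].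
- have cont l : continuous (fun x : 'rV[R]_n => flat l (c * x 0 i + d)).
    move=> x; apply: (@continuous_comp _ _ _ (fun x : 'rV[R]_n => c * x 0 i + d) (flat l)).
      exact: (cvgD (cvgM (@continuous_cst c x) (@continuous_coord i x))
        (@continuous_cst d x)).
    exact: continuous_flat.
  split=> [|j]; last first.
    rewrite partial_flat; apply: elementary_mul; first exact: elementary_cst.
    apply: elementary_add; first exact: elementary_flat.
    by apply: elementary_mul; [exact: elementary_cst|exact: elementary_flat].
  split=> // j; split=> [x|].
    by case: (is_derive_coord j (affine_flat k c d (x 0 i))).
  rewrite partial_flat => x; apply: (cvgM (@continuous_cst _ x)).
  exact: (cvgD (cont k.+2 x) (cvgM (@continuous_cst (- k%:R) x) (cont k.+1 x))).
- split=> [|j]; last by rewrite partial_add //; exact: elementary_add.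
  split=> [x|j]; first exact: (cvgD (f1.1 x) (g1.1 x)).
  have [df cf] := f1.2 j; have [dg cg] := g1.2 j; split=> [x|].
    exact: derivableD.
  by rewrite partial_add // => x; exact: (cvgD (cf x) (cg x)).
- have [fg1 _] := C1_mul f1 g1; split=> // j.
  rewrite partial_mul //; apply: elementary_add; apply: elementary_mul => //; exact: pf.
Qed.

Lemma elementary_C1 f : elementary f -> C1 f.
Proof. by case/elementary_partial. Qed.

Lemma elementary_smooth f : elementary f -> smooth f.
Proof.
move=> ef s; have es : elementary (partials s f).
  by elim: s => //= i s /elementary_partial[_]; exact.
by have [c d] := elementary_C1 es; split=> // i x; exact: (d i).1.
Qed.

Lemma elementary_mixed f i j : elementary f ->
  partial i (partial j f) = partial j (partial i f).
Proof.
elim=> [c|k l c d|{}f g ef ihf eg ihg|{}f g ef ihf eg ihg].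
- by rewrite !partial_cst.
- have lin p q : partial p (fun x => (l == q)%:R * c *
       (flat k.+2 (c * x 0 l + d) + - k%:R * flat k.+1 (c * x 0 l + d))) =
     (fun x => (l == q)%:R * c * ((l == p)%:R * c *
       (flat k.+4 (c * x 0 l + d) + - k.+2%:R * flat k.+3 (c * x 0 l + d) - k%:R *
       (flat k.+3 (c * x 0 l + d) + - k.+1%:R * flat k.+2 (c * x 0 l + d))))).
    have e m : C1 (fun x : 'rV[R]_n => flat m (c * x 0 l + d)).
      exact/elementary_C1/elementary_flat.
    have ec r : C1 (fun=> r : R) := elementary_C1 (elementary_cst r).
    have ek : C1 (fun x : 'rV[R]_n => - k%:R * flat k.+1 (c * x 0 l + d)).
      exact: (C1_mul (ec (- k%:R)) (e k.+1)).1.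
    have es : C1 (fun x : 'rV[R]_n => flat k.+2 (c * x 0 l + d) +
        - k%:R * flat k.+1 (c * x 0 l + d)).
      apply/elementary_C1/elementary_add; first exact: elementary_flat.
      by apply: elementary_mul; [exact: elementary_cst|exact: elementary_flat].
    rewrite (partial_mul p (ec _) es) partial_cst (partial_add p (e _) ek).
    rewrite (partial_mul p (ec _) (e _)) partial_cst !partial_flat.
    by apply/funext => x; ring.
  by rewrite !partial_flat !lin; apply/funext => x; rewrite mulrCA.
- have [f1 pf] := elementary_partial ef; have [g1 pg] := elementary_partial eg.
  have H p q : partial p (partial q (fun x => f x + g x)) =
      fun x => partial p (partial q f) x + partial p (partial q g) x.
    rewrite (partial_add q f1 g1).
    exact: (partial_add p (elementary_C1 (pf q)) (elementary_C1 (pg q))).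
  by rewrite (H i j) (H j i) ihf ihg.
- have [f1 pf] := elementary_partial ef; have [g1 pg] := elementary_partial eg.
  have H p q : partial p (partial q (fun x => f x * g x)) = fun x =>
     (partial p (partial q f) x * g x + partial q f x * partial p g x) +
     (partial p f x * partial q g x + f x * partial p (partial q g) x).
    have fq := elementary_C1 (pf q); have gq := elementary_C1 (pg q).
    rewrite (partial_mul q f1 g1) (partial_add p (C1_mul fq g1).1 (C1_mul f1 gq).1).
    by rewrite (partial_mul p fq g1) (partial_mul p f1 gq).
  by rewrite (H i j) (H j i) ihf ihg; apply/funext => x; rewrite addrACA.
Qed.

(** Since flat 0 (m t) = exp (- 1 / (m t)) tends to 1 for t > 0, these functions
    tend to the indicator of the open box as m grows. *)
Definition box_bump (m : nat) a b x : R :=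
  \prod_i (flat 0 (m.+1%:R * x 0 i + - (m.+1%:R * a 0 i)) *
           flat 0 (- m.+1%:R * x 0 i + m.+1%:R * b 0 i)).

Lemma elementary_bump m a b : elementary (box_bump m a b).
Proof.
rewrite /box_bump; elim: (index_enum _) => [|i s ih].
  by under eq_fun do rewrite big_nil; exact: elementary_cst.
under eq_fun do rewrite big_cons.
by apply: elementary_mul => //; apply: elementary_mul; exact: elementary_flat.
Qed.

Let flat0_le1 (t : R) : flat 0 t <= 1.
Proof.
rewrite /flat; case: ltP => // t0; rewrite expr0 mul1r -expR0 ler_expR.
by rewrite oppr_le0 invr_ge0 ltW.
Qed.

Let flat0_le0 k (t : R) : t <= 0 -> flat k t = 0.
Proof. by move=> t0; rewrite /flat ltNge t0. Qed.

Lemma bump_ge0 m a b x : 0 <= box_bump m a b x.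
Proof. by apply: prodr_ge0 => i _; rewrite mulr_ge0 ?flat_ge0. Qed.

Lemma bump_le1 m a b x : box_bump m a b x <= 1.
Proof.
suff /andP[] : 0 <= box_bump m a b x <= 1 by [].
rewrite /box_bump; apply: (big_ind (fun t => 0 <= t <= 1)); first by rewrite ler01 lexx.
  by move=> s t /andP[s0 s1] /andP[t0 t1]; rewrite mulr_ge0 // mulr_ile1.
by move=> i _; rewrite mulr_ge0 ?flat_ge0 // mulr_ile1 ?flat_ge0.
Qed.

Lemma bump_eq0 m a b x : ~ open_box a b x -> box_bump m a b x = 0.
Proof.
move=> /existsNP[i /negP]; rewrite negb_and -!leNgt => h.
have m0 : (0 : R) < m.+1%:R by rewrite ltr0n.
rewrite /box_bump (bigD1 i) //=; case/orP: h => h.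
  by rewrite flat0_le0 ?mul0r // subr_le0 ler_pM2l.
by rewrite [flat 0 (- _ * _ + _)]flat0_le0 ?mulr0 ?mul0r // addrC mulNr subr_le0 ler_pM2l.
Qed.

Let flat0_cvg (t : R) : 0 < t -> flat 0 (m.+1%:R * t) @[m --> \oo] --> (1 : R).
Proof.
move=> t0; apply/cvgrPdist_lt => e e0.
have [N hN] := ltr_add_invr (mulr_gt0 e0 t0); rewrite add0r in hN.
exists N => // m /= Nm.
have m0 : (0 : R) < m.+1%:R by rewrite ltr0n.
have mt : 0 < m.+1%:R * t by rewrite mulr_gt0.
rewrite ger0_norm ?subr_ge0 ?flat0_le1 // /flat mt expr0 mul1r.
apply: (@le_lt_trans _ _ (m.+1%:R * t)^-1).
  by rewrite lerBlDl -lerBlDr; exact: expR_ge1Dx.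
rewrite invfM ltr_pdivrMr //; apply: le_lt_trans hN.
by rewrite lef_pV2 ?posrE // ler_nat ltnS.
Qed.

Lemma bump_cvg a b x : open_box a b x -> box_bump m a b x @[m --> \oo] --> (1 : R).
Proof.
move=> xab; rewrite /box_bump; elim: (index_enum _) => [|i s ih].
  by under eq_fun do rewrite big_nil; exact: cvg_cst.
under eq_fun do rewrite big_cons.
have /andP[ai ib] := xab i.
have h1 : flat 0 (m.+1%:R * x 0 i + - (m.+1%:R * a 0 i)) @[m --> \oo] --> (1 : R).
  by under eq_fun do rewrite -mulrBr; apply: flat0_cvg; rewrite subr_gt0.
have h2 : flat 0 (- m.+1%:R * x 0 i + m.+1%:R * b 0 i) @[m --> \oo] --> (1 : R).
  by under eq_fun do rewrite mulNr addrC -mulrBr; apply: flat0_cvg; rewrite subr_gt0.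
have h3 := cvgM (cvgM h1 h2) ih.
by rewrite !mulr1 in h3; exact: h3.
Qed.

Lemma closed_closed_box a b : closed (closed_box a b) /\ compact (closed_box a b).
Proof.
have cb : compact (closed_box a b).
  exact: (@rV_compact R n (fun i => `[a 0 i, b 0 i]%classic)
    (fun i => @segment_compact _ _ _)).
by split=> //; apply: compact_closed => //; exact: norm_hausdorff.
Qed.

Lemma test_function_bump (Omega : set 'rV[R]_n) m a b :
  closed_box a b `<=` Omega -> test_function Omega (box_bump m a b).
Proof.
move=> abO; have [cl cp] := closed_closed_box a b.
have sub : closure [set x | box_bump m a b x != 0] `<=` closed_box a b.
  rewrite [X in _ `<=` X](closure_id _).1 //; apply: closure_subset => x /= bx i.
  have /(_ i)/andP[/ltW -> /ltW ->] // : open_box a b x.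
  by apply: contrapT => /(bump_eq0 m)/eqP; rewrite (negbTE bx).
split; first exact/elementary_smooth/elementary_bump.
- apply: subclosed_compact cp sub; exact: closed_closure.
- exact: subset_trans abO.
Qed.

End bump_functions.

(** * The fundamental lemma of the calculus of variations *)

Section fundamental_lemma.
Context (R : realType) (n : nat).
Local Notation mu := (lebesgue_rV R n).

Lemma sq_integrableS d (T : measurableType d) (nu : {measure set T -> \bar R}) (A B : set T) f :
  measurable A -> measurable B -> B `<=` A ->
  sq_integrable nu A f -> sq_integrable nu B f.
Proof.
move=> mA mB BA [mf f2]; split; first exact: measurable_funS mf.
exact: integrableS f2.
Qed.

Lemma sq_integrable_integrable d (T : measurableType d) (nu : {measure set T -> \bar R})
    (A : set T) f :
  measurable A -> (nu A < +oo)%E -> sq_integrable nu A f -> nu.-integrable A (EFin \o f).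
Proof.
move=> mA Aoo Hf.
have H1 : sq_integrable nu A (cst 1).
  split; first exact: measurable_cst.
  apply/integrableP; split.
    by apply/measurable_EFinP; apply: measurable_funX; exact: measurable_cst.
  under eq_integral do rewrite /= expr1n normr1.
  by rewrite integral_cst // mul1e.
have := sq_integrable_mul mA Hf H1; apply: eq_integrable => // x _.
by rewrite /= mulr1.
Qed.

Lemma open_box_cube (a b : 'rV[R]_n) : open_box a b `<=` cube n (`|a| + `|b|).
Proof.
move=> x xab i; have /andP[h1 h2] := xab i.
have := coord_le_norm a i; have := coord_le_norm b i.
rewrite !ler_norml => /andP[h3 h4] /andP[h5 h6].
have := normr_ge0 a; have := normr_ge0 b; move: h1 h2 h3 h4 h5 h6.
move: (x 0 i) (a 0 i) (b 0 i) `|a| `|b| => *; lra.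
Qed.

Lemma open_box_lty (a b : 'rV[R]_n) : (mu (open_box a b) < +oo)%E.
Proof.
apply: le_lt_trans (@cube_lty R n (`|a| + `|b|)); apply: le_measure; rewrite ?inE.
- exact: measurable_open_box.
- exact: measurable_cube.
- exact: open_box_cube.
Qed.

Definition within_range (p : option (R * R)) (t : R) : bool :=
  if p is Some (u, v) then u < t < v else true.

(** Open boxes with possibly unbounded sides: these form a generator of the
    product sigma-algebra that is stable under intersection. *)
Definition generating_boxes : set (set 'rV[R]_n) :=
  [set A | exists2 I : 'I_n -> option (R * R),
    A = [set x : 'rV[R]_n | forall i, within_range (I i) (x 0 i)] & True].

Lemma measurable_generating_boxes :
  @measurable _ 'rV[R]_n = <<s generating_boxes >>.
Proof.
apply/seteqP; split.
  apply: smallest_sub; first exact: smallest_sigma_algebra.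
  move=> _ [i [j [B mB ->]]]; rewrite (ord1 i).
  have mj : measurable_fun setT
      (fun M : g_sigma_algebraType generating_boxes => (M : 'rV[R]_n) 0 j).
    apply: (measurability _ (measurable_realfun.RGenOpens.measurableE R)).
    move=> _ [_ [u [v ->]] <-]; rewrite setTI; apply: sub_sigma_algebra.
    exists (fun k => if k == j then Some (u, v) else None) => //.
    apply/seteqP; split=> x /=.
      by rewrite in_itv /= => h k; rewrite /within_range; case: eqP => [->|].
    by rewrite in_itv /= => /(_ j); rewrite eqxx.
  by have := mj measurableT B mB; rewrite setTI.
apply: smallest_sub; first exact: sigma_algebra_measurable.
move=> _ [I -> _].
have mI i : measurable [set t | within_range (I i) t].
  rewrite /within_range.
  case: (I i) => [[u v]|].
    rewrite [X in measurable X](_ : _ = `]u, v[%classic); first exact: measurable_itv.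
    by apply/seteqP; split=> t; rewrite /= in_itv.
  rewrite [X in measurable X](_ : _ = setT); first exact: measurableT.
  by apply/seteqP; split.
exact: measurable_forall_coord mI.
Qed.

Lemma setI_generating_boxes : setI_closed generating_boxes.
Proof.
move=> _ _ [I -> _] [J -> _].
exists (fun i => match I i, J i with
  | Some (u, v), Some (u', v') => Some (Num.max u u', Num.min v v')
  | Some p, None => Some p | None, q => q end) => //.
apply/seteqP; split=> x /=.
  move=> [h1 h2] i; have := h1 i; have := h2 i.
  rewrite /within_range; case: (I i) (J i) => [[u v]|] [[u' v']|] //.
  by rewrite gt_max lt_min => /andP[-> ->] /andP[-> ->].
move=> h; split=> i; have := h i.
  rewrite /within_range; case: (I i) (J i) => [[u v]|] [[u' v']|] //.
  by rewrite gt_max lt_min => /andP[/andP[-> _] /andP[-> _]].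
rewrite /within_range; case: (I i) (J i) => [[u v]|] [[u' v']|] //.
by rewrite gt_max lt_min => /andP[/andP[_ ->] /andP[_ ->]].
Qed.

Lemma generating_boxes_open_box A (a b : 'rV[R]_n) : generating_boxes A ->
  exists a' b', A `&` open_box a b = open_box a' b' /\
    closed_box a' b' `<=` closed_box a b.
Proof.
move=> [I -> _].
exists (\row_i (if I i is Some (u, v) then Num.max u (a 0 i) else a 0 i)).
exists (\row_i (if I i is Some (u, v) then Num.min v (b 0 i) else b 0 i)); split.
  apply/seteqP; split=> x /=.
    move=> [h1 h2] i; have := h1 i; have := h2 i; rewrite !mxE.
    rewrite /within_range; case: (I i) => [[u v]|] //.
    by rewrite gt_max lt_min => /andP[-> ->] /andP[-> ->].
  move=> h; split=> i; have := h i; rewrite !mxE /within_range; case: (I i) => [[u v]|] //.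
    by rewrite gt_max lt_min => /andP[/andP[-> _] /andP[-> _]].
  by rewrite gt_max lt_min => /andP[/andP[_ ->] /andP[_ ->]].
move=> x h i; have := h i; rewrite !mxE /within_range; case: (I i) => [[u v]|] //.
by rewrite ge_max le_min => /andP[/andP[_ ->] /andP[_ ->]].
Qed.

Context (Omega : set 'rV[R]_n) (oO : open Omega).
Context (f : 'rV[R]_n -> R) (Hf : sq_integrable mu Omega f).
Hypothesis f0 : forall m (a b : 'rV[R]_n), closed_box a b `<=` Omega ->
  \int[mu]_(x in Omega) (f x * box_bump m a b x) = 0.

Let mO : measurable Omega. Proof. exact: open_rV_measurable. Qed.

Let open_box_Omega a b : closed_box a b `<=` Omega -> open_box a b `<=` Omega.
Proof.
move=> abO; apply: subset_trans abO => x h i.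
by have /andP[/ltW -> /ltW ->] := h i.
Qed.

Let integrable_box a b : closed_box a b `<=` Omega ->
  mu.-integrable (open_box a b) (EFin \o f).
Proof.
move=> abO; apply: sq_integrable_integrable.
- exact: measurable_open_box.
- exact: open_box_lty.
- by apply: sq_integrableS Hf => //; [exact: measurable_open_box|exact: open_box_Omega].
Qed.

(** By dominated convergence along the bumps, which tend to 1 on the box. *)
Let integral_box a b : closed_box a b `<=` Omega ->
  (\int[mu]_(x in open_box a b) (f x)%:E = 0)%E.
Proof.
move=> abO; have mB := measurable_open_box a b; have fi := integrable_box abO.
have mf : measurable_fun (open_box a b) f by apply/measurable_EFinP; case/integrableP: fi.
have mb m : measurable_fun (open_box a b) (box_bump m a b).
  apply: measurable_funTS; apply: continuous_rV_measurable.
  by have [] := elementary_C1 (@elementary_bump R n m a b).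
have mfb m : measurable_fun (open_box a b) (fun x => (f x * box_bump m a b x)%:E).
  by apply/measurable_EFinP; exact: measurable_funM.
have le m x : (`|(f x * box_bump m a b x)%:E| <= (`|f x|)%:E)%E.
  rewrite /= lee_fin normrM ler_piMr // ger0_norm ?bump_ge0 //; exact: bump_le1.
have z m : (\int[mu]_(x in open_box a b) (f x * box_bump m a b x)%:E = 0)%E.
  have fbi : mu.-integrable (open_box a b) (fun x => (f x * box_bump m a b x)%:E).
    by apply: le_integrable fi => // x _; rewrite /=; exact: le.
  have := f0 m abO; rewrite /Rintegral.
  rewrite (_ : (\int[mu]_(x in Omega) _)%E =
    (\int[mu]_(x in open_box a b) (f x * box_bump m a b x)%:E)%E); last first.
    rewrite integral_mkcond [RHS]integral_mkcond; apply: eq_integral => x _.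
    rewrite !patchE; case: ifPn => xO; case: ifPn => xB //.
      by rewrite bump_eq0 ?mulr0 //; rewrite notin_setE in xB.
    by move: xO; rewrite mem_set //; apply: (open_box_Omega abO); exact: set_mem.
  by move=> h; rewrite -(fineK (integrable_fin_num mB fbi)) h.
have cvgf : {ae mu, forall x, open_box a b x ->
    (fun m => (f x * box_bump m a b x)%:E) @ \oo --> (f x)%:E}.
  apply: aeW => x xB; apply: cvg_EFin; first exact: nearW.
  have := cvgM (cvg_cst (f x)) (bump_cvg xB).
  by rewrite mulr1; apply.
have leae : {ae mu, forall x m, open_box a b x ->
    (`|(f x * box_bump m a b x)%:E| <= (`|f x|)%:E)%E}.
  by apply: aeW => x m _; exact: le.
have mfE : measurable_fun (open_box a b) (EFin \o f) by apply/measurable_EFinP.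
have nfi : mu.-integrable (open_box a b) (fun x => (`|f x|)%:E).
  by apply: le_integrable (fi) => //; [apply/measurable_EFinP; exact: measurableT_comp|
    move=> x _; rewrite /= normr_id].
have [_ _] := dominated_convergence mB mfb mfE cvgf nfi leae.
under eq_fun do rewrite z.
by move/(cvg_unique _ (cvg_cst _)) => <-.
Qed.

(** By Dynkin's theorem the vanishing of the integral extends from the boxes to
    all measurable subsets of a box. *)
Let integral_subset a b A : closed_box a b `<=` Omega -> measurable A ->
  (\int[mu]_(x in A `&` open_box a b) (f x)%:E = 0)%E.
Proof.
move=> abO + ; have mB := measurable_open_box a b; have fi := integrable_box abO.
pose P (A : set 'rV[R]_n) := (\int[mu]_(x in A `&` open_box a b) (f x)%:E = 0)%E.
have sub (S : set 'rV[R]_n) : S `&` open_box a b `<=` open_box a b by move=> x [].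
move=> mA; suff /(_ A) : forall S, <<s generating_boxes >> S -> P S.
  by rewrite -measurable_generating_boxes; apply.
apply: (@dynkin_induction _ 'rV[R]_n generating_boxes P measurable_generating_boxes
  setI_generating_boxes); rewrite /P.
- by rewrite setTI; exact: integral_box.
- move=> S /(@generating_boxes_open_box _ a b)[a' [b' [-> sub']]].
  by apply: integral_box; exact: subset_trans abO.
- move=> S mS hS.
  have : (\int[mu]_(x in open_box a b) (f x)%:E = 0)%E by exact: integral_box.
  have E : open_box a b = (S `&` open_box a b) `|` (~` S `&` open_box a b).
    by rewrite -setIUl setUv setTI.
  rewrite {1}E integral_setU //.
  + by rewrite hS add0e.
  + exact: measurableI.
  + by apply: measurableI => //; exact: measurableC.
  + by rewrite -E; case/integrableP: fi.
  + by apply/disj_setPS => x [[h1 _] [h2 _]].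
- move=> F mF tF hF; rewrite setI_bigcupl integral_bigcup //.
  + by apply: eseries0 => i _ _; exact: hF.
  + exact: trivIset_setIr.
  + by move=> k; exact: measurableI.
  + apply: (integrableS mB _ _ fi); last by move=> x [k _ [_ ?]].
    by apply: bigcupT_measurable => k; exact: measurableI.
Qed.

(** Every point of Omega lies in one of countably many rational boxes, and on
    each of them f vanishes almost everywhere. *)
Theorem fundamental_lemma : {ae mu, forall x, Omega x -> f x = 0}.
Proof.
have box_ae (pq : 'rV[rat]_n * 'rV[rat]_n) :
    {ae mu, forall x, closed_box (map_mx ratr pq.1) (map_mx ratr pq.2) `<=` Omega ->
      open_box (map_mx ratr pq.1) (map_mx ratr pq.2) x -> f x = 0}.
  have [abO|nabO] := pselect (closed_box (map_mx ratr pq.1) (map_mx ratr pq.2) `<=` Omega);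
    last by apply: aeW.
  have := @integral_ae_eq _ _ _ mu _ (measurable_open_box _ _) (cst 0%E) _
    (integrable_box abO) (@measurable_cst _ _ _ _ _ _).
  have H E : E `<=` open_box (map_mx ratr pq.1) (map_mx ratr pq.2) -> measurable E ->
      (\int[mu]_(x in E) (EFin \o f) x = \int[mu]_(x in E) (cst 0 x))%E.
    move=> EB mE; rewrite integral0 -(integral_subset abO mE).
    by congr (integral _ _ _); apply/seteqP; split=> x //; [split=> //; exact: EB|case].
  move=> /(_ H); apply: filterS => x hx _ Bx.
  by have [] := hx Bx.
have : {ae mu, forall x, forall k : nat, forall pq : 'rV[rat]_n * 'rV[rat]_n,
    unpickle k = Some pq ->
    closed_box (map_mx ratr pq.1) (map_mx ratr pq.2) `<=` Omega ->
      open_box (map_mx ratr pq.1) (map_mx ratr pq.2) x -> f x = 0}.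
  apply: ae_foralln => k.
  case E : (unpickle k) => [pq|]; last by apply: aeW.
  by apply: filterS (box_ae pq) => x hx _ [<-].
apply: filterS => x hx Ox.
have [pq [h1 h2]] := open_rational_box oO Ox.
exact: (hx (pickle pq) pq (pickleK pq)).
Qed.

End fundamental_lemma.

(** * Square-integrable vector fields *)

Section L2_fields.
Context (R : realType) (n : nat) (Omega : set 'rV[R]_n) (oO : open Omega).
Local Notation mu := (lebesgue_rV R n).
Local Notation L2s := (sq_integrable mu Omega).
Local Notation ip := (int_mul mu Omega).
Implicit Types (f g : 'rV[R]_n -> R).

Lemma measurable_domain : measurable Omega.
Proof. exact: open_rV_measurable. Qed.
Let mO := measurable_domain.

Lemma L2P f : L2 Omega f <-> L2s f.
Proof.
have sqE : (EFin \o (fun x => (f \_ Omega) x ^+ 2)) =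
    (EFin \o (fun x => f x ^+ 2)) \_ Omega.
  by apply/funext => x; rewrite /= !patchE; case: ifP => // _; rewrite expr0n.
rewrite /L2; split=> [Lf|[mf f2]].
  split.
    have := sub_Lfun_mfun Lf; rewrite inE /= => mf.
    by apply/(measurable_restrictT _ mO).
  have := Lfun2_integrable_sqr Lf; rewrite sqE.
  by rewrite -integrable_mkcond.
rewrite inE; apply/andP; split.
  by rewrite inE /=; apply/(measurable_restrictT _ mO).
rewrite inE /= /finite_norm unlock /Lnorm poweR_lty //.
have := f2; rewrite (integrable_mkcond _ mO) -sqE => /integrableP[_].
apply: le_lt_trans; rewrite le_eqVlt; apply/orP; left; apply/eqP.
apply: eq_integral => x _; rewrite /= powR_mulrn //.
by rewrite real_normK ?num_real // ger0_norm ?sqr_ge0.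
Qed.

Lemma L2_fieldP m (u : 'rV[R]_n -> 'rV[R]_m) :
  L2_field Omega u <-> forall j, L2s (fun x => u x 0 j).
Proof. by split=> h j; apply/L2P; exact: h. Qed.

Let sL := sq_integrable_subspace mu mO.
Let aL := int_mul_semi_inner mu mO.

Lemma integrable_dotv m (u v : 'rV[R]_n -> 'rV[R]_m) :
  L2_field Omega u -> L2_field Omega v ->
  mu.-integrable Omega (EFin \o (fun x => dotv (u x) (v x))).
Proof.
move=> /L2_fieldP Hu /L2_fieldP Hv.
have := @integrable_sum _ _ _ mu Omega mO 'I_m (index_enum _) xpredT
   (fun j => EFin \o (fun x => u x 0 j * v x 0 j)) (fun j _ => sq_integrable_mul mO (Hu j) (Hv j)).
by apply: eq_integrable => // x _; rewrite /= /dotv sumEFin.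
Qed.

Lemma L2_dotE m (u v : 'rV[R]_n -> 'rV[R]_m) :
  L2_field Omega u -> L2_field Omega v ->
  L2_dot Omega u v = \sum_j ip (fun x => u x 0 j) (fun x => v x 0 j).
Proof.
move=> /L2_fieldP Hu /L2_fieldP Hv; rewrite /L2_dot /dotv.
elim: (index_enum _) => [|j s ih].
  rewrite big_nil; under eq_Rintegral do rewrite big_nil.
  by rewrite Rintegral_cst // mul0r.
rewrite big_cons -ih; under eq_Rintegral do rewrite big_cons.
rewrite RintegralD //; first exact: sq_integrable_mul.
have := @integrable_sum _ _ _ mu Omega mO 'I_m s xpredT
   (fun j => EFin \o (fun x => u x 0 j * v x 0 j)) (fun j _ => sq_integrable_mul mO (Hu j) (Hv j)).
by apply: eq_integrable => // x _; rewrite /= sumEFin.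
Qed.

Lemma L2_field_subspace m : linear_subspace (@L2_field R n Omega m).
Proof.
split.
  apply/L2_fieldP => j.
  rewrite (_ : (fun x => _) = 0); first exact: sL.1.
  by apply/funext => x; rewrite mxE.
move=> c u v /L2_fieldP Hu /L2_fieldP Hv; apply/L2_fieldP => j.
rewrite (_ : (fun x => _) = c *: (fun x => u x 0 j) + (fun x => v x 0 j)).
  exact: sL.2.
by apply/funext => x; rewrite !mxE.
Qed.

Lemma L2_dot_semi_inner m : semi_inner (@L2_field R n Omega m) (@L2_dot R n Omega m).
Proof.
split=> [u v Hu Hv|c u v w Hu Hv Hw|u Hu].
- by apply: eq_Rintegral => x _; apply: eq_bigr => j _; rewrite mulrC.
- have Huv : L2_field Omega (c *: u + v) by exact: (L2_field_subspace m).2.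
  rewrite !L2_dotE // mulr_sumr -big_split; apply: eq_bigr => j _.
  move: Hu Hv Hw => /L2_fieldP Hu /L2_fieldP Hv /L2_fieldP Hw.
  case: aL => _ lin _; rewrite /= -lin //; apply: eq_Rintegral => x _.
  by rewrite !mxE.
- apply: Rintegral_ge0 => x _; apply: sumr_ge0 => j _.
  by rewrite -expr2 sqr_ge0.
Qed.

Lemma int_mul_le_L2_dot m (u : 'rV[R]_n -> 'rV[R]_m) j : L2_field Omega u ->
  ip (fun x => u x 0 j) (fun x => u x 0 j) <= L2_dot Omega u u.
Proof.
move=> Hu; rewrite L2_dotE // (bigD1 j) //= lerDl; apply: sumr_ge0 => k _.
by apply: (semi_inner_ge0 aL); move/L2_fieldP: Hu.
Qed.

Lemma L2_field_complete m : complete_for (@L2_field R n Omega m) (@L2_dot R n Omega m).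
Proof.
move=> u Hu cu; have sF := L2_field_subspace m.
have comp j k : L2s (fun x => u k x 0 j) by have /L2_fieldP := Hu k.
have HB k l := subspaceB sF (Hu k) (Hu l).
have subE (v w : 'rV[R]_n -> 'rV[R]_m) j :
    (fun x => (v - w) x 0 j) = (fun x => v x 0 j) - (fun x => w x 0 j).
  by apply/funext => x; rewrite !mxE.
have lim j : exists2 f, L2s f & cvg_for ip (fun k x => u k x 0 j) f.
  apply: sq_integrable_complete => [|k|e e0]; [exact: mO|exact: comp|].
  have [N hN] := cu e e0; exists N => k l Nk Nl.
  by rewrite -subE; apply: le_lt_trans (int_mul_le_L2_dot j (HB k l)) (hN k l Nk Nl).
have /choice[f hf] : forall j, exists f, L2s f /\ cvg_for ip (fun k x => u k x 0 j) f.
  by move=> j; have [f ? ?] := lim j; exists f.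
have Hf : L2_field Omega (fun x => \row_j f j x).
  apply/L2_fieldP => j; have [h _] := hf j.
  by rewrite (_ : (fun x => _) = f j) //; apply/funext => x; rewrite mxE.
exists (fun x => \row_j f j x) => // e e0.
have e1 : 0 < e / m.+1%:R by rewrite divr_gt0.
have /choice[N hN] : forall j, exists N, forall k, (N <= k)%N ->
    ip ((fun x => u k x 0 j) - f j) ((fun x => u k x 0 j) - f j) < e / m.+1%:R.
  by move=> j; have [_ /(_ _ e1)] := hf j.
exists (\sum_j N j)%N => k Nk; have HB0 := subspaceB sF (Hu k) Hf; rewrite L2_dotE //.
apply: (@le_lt_trans _ _ (\sum_(j < m) e / m.+1%:R)).
  apply: ler_sum => j _; rewrite subE (_ : (fun x => (\row_j f j x) 0 j) = f j); last first.
    by apply/funext => x; rewrite mxE.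
  apply/ltW/hN; apply: leq_trans Nk; by rewrite (bigD1 j) //= leq_addr.
by rewrite sumr_const card_ord -[_ *+ m]mulr_natr mulrAC ltr_pdivrMr ?ltr0n //
  ltr_pM2l // ltr_nat.
Qed.

Lemma int_mul_ae0 f : L2s f -> {ae mu, forall x, Omega x -> f x = 0} -> ip f f = 0.
Proof.
move=> [mf _] f0; rewrite /int_mul /Rintegral (ae_eq_integral (cst 0%E)).
- by rewrite integral_cst // mul0e.
- exact: mO.
- by apply/measurable_EFinP; exact: measurable_funM.
- exact: measurable_cst.
- by apply: filterS f0 => x h Ox; rewrite /= h // mul0r.
Qed.

(** The fundamental lemma of the calculus of variations, in terms of the
    inner product and with bumps as the test functions. *)
Lemma int_mul_bump_eq0 f : L2s f ->
  (forall m (a b : 'rV[R]_n), closed_box a b `<=` Omega -> ip f (box_bump m a b) = 0) ->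
  ip f f = 0.
Proof. by move=> Hf h; apply: int_mul_ae0 => //; exact: fundamental_lemma. Qed.

Lemma int_mul_test_eq0 f : L2s f -> (forall psi, test_function Omega psi -> ip f psi = 0) ->
  ip f f = 0.
Proof. by move=> Hf h; apply: int_mul_bump_eq0 => // m a b /(test_function_bump m)/h. Qed.

End L2_fields.

(** * Test functions and weak gradients *)

Section test_functions.
Context (R : realType) (n : nat) (Omega : set 'rV[R]_n) (oO : open Omega).
Context (L : R) (L0 : 0 < L).
Hypothesis OL : forall x, Omega x -> forall i, `|x 0 i| < L.
Local Notation mu := (lebesgue_rV R n).
Local Notation L2s := (sq_integrable mu Omega).
Local Notation ip := (int_mul mu Omega).
Local Notation test := (test_function Omega).
Implicit Types (f g psi chi : 'rV[R]_n -> R).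

Let mO := measurable_domain oO.
Let sL := sq_integrable_subspace mu mO.
Let aL := int_mul_semi_inner mu mO.

Lemma domain_sub_cube : Omega `<=` cube n L.
Proof. by move=> x /OL h i; rewrite -ler_norml ltW. Qed.

Lemma test_function_eq0 psi x : test psi -> ~ Omega x -> psi x = 0.
Proof.
move=> [_ _ sub] nx; apply: contrapT => /eqP px; apply: nx; apply: sub.
exact: subset_closure.
Qed.

Lemma test_function_C1 psi : test psi -> C1 psi.
Proof. by case=> /smooth_C1. Qed.

Lemma test_function_supported psi : test psi -> supported_in L psi.
Proof.
move=> tp x [i xi]; apply: (test_function_eq0 tp) => /OL/(_ i).
by rewrite ltNge xi.
Qed.

Let test_support psi (chi : 'rV[R]_n -> R) : test psi ->
  smooth chi -> (forall x, ~ closure [set x | psi x != 0] x -> chi x = 0) -> test chi.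
Proof.
move=> [sp cp sub] sc chi0.
have cl : closure [set x | chi x != 0] `<=` closure [set x | psi x != 0].
  rewrite [X in _ `<=` X](closure_id _).1; last exact: closed_closure.
  by apply: closure_subset => x /= cx; apply: contrapT => /chi0/eqP; rewrite (negbTE cx).
split=> //; last exact: subset_trans sub.
by apply: subclosed_compact cp cl; exact: closed_closure.
Qed.

Lemma test_function_partial psi i : test psi -> test (partial i psi).
Proof.
move=> tp; apply: (test_support tp).
  have [sp _ _] := tp; move=> s; have := sp (rcons s i).
  by rewrite /partials foldr_rcons.
move=> x nx; apply: (@partial_eq0 R n psi i (~` closure [set x | psi x != 0]) x) => //.
  by apply: closed_openC; exact: closed_closure.
move=> y ny; apply: contrapT => /eqP py; apply: ny; exact: subset_closure.
Qed.

Lemma smooth_linear c psi chi : smooth psi -> smooth chi -> smooth (c *: psi + chi).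
Proof.
move=> sp sc; have lin s : partials s (c *: psi + chi) = c *: partials s psi + partials s chi.
  elim: s => //= i s ->; apply/funext => x; rewrite /partial.
  rewrite deriveD; [|apply: derivableZ; exact: (sp s).2|exact: (sc s).2].
  by rewrite deriveZ //; exact: (sp s).2.
move=> s; rewrite lin; split.
  move=> x; exact: (cvgD (cvgZr (k := c) ((sp s).1 x)) ((sc s).1 x)).
move=> i x; apply: derivableD; last exact: (sc s).2.
by apply: derivableZ; exact: (sp s).2.
Qed.

Lemma test_function_linear c psi chi : test psi -> test chi -> test (c *: psi + chi).
Proof.
move=> [sp cp subp] [sc continuous_coord subc].
have cl : closure [set x | (c *: psi + chi) x != 0] `<=`
    closure [set x | psi x != 0] `|` closure [set x | chi x != 0].
  rewrite -closureU; apply: closure_subset => x /= nz.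
  have [p0|p0] := eqVneq (psi x) 0; last by left.
  right; apply: contra nz => /eqP c0.
  by rewrite [X in X == 0](_ : _ = c * psi x + chi x) // p0 c0 mulr0 addr0.
split; first exact: smooth_linear.
- apply: subclosed_compact (compactU cp continuous_coord) cl; exact: closed_closure.
- by apply: subset_trans cl _ => x [/subp|/subc].
Qed.

Lemma test_function0 : test 0.
Proof.
split.
- exact/elementary_smooth/(@elementary_cst R n 0).
- rewrite [X in closure X](_ : _ = set0) ?closure0; first exact: compact0.
  by apply/seteqP; split=> x //=; rewrite eqxx.
- rewrite [X in closure X](_ : _ = set0) ?closure0; first exact: sub0set.
  by apply/seteqP; split=> x //=; rewrite eqxx.
Qed.

Lemma test_function_sq psi : test psi -> L2s psi.
Proof.
move=> /test_function_C1[cp _].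
exact: (sq_integrable_continuous_cube cp mO domain_sub_cube).
Qed.

Lemma Rintegral_domain (A : set 'rV[R]_n) g : Omega `<=` A ->
  (forall x, ~ Omega x -> g x = 0) ->
  \int[mu]_(x in Omega) g x = \int[mu]_(x in A) g x.
Proof.
move=> OA g0; rewrite Rintegral_mkcond [RHS]Rintegral_mkcond.
apply: eq_Rintegral => x _; rewrite !patchE; case: ifPn => xO; case: ifPn => xA //.
- by move: xA; rewrite mem_set //; apply: OA; exact: set_mem.
- by rewrite g0 //; rewrite notin_setE in xO.
Qed.

Definition classical_grad psi : 'rV[R]_n -> 'rV[R]_n := fun x => \row_i partial i psi x.

Lemma classical_gradE psi i : (fun x => classical_grad psi x 0 i) = partial i psi.
Proof. by apply/funext => x; rewrite mxE. Qed.

Lemma classical_grad_L2 psi : test psi -> L2_field Omega (classical_grad psi).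
Proof.
move=> tp; apply/(L2_fieldP oO) => i; rewrite classical_gradE.
exact/test_function_sq/test_function_partial.
Qed.

Lemma test_by_parts psi chi i : test psi -> test chi ->
  \int[mu]_(x in Omega) (partial i psi x * chi x) =
  - \int[mu]_(x in Omega) (psi x * partial i chi x).
Proof.
move=> tp tc; rewrite (@Rintegral_domain setT) //; last first.
  by move=> x nx; rewrite (test_function_eq0 tc nx) mulr0.
rewrite (@integration_by_parts_rV R n L) //.
- rewrite (@Rintegral_domain setT) // => x nx.
  by rewrite (test_function_eq0 tp nx) mul0r.
- exact: test_function_C1.
- exact: test_function_C1.
- exact: test_function_supported.
Qed.

Lemma weak_grad_test psi : test psi -> is_weak_grad Omega psi (classical_grad psi).
Proof.
move=> tp; split; first exact: classical_grad_L2.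
move=> chi i tc; rewrite -test_by_parts //.
by apply: eq_Rintegral => x _; rewrite mxE.
Qed.

Lemma weak_grad_linear c f g v w : L2s f -> L2s g ->
  is_weak_grad Omega f v -> is_weak_grad Omega g w ->
  is_weak_grad Omega (c *: f + g) (c *: v + w).
Proof.
move=> Hf Hg [Hv vf] [Hw wg]; split; first exact: (L2_field_subspace oO n).2.
move=> psi i tp.
have Hp := test_function_sq tp; have Hdp := test_function_sq (test_function_partial i tp).
move: (Hv) (Hw) => /(L2_fieldP oO) Hvi /(L2_fieldP oO) Hwi.
rewrite -[RHS]/(- ip (c *: f + g) (partial i psi)).
case: (aL) => _ lin _; rewrite lin // opprD -mulrN.
rewrite /int_mul -(vf psi i tp) -(wg psi i tp).
rewrite -[RHS]/(c * ip (fun x => v x 0 i) psi + ip (fun x => w x 0 i) psi) -lin //.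
by apply: eq_Rintegral => x _; rewrite !mxE.
Qed.

Lemma weak_gradB f g v w : L2s f -> L2s g ->
  is_weak_grad Omega f v -> is_weak_grad Omega g w ->
  is_weak_grad Omega (f - g) (v - w).
Proof.
move=> Hf Hg vf wg; have := weak_grad_linear (-1) Hg Hf wg vf.
by rewrite !scaleN1r [- g + f]addrC [- w + v]addrC.
Qed.

(** The function being almost everywhere 0, its weak gradient is orthogonal to
    the test functions. *)
Lemma weak_grad_eq0 f v : L2s f -> ip f f = 0 -> is_weak_grad Omega f v ->
  L2_dot Omega v v = 0.
Proof.
move=> Hf f0 [Hv vf]; rewrite L2_dotE //; apply: big1 => i _.
have /(L2_fieldP oO) Hvi := Hv.
apply: int_mul_test_eq0 => // psi tp; rewrite /int_mul vf //; apply/eqP; rewrite oppr_eq0; apply/eqP.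
exact: (semi_inner_eq0 sL aL Hf (test_function_sq (test_function_partial i tp)) f0).
Qed.

Lemma weak_grad_unique f v w : L2s f -> is_weak_grad Omega f v ->
  is_weak_grad Omega f w -> L2_dot Omega (v - w) (v - w) = 0.
Proof.
move=> Hf vf wf; apply: weak_grad_eq0 (weak_gradB Hf Hf vf wf).
  exact: (subspaceB sL).
by rewrite subrr (semi_inner0l sL aL) //; exact: sL.1.
Qed.

(** Second partial derivatives of a test function commute: by duality with the
    bump functions, for which they do by inspection. *)
Lemma test_function_mixed psi i j : test psi ->
  let d := partial i (partial j psi) - partial j (partial i psi) in
  L2s d /\ ip d d = 0.
Proof.
move=> tp d.
have tij k l := test_function_sq (test_function_partial k (test_function_partial l tp)).
have Hd : L2s d by exact: (subspaceB sL (tij i j) (tij j i)).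
split=> //; apply: (int_mul_bump_eq0 oO) => // m a b abO.
have tc := test_function_bump m abO; have Hc := test_function_sq tc.
have mv k l : ip (partial k (partial l psi)) (box_bump m a b) =
    ip psi (partial l (partial k (box_bump m a b))).
  rewrite /int_mul test_by_parts //; last exact: test_function_partial.
  by rewrite test_by_parts ?opprK //; exact: test_function_partial.
have -> := semi_innerBl sL aL (tij i j) (tij j i) Hc.
have E := elementary_mixed i j (elementary_bump m a b).
apply/eqP; rewrite subr_eq0; apply/eqP.
exact: etrans (mv i j) (etrans (congr1 (ip psi) (esym E)) (esym (mv j i))).
Qed.

End test_functions.

(** * The space H^1_0 *)

Lemma le_of_le_eps (R : realType) (x y M : R) : 0 <= M ->
  (forall e : R, 0 < e -> x <= y + M * e) -> x <= y.
Proof.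
move=> M0 h; apply/ler_addgt0Pr => e e0.
have M1 : 0 < M + 1 by lra.
apply: le_trans (h (e / (M + 1)) (divr_gt0 e0 M1)) _.
by rewrite lerD2l mulrCA ger_pMr // ler_pdivrMr //; lra.
Qed.

Lemma friedrichs_pos (R : realType) n (L : R) (f : 'rV[R]_n -> R) :
  (0 < n)%N -> 0 < L -> C1 f -> supported_in L f -> exists i,
  (\int[lebesgue_rV R n]_x (f x ^+ 2)%:E <=
   ((2 * L) ^+ 2)%:E * \int[lebesgue_rV R n]_x (partial i f x ^+ 2)%:E)%E.
Proof. by case: n f => // n f _ L0 f1 fL; exists ord_max; exact: friedrichs. Qed.

Section H10_space.
Context (R : realType) (n : nat) (Omega : set 'rV[R]_n) (oO : open Omega).
Context (L : R) (L0 : 0 < L).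
Hypothesis OL : forall x, Omega x -> forall i, `|x 0 i| < L.
Local Notation mu := (lebesgue_rV R n).
Local Notation L2s := (sq_integrable mu Omega).
Local Notation ip := (int_mul mu Omega).
Local Notation test := (test_function Omega).
Local Notation a := (H10_dot Omega).
Implicit Types (f g psi chi : 'rV[R]_n -> R).

Let mO := measurable_domain oO.
Let sL := sq_integrable_subspace mu mO.
Let aL := int_mul_semi_inner mu mO.
Let sF := L2_field_subspace oO n.
Let aF := L2_dot_semi_inner oO n.

Lemma H1_grad f : H1 Omega f -> L2s f /\ is_weak_grad Omega f (grad Omega f).
Proof. by case=> /(L2P oO) Hf [v hv]; split=> //; exact: (xgetPex 0 (P := [set v | is_weak_grad Omega f v]) (ex_intro _ v hv)). Qed.

Lemma weak_grad_H1 f v : L2s f -> is_weak_grad Omega f v -> H1 Omega f.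
Proof. by move=> Hf vf; split; [exact/(L2P oO)|exists v]. Qed.

(** Two weak gradients of a function differ by a field of zero norm. *)
Lemma H10_dotE f g v w : L2s f -> L2s g -> is_weak_grad Omega f v ->
  is_weak_grad Omega g w -> a f g = L2_dot Omega v w.
Proof.
move=> Hf Hg vf wg.
have [_ vf'] := H1_grad (weak_grad_H1 Hf vf).
have [_ wg'] := H1_grad (weak_grad_H1 Hg wg).
rewrite /H10_dot (semi_inner_congr sF aF vf'.1 vf.1 wg'.1); last first.
  exact: (weak_grad_unique oO OL Hf vf' vf).
rewrite (semi_innerC aF) ?(semi_innerC aF vf.1) //; try by case: wg' vf wg => ? _ [? _] [].
exact: (semi_inner_congr sF aF wg'.1 wg.1 vf.1 (weak_grad_unique oO OL Hg wg' wg)).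
Qed.

Let wlin c f g : H1 Omega f -> H1 Omega g ->
  L2s (c *: f + g) /\ is_weak_grad Omega (c *: f + g) (c *: grad Omega f + grad Omega g).
Proof.
move=> /H1_grad[Hf vf] /H1_grad[Hg wg].
by split; [exact: sL.2|exact: (weak_grad_linear oO OL c Hf Hg vf wg)].
Qed.

Lemma test_H1 psi : test psi -> H1 Omega psi.
Proof.
move=> tp; exact: (weak_grad_H1 (test_function_sq oO OL tp) (weak_grad_test oO L0 OL tp)).
Qed.

Lemma H1_subspace : linear_subspace (H1 Omega).
Proof.
split; first exact/test_H1/test_function0.
by move=> c f g hf hg; have [] := wlin c hf hg; exact: weak_grad_H1.
Qed.

Lemma H10_dot_semi_inner : semi_inner (H1 Omega) a.
Proof.
split=> [f g /H1_grad[_ [hf _]] /H1_grad[_ [hg _]]|c f g h hf hg hh|f /H1_grad[_ [hf _]]].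
- exact: (semi_innerC aF).
- have [Hfg wfg] := wlin c hf hg; have [Hh vh] := H1_grad hh.
  rewrite (H10_dotE Hfg Hh wfg vh); case: (aF) => _ lin _.
  by rewrite lin //; [case: (H1_grad hf) => _ []|case: (H1_grad hg) => _ []|case: vh].
- exact: (semi_inner_ge0 aF).
Qed.

Definition H1_dot f g : R := ip f g + a f g.

Lemma H1_dot_semi_inner : semi_inner (H1 Omega) H1_dot.
Proof.
have [sa1 sa2 sa3] := H10_dot_semi_inner; have [sb1 sb2 sb3] := aL.
split=> [f g hf hg|c f g h hf hg hh|f hf]; rewrite /H1_dot.
- by rewrite sa1 // sb1 //; [case: (H1_grad hf)|case: (H1_grad hg)].
- rewrite sa2 // sb2 //; last 3 first.
  + by case: (H1_grad hf).
  + by case: (H1_grad hg).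
  + by case: (H1_grad hh).
  by rewrite mulrDr addrACA.
- by rewrite addr_ge0 ?sa3 ?sb3 //; case: (H1_grad hf).
Qed.

Lemma H1_normE f : H1 Omega f -> H1_norm Omega f = Num.sqrt (H1_dot f f).
Proof.
move=> /H1_grad[Hf [Hv _]]; rewrite /H1_norm /H1_dot /int_mul /H10_dot /L2_dot -RintegralD //.
- exact: sq_integrable_mul.
- exact: (integrable_dotv oO).
Qed.

Lemma H10P f : H10 Omega f <-> H1 Omega f /\
  forall eps : R, 0 < eps -> exists2 psi, test psi & H1_dot (f - psi) (f - psi) < eps.
Proof.
split=> [] [hf app]; split=> // e e0.
  have [|psi tp h] := app (Num.sqrt e); first by rewrite sqrtr_gt0.
  exists psi => //; move: h; rewrite H1_normE ?ltr_sqrt //.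
  exact: (subspaceB H1_subspace hf (test_H1 tp)).
have [|psi tp h] := app (e ^+ 2); first exact: exprn_gt0.
exists psi => //; rewrite H1_normE; last exact: (subspaceB H1_subspace hf (test_H1 tp)).
by rewrite -(gtr0_norm e0) -sqrtr_sqr ltr_sqrt ?exprn_gt0.
Qed.

Lemma H10_H1 f : H10 Omega f -> H1 Omega f. Proof. by case. Qed.

Lemma test_H10 psi : test psi -> H10 Omega psi.
Proof.
move=> tp; apply/H10P; split=> [|e e0]; first exact: test_H1.
by exists psi => //; rewrite subrr (semi_inner0l H1_subspace H1_dot_semi_inner) //; exact: H1_subspace.1.
Qed.

Lemma H10_subspace : linear_subspace (H10 Omega).
Proof.
split; first exact/test_H10/test_function0.
move=> c f g /H10P[hf af] /H10P[hg ag]; apply/H10P; split; first exact: H1_subspace.2.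
move=> e e0.
have c1 : 0 < 4 * (c ^+ 2 + 1) by have := sqr_ge0 c; lra.
have [psi tp hp] := af _ (divr_gt0 e0 c1).
have [|chi tc hc] := ag (e / 4); first by lra.
exists (c *: psi + chi); first exact: test_function_linear.
have B1 := subspaceB H1_subspace hf (test_H1 tp).
have B2 := subspaceB H1_subspace hg (test_H1 tc).
rewrite (_ : _ - _ = c *: (f - psi) + (g - chi)); last first.
  by rewrite scalerBr opprD addrACA.
have B3 := subspaceZ H1_subspace c B1.
apply: le_lt_trans (semi_inner_leD H1_subspace H1_dot_semi_inner B3 B2) _.
rewrite (semi_innerZl H1_subspace H1_dot_semi_inner) // (semi_innerZr H1_subspace H1_dot_semi_inner) //.
rewrite ltr_pdivlMr // in hp.
have := semi_inner_ge0 H1_dot_semi_inner B1; have := sqr_ge0 c.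
move: (H1_dot (f - psi) _) (H1_dot (g - chi) _) hp hc => x y; rewrite expr2; nra.
Qed.

Lemma H10_density f : H10 Omega f -> forall eps : R, 0 < eps -> exists psi,
  [/\ test psi, ip (f - psi) (f - psi) <= eps & a (f - psi) (f - psi) <= eps].
Proof.
move=> /H10P[hf af] e e0; have [psi tp hp] := af e e0; exists psi.
have B := subspaceB H1_subspace hf (test_H1 tp).
have := semi_inner_ge0 H10_dot_semi_inner B.
have := semi_inner_ge0 aL (H1_grad B).1.
by move: hp; rewrite /H1_dot => *; split=> //; lra.
Qed.

Let saH : semi_inner (H10 Omega) a.
Proof.
have [s1 s2 s3] := H10_dot_semi_inner.
split=> [f g /H10_H1 ? /H10_H1 ?|c f g h /H10_H1 ? /H10_H1 ? /H10_H1 ?|f /H10_H1 ?];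
  [exact: s1|exact: s2|exact: s3].
Qed.

Let sbH : semi_inner (H10 Omega) ip.
Proof.
have [s1 s2 s3] := aL; pose h f (hf : H10 Omega f) := (H1_grad (H10_H1 hf)).1.
by split=> [f g /h ? /h ?|c f g k /h ? /h ? /h ?|f /h ?]; [exact: s1|exact: s2|exact: s3].
Qed.

Lemma H10_dot_test psi : test psi ->
  a psi psi = \sum_i ip (partial i psi) (partial i psi).
Proof.
move=> tp; have wp := weak_grad_test oO L0 OL tp; have Hp := test_function_sq oO OL tp.
rewrite (H10_dotE Hp Hp wp wp) L2_dotE //; last by case: wp.
  by apply: eq_bigr => i _; rewrite classical_gradE.
by case: wp.
Qed.

Lemma int_mul_domain (A : set 'rV[R]_n) f g : Omega `<=` A -> (forall x, ~ Omega x -> f x = 0) ->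
  int_mul mu A f g = ip f g.
Proof.
by move=> OA f0; rewrite /int_mul -(Rintegral_domain OA) // => x /f0->; rewrite mul0r.
Qed.

Let friedrichs_test psi : (0 < n)%N -> test psi -> ip psi psi <= (2 * L) ^+ 2 * a psi psi.
Proof.
move=> n0 tp; have [i] := friedrichs_pos n0 L0 (test_function_C1 tp) (test_function_supported OL tp).
have sqT chi : test chi -> (\int[mu]_x (chi x ^+ 2)%:E = (ip chi chi)%:E)%E.
  move=> tc; rewrite -int_mul_sqrE //; last exact: (test_function_sq oO OL tc).
  rewrite [RHS]integral_mkcond; apply: eq_integral => x _; rewrite patchE; case: ifPn => //.
  by rewrite notin_setE => /(test_function_eq0 tc) ->; rewrite expr0n.
rewrite !sqT //; last exact: test_function_partial.
rewrite -EFinM lee_fin => h; apply: le_trans h _.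
rewrite ler_wpM2l ?sqr_ge0 // H10_dot_test // (bigD1 i) //= lerDl.
apply: sumr_ge0 => k _; apply: (semi_inner_ge0 aL).
exact/(test_function_sq oO OL)/test_function_partial.
Qed.

(** The Friedrichs inequality on all of H^1_0, by density. *)
Lemma H10_bounded : (0 < n)%N -> bounded_for (H10 Omega) a ip.
Proof.
move=> n0; exists (4 * (2 * L) ^+ 2); split; first by rewrite !mulr_gt0 // exprn_gt0 // mulr_gt0.
move=> f hf.
apply: (@le_of_le_eps _ _ _ (2 + 4 * (2 * L) ^+ 2)).
  by have := sqr_ge0 (2 * L); lra.
move=> e e0; have [psi [tp h1 h2]] := H10_density hf e0.
have hp := test_H10 tp; have HB := subspaceB H10_subspace hf hp.
have := friedrichs_test n0 tp.
have := semi_inner_leD H10_subspace sbH HB hp; rewrite subrK.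
have := semi_inner_leB H10_subspace saH hf HB; rewrite subKr.
have := sqr_ge0 (2 * L).
move: ((2 * L) ^+ 2) (ip f f) (a f f) (ip psi psi) (a psi psi) (ip (f - psi) _) (a (f - psi) _) h1 h2.
by move=> M x y z t u v *; nra.
Qed.

Let indic_sq (B : set 'rV[R]_n) : measurable B -> L2s (\1_B).
Proof.
move=> mB; split; first by apply: measurable_funTS; exact: measurable_indic.
have [_] := sq_integrable_continuous_cube (@cst_continuous _ _ (1 : R)) mO (domain_sub_cube OL).
apply: le_integrable => //.
  apply/measurable_EFinP; apply: measurable_funX; apply: measurable_funTS.
  exact: measurable_indic.
move=> x _; rewrite /= lee_fin indicE; case: (_ \in _) => /=; first exact: lexx.
by rewrite expr0n normr0.
Qed.

Let integral_indic_test (B : set 'rV[R]_n) psi : test psi ->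
  \int[mu]_(x in B) psi x = ip psi \1_B.
Proof.
move=> tp; rewrite /int_mul Rintegral_mkcond [RHS]Rintegral_mkcond.
apply: eq_Rintegral => x _; rewrite !patchE indicE.
case: ifPn => xB; case: ifPn => xO; rewrite ?mulr1 ?mulr0 //.
by rewrite notin_setE in xO; exact: (test_function_eq0 tp xO).
Qed.

Let int_mul_H10_CS f g : H10 Omega f -> L2s g -> (ip f g) ^+ 2 <= ip f f * ip g g.
Proof. by move=> /H10_H1/H1_grad[Hf _] Hg; exact: (semi_inner_CS sL aL). Qed.

(** Rellich's theorem: the cell inequality passes to the limit. *)
Lemma H10_compact : (0 < n)%N -> compact_for (H10 Omega) a ip.
Proof.
move=> n0 e e0; have [|K [B [C [C0 hB cell]]]] := @cell_inequality R n L (e / 4) L0.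
  by lra.
have [F [F0 hF]] := H10_bounded n0.
have Hg k : L2s (\1_(B k)) by apply: indic_sq; case: (hB k).
pose M k := ip (\1_(B k)) (\1_(B k)).
have M0 k : 0 <= M k by exact: (semi_inner_ge0 aL).
have MS k : M k <= \sum_k M k.
  by rewrite (bigD1 k) //= lerDl sumr_ge0.
have SM0 : 0 <= \sum_k M k by rewrite sumr_ge0.
exists K, (fun k f => Num.sqrt (4 * C) * ip f (\1_(B k))), (Num.sqrt (4 * C * (F * \sum_k M k))).
have C40 : 0 <= 4 * C by rewrite mulr_ge0.
split.
- move=> k f g /H10_H1/H1_grad[Hf _] /H10_H1/H1_grad[Hf' _].
  by rewrite -mulrBr -(semi_innerBl sL aL).
- move=> k f hf af; rewrite -sqrtr_sqr; apply: ler_wsqrtr.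
  rewrite exprMn sqr_sqrtr // ler_wpM2l //.
  apply: le_trans (int_mul_H10_CS hf (Hg k)) _.
  apply: ler_pM (semi_inner_ge0 sbH hf) (M0 k) _ (MS k).
  by apply: le_trans (hF f hf) _; rewrite ler_piMr // ltW.
move=> f hf; rewrite (eq_bigr (fun k => 4 * C * ip f (\1_(B k)) ^+ 2)); last first.
  by move=> k _; rewrite exprMn sqr_sqrtr.
rewrite -mulr_sumr.
apply: (@le_of_le_eps _ _ _ (2 + 4 * C * \sum_k M k + e)).
  by rewrite !addr_ge0 ?mulr_ge0 // ltW.
move=> d d0; have [psi [tp h1 h2]] := H10_density hf d0.
have hp := test_H10 tp; have HB := subspaceB H10_subspace hf hp.
have cp := cell psi (test_function_C1 tp).
rewrite int_mul_domain in cp; [|exact: (domain_sub_cube OL)|by move=> x; exact: test_function_eq0].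
have cs : \sum_k (\int[mu]_(x in B k) psi x) ^+ 2 <=
    2 * (\sum_k ip f (\1_(B k)) ^+ 2) + 2 * d * \sum_k M k.
  rewrite !mulr_sumr -big_split; apply: ler_sum => k _ /=.
  rewrite integral_indic_test //.
  have := int_mul_H10_CS HB (Hg k); rewrite -/(M k).
  have Hf := (H1_grad (H10_H1 hf)).1; have Hp := (H1_grad (H10_H1 hp)).1.
  rewrite (semi_innerBl sL aL) // => h.
  have {}h : (ip f (\1_(B k)) - ip psi (\1_(B k))) ^+ 2 <= d * M k := le_trans h (ler_wpM2r (M0 k) h1).
  move: (ip f _) (ip psi _) (M k) h => x y z; rewrite !expr2.
  by have := sqr_ge0 (2 * x - y); rewrite expr2; nra.
have cg : \sum_i int_mul mu (cube n L) (partial i psi) (partial i psi) = a psi psi.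
  rewrite H10_dot_test //; apply: eq_bigr => i _; apply: int_mul_domain.
    exact: (domain_sub_cube OL).
  by move=> x; apply: test_function_eq0; exact: test_function_partial.
rewrite cg in cp.
have := semi_inner_leD H10_subspace sbH HB hp; rewrite subrK.
have := semi_inner_leB H10_subspace saH hf HB; rewrite subKr.
move: (\sum_k M k) (\sum_k ip f _ ^+ 2) (\sum_k (Rintegral _ _ _) ^+ 2) (ip f f) (a f f)
  (ip psi psi) (a psi psi) (ip (f - psi) _) (a (f - psi) _) C0 e0 d0 SM0 h1 h2 cs cp.
move=> SM S T x y z t u v C0 e0 d0 SM0 h1 h2 cs cp h3 h4.
have A1 : C * T <= C * (2 * S + 2 * d * SM) by exact: ler_wpM2l.
have A2 : e * t <= e * (2 * y + 2 * v) by apply: ler_wpM2l => //; exact: ltW.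
have A3 : e * v <= e * d by apply: ler_wpM2l => //; exact: ltW.
lra.
Qed.

(** The weak gradient is a closed operator: both sides of its defining identity
    are continuous in mean square. *)
Lemma cvg_weak_grad f v (x : nat -> 'rV[R]_n -> R) : (forall k, H1 Omega (x k)) ->
  L2s f -> L2_field Omega v -> cvg_for ip x f ->
  cvg_for (@L2_dot R n Omega n) (fun k => grad Omega (x k)) v -> is_weak_grad Omega f v.
Proof.
move=> hx Hf Hv xf xv; split=> // psi i tp.
have Hp := test_function_sq oO OL tp.
have Hd := test_function_sq oO OL (test_function_partial i tp).
have Hvi : L2s (fun y => v y 0 i) by move/(L2_fieldP oO): Hv.
rewrite -[LHS]/(ip (fun y => v y 0 i) psi) -[X in _ = - X]/(ip f (partial i psi)).
apply/eqP; rewrite -subr_eq0 opprK -sqrf_eq0 eq_le sqr_ge0 andbT.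
set p := ip psi psi; set q := ip (partial i psi) (partial i psi).
have p0 : 0 <= p by exact: (semi_inner_ge0 aL).
have q0 : 0 <= q by exact: (semi_inner_ge0 aL).
apply: (@le_of_le_eps _ _ _ (2 * p + 2 * q)); first by lra.
move=> e e0; have [N1 hN1] := xf e e0; have [N2 hN2] := xv e e0.
pose k := maxn N1 N2.
have {}hN1 := hN1 k (leq_maxl _ _); have {}hN2 := hN2 k (leq_maxr _ _).
have [Hx [Hg wg]] := H1_grad (hx k).
have Hgi : L2s (fun y => grad Omega (x k) y 0 i) by move/(L2_fieldP oO): Hg.
have wk : ip (fun y => grad Omega (x k) y 0 i) psi = - ip (x k) (partial i psi) by exact: wg.
have B1 := int_mul_le_L2_dot oO i (subspaceB sF Hg Hv).
have E : (fun y => (grad Omega (x k) - v) y 0 i) =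
    (fun y => grad Omega (x k) y 0 i) - (fun y => v y 0 i).
  by apply/funext => y; rewrite !mxE.
rewrite E in B1.
have D1 := semi_innerBl sL aL Hgi Hvi Hp.
have := semi_inner_CS sL aL (subspaceB sL Hgi Hvi) Hp; rewrite D1 wk -/p.
have D2 := semi_innerBl sL aL Hx Hf Hd.
have := semi_inner_CS sL aL (subspaceB sL Hx Hf) Hd; rewrite D2 -/q.
set r := ip (x k - f) (x k - f) in hN1 *.
set s := ip (_ - _) (_ - _) in B1 *.
have {}B1 : s <= e by apply: le_trans B1 (ltW hN2).
have {}hN1 : r <= e by exact: ltW.
have R1 : r * q <= e * q by exact: ler_wpM2r.
have R2 : s * p <= e * p by exact: ler_wpM2r.
move: (ip (x k) _) (ip f _) (ip (fun y => v y 0 i) psi) R1 R2 => w y z R1 R2.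
rewrite !expr2; have := sqr_ge0 (- w - z - (w - y) ); rewrite expr2.
have := sqr_ge0 (- w - z + (y - w)); rewrite expr2.
by move: R1 R2; move: (r * q) (s * p) => *; nra.
Qed.

(** For a Cauchy sequence both the functions and the gradients converge in mean
    square, the former by the Friedrichs inequality. *)
Lemma H10_complete : (0 < n)%N -> complete_for (H10 Omega) a.
Proof.
move=> n0 x hx cx; have [F [F0 hF]] := H10_bounded n0.
have Hx k := H10_H1 (hx k); have Gx k := H1_grad (Hx k).
have gB k l : a (x k - x l) (x k - x l) =
    L2_dot Omega (grad Omega (x k) - grad Omega (x l)) (grad Omega (x k) - grad Omega (x l)).
  have [Hk wk] := Gx k; have [Hl wl] := Gx l.
  have HB := subspaceB sL Hk Hl.
  have wB : is_weak_grad Omega (x k - x l) (grad Omega (x k) - grad Omega (x l)) :=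
    weak_gradB oO OL Hk Hl wk wl.
  exact: (H10_dotE HB HB wB wB).
have [|f Hf xf] := sq_integrable_complete mO (fun k => (Gx k).1).
  move=> e e0; have [N hN] := cx (e / F) (divr_gt0 e0 F0); exists N => k l Nk Nl.
  apply: le_lt_trans (hF _ (subspaceB H10_subspace (hx k) (hx l))) _.
  by rewrite mulrC -ltr_pdivlMr //; exact: hN.
have [|v Hv xv] := L2_field_complete oO (fun k => (Gx k).2.1).
  by move=> e e0; have [N hN] := cx e e0; exists N => k l Nk Nl; rewrite -gB; exact: hN.
have wf := cvg_weak_grad Hx Hf Hv xf xv.
have hf := weak_grad_H1 Hf wf.
have aE k : a (x k - f) (x k - f) = L2_dot Omega (grad Omega (x k) - v) (grad Omega (x k) - v).
  have [Hk wk] := Gx k.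
  have HB := subspaceB sL Hk Hf.
  have wB : is_weak_grad Omega (x k - f) (grad Omega (x k) - v) :=
    weak_gradB oO OL Hk Hf wk wf.
  exact: (H10_dotE HB HB wB wB).
exists f.
  apply/H10P; split=> // e e0.
  have e8 : 0 < e / 8 by lra.
  have [N1 hN1] := xf _ e8; have [N2 hN2] := xv _ e8.
  pose k := maxn N1 N2.
  have {}hN1 := hN1 k (leq_maxl _ _); have {}hN2 := hN2 k (leq_maxr _ _).
  rewrite -aE in hN2.
  have [_ /(_ _ e8)[psi tp hp]] := (H10P (x k)).1 (hx k).
  exists psi => //.
  have B1 := subspaceB H1_subspace (Hx k) (test_H1 tp).
  have B2 := subspaceB H1_subspace (Hx k) hf.
  have E : x k - psi - (x k - f) = f - psi by rewrite opprB addrC addrA subrK.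
  have := semi_inner_leB H1_subspace H1_dot_semi_inner B1 B2; rewrite E.
  rewrite -[H1_dot (x k - f) _]/(ip (x k - f) (x k - f) + a (x k - f) (x k - f)).
  move: (H1_dot _ _) (H1_dot _ _) (ip _ _) (a _ _) hp hN1 hN2 => r s t u *; lra.
by move=> e e0; have [N hN] := xv e e0; exists N => k Nk; rewrite aE; exact: hN.
Qed.

Lemma H10_inj f : H10 Omega f -> ip f f = 0 -> a f f = 0.
Proof.
move=> /H10_H1/H1_grad[Hf wf] f0; rewrite (H10_dotE Hf Hf wf wf).
exact: (weak_grad_eq0 oO OL Hf f0 wf).
Qed.

(** The spectral theorem for the inclusion of H^1_0 into L^2, whose inverse is
    the Dirichlet Laplacian. *)
Lemma H10_eigenbasis : (0 < n)%N -> exists (I : countType) (phi : I -> ('rV[R]_n -> R)),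
  orthonormal_basis (H10 Omega) a phi /\
  forall k, exists lambda, forall v, H10 Omega v -> a (phi k) v = lambda * ip (phi k) v.
Proof.
move=> n0; exact: (spectral_theorem H10_subspace saH sbH (H10_complete n0) (H10_compact n0)
  (H10_bounded n0) H10_inj).
Qed.

End H10_space.

(** * Gradient fields, their curl and their trace *)

Section curl_entries.
Context (R : realType) (n : nat).

Lemma entryE m p (A : 'M[R]_(m, p)) (i : 'I_m) (j : 'I_p) : entry A i j = A i j.
Proof. by rewrite /entry !valK. Qed.

Lemma curl_ofE : n = 2%N \/ n = 3%N -> forall k : 'I_(curl_dim n),
  exists i j, forall D : 'M[R]_n, curl_of D 0 k = D i j - D j i.
Proof.
case=> ->; rewrite /curl_of /curl_dim /= => k.
  pose i := @Ordinal 2 1 isT; pose j := @Ordinal 2 0 isT.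
  exists i, j => D; rewrite mxE; congr (_ - _); [exact: (entryE D i j)|exact: (entryE D j i)].
pose i := @Ordinal 3 (k.+1 %% 3) (@ltn_pmod _ 3 isT).
pose j := @Ordinal 3 (k.+2 %% 3) (@ltn_pmod _ 3 isT).
exists i, j => D; rewrite mxE; congr (_ - _); [exact: (entryE D i j)|exact: (entryE D j i)].
Qed.

Lemma cross0l (v : 'rV[R]_n) : cross 0 v = 0.
Proof.
have e0 j : entry (0 : 'rV[R]_n) 0 j = 0.
  by rewrite /entry; case: insub => // i; case: insub => // k; rewrite mxE.
by apply/rowP => k; rewrite !mxE !e0 !mul0r subrr; case: ifP.
Qed.

End curl_entries.

Section gradient_fields.
Context (R : realType) (n : nat) (hn : n = 2%N \/ n = 3%N).
Context (Omega : set 'rV[R]_n) (oO : open Omega) (L : R) (L0 : 0 < L).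
Hypothesis OL : forall x, Omega x -> forall i, `|x 0 i| < L.
Local Notation mu := (lebesgue_rV R n).
Local Notation L2s := (sq_integrable mu Omega).
Local Notation ip := (int_mul mu Omega).
Local Notation test := (test_function Omega).
Implicit Types (f g psi : 'rV[R]_n -> R) (u v : 'rV[R]_n -> 'rV[R]_n).

Let mO := measurable_domain oO.
Let sL := sq_integrable_subspace mu mO.
Let aL := int_mul_semi_inner mu mO.

Definition gradient_field v : Prop := exists2 f, L2s f & is_weak_grad Omega f v.

(** The curl of a gradient vanishes: tested against psi it is the integral of f
    against a difference of mixed second derivatives of psi. *)
Lemma gradient_field_curl v psi k : gradient_field v -> test psi ->
  \int[mu]_(x in Omega) curl_of (\matrix_(i, j) (partial i psi x * v x 0 j)) 0 k = 0.
Proof.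
move=> [f Hf [Hv vf]] tp; have [i [j cE]] := curl_ofE R hn k.
have [Hd d0] := test_function_mixed oO L0 OL j i tp.
move/(L2_fieldP oO) in Hv.
have tP l := test_function_partial l tp.
have sP l := test_function_sq oO OL (tP l).
have sPP l m := test_function_sq oO OL (test_function_partial m (tP l)).
have -> : \int[mu]_(x in Omega) curl_of (\matrix_(i, j) (partial i psi x * v x 0 j)) 0 k =
    ip (fun x => v x 0 j) (partial i psi) - ip (fun x => v x 0 i) (partial j psi).
  rewrite /int_mul -RintegralB //; [|exact: sq_integrable_mul|exact: sq_integrable_mul].
  by apply: eq_Rintegral => x _; rewrite cE !mxE mulrC [X in _ - X]mulrC.
rewrite /int_mul !vf // opprK addrC.
apply/eqP; rewrite subr_eq0 eq_sym -subr_eq0; apply/eqP.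
have := semi_innerBr sL aL (sPP i j) (sPP j i) Hf.
rewrite (semi_innerC aL Hf Hd) (semi_inner_eq0 sL aL Hd Hf d0) => h.
by rewrite h.
Qed.

Lemma gradient_weak_curl v : gradient_field v -> is_weak_curl Omega v 0.
Proof.
move=> gv; split; first exact: (L2_field_subspace oO _).1.
move=> psi k tp; rewrite (gradient_field_curl k gv tp) oppr0.
under eq_Rintegral do rewrite mxE mul0r.
by rewrite Rintegral_cst // mul0r.
Qed.

(** The chosen curl need not be 0 but is orthogonal to all test functions. *)
Lemma gradient_curl_eq0 v : gradient_field v ->
  L2_field Omega (curl Omega v) /\ L2_dot Omega (curl Omega v) (curl Omega v) = 0.
Proof.
move=> gv.
have [Hc cE] : is_weak_curl Omega v (curl Omega v).
  exact: (xgetPex 0 (P := [set c | is_weak_curl Omega v c]) (ex_intro _ 0 (gradient_weak_curl gv))).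
split=> //; rewrite L2_dotE //; apply: big1 => k _; move/(L2_fieldP oO) in Hc.
apply: (int_mul_test_eq0 oO) => // psi tp.
by rewrite /int_mul cE // (gradient_field_curl k gv tp) oppr0.
Qed.

Lemma Hcurl_dot_gradient u v : gradient_field u -> gradient_field v ->
  Hcurl_dot Omega u v = L2_dot Omega u v.
Proof.
move=> gu gv; have [Hcu cu] := gradient_curl_eq0 gu; have [Hcv _] := gradient_curl_eq0 gv.
have [[f _ [Hu _]] [g _ [Hv _]]] := (gu, gv).
rewrite /Hcurl_dot RintegralD //; try exact: (integrable_dotv oO).
rewrite -[X in X + _]/(L2_dot Omega (curl Omega u) (curl Omega v)).
by rewrite (semi_inner_eq0 (L2_field_subspace oO _) (L2_dot_semi_inner oO _) Hcu Hcv cu) add0r.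
Qed.

Lemma H10_gradient f v : H10 Omega f -> is_weak_grad Omega f v -> gradient_field v.
Proof. by move=> /H10_H1/(H1_grad oO)[Hf _] wv; exists f. Qed.

(** The gradient of psi vanishes outside the open set Omega, in particular on
    its boundary. *)
Lemma smooth_trace_test psi (g : 'rV[R]_n -> 'rV[R]_(curl_dim n)) : test psi ->
  smooth_trace Omega (classical_grad psi) g = 0.
Proof.
move=> tp; rewrite /smooth_trace /Rintegral.
rewrite (eq_integral (cst 0%E)) ?integral0 // => x; rewrite inE => -[_ nx].
have -> : classical_grad psi x = 0.
  apply/rowP => i; rewrite !mxE; apply: (test_function_eq0 (test_function_partial i tp)).
  by move=> Ox; apply: nx; exact: open_nbhs_nbhs.
by rewrite cross0l /dotv big1 // => i _; rewrite mxE mul0r.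
Qed.

(** The gradients of the test functions that approximate f in H^1 approximate
    the gradient of f in H(curl), and they vanish on the boundary. *)
Lemma grad_H10_Hcurl0 : grad_H10 Omega `<=` Hcurl0 Omega.
Proof.
move=> v [f hf wv]; have gv := H10_gradient hf wv.
split; first by split; [case: wv|exists 0; exact: gradient_weak_curl].
move=> e e0; have e2 : 0 < e / 2 by lra.
have [psi [tp _ h]] := H10_density oO L0 OL hf (exprn_gt0 2 e2).
exists (classical_grad psi); split.
- move=> j; rewrite classical_gradE.
  by have [] := test_function_partial j tp.
- have [Hf _] := H1_grad oO (H10_H1 hf).
  have wp := weak_grad_test oO L0 OL tp; have Hp := test_function_sq oO OL tp.
  have HB := subspaceB sL Hf Hp.
  have wB : is_weak_grad Omega (f - psi) (v - classical_grad psi) :=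
    weak_gradB oO OL Hf Hp wv wp.
  have gB : gradient_field (v - classical_grad psi) by exists (f - psi).
  rewrite /Hcurl_norm Hcurl_dot_gradient // -(H10_dotE oO OL HB HB wB wB).
  apply: (@le_lt_trans _ _ (e / 2)); last by lra.
  by rewrite -[leRHS](gtr0_norm e2) -sqrtr_sqr ler_wsqrtr.
- move=> g Hg; rewrite smooth_trace_test // subrr normr0 mulr_ge0 ?sqrtr_ge0 //; exact: ltW.
Qed.

End gradient_fields.

Section gradients_of_basis.
Context (R : realType) (n : nat) (hn : n = 2%N \/ n = 3%N).
Context (Omega : set 'rV[R]_n) (oO : open Omega) (L : R) (L0 : 0 < L).
Hypothesis OL : forall x, Omega x -> forall i, `|x 0 i| < L.
Local Notation mu := (lebesgue_rV R n).
Local Notation a := (H10_dot Omega).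

Let mO := measurable_domain oO.
Let sL := sq_integrable_subspace mu mO.

Context (I : countType) (phi : I -> 'rV[R]_n -> R).
Hypothesis phiB : orthonormal_basis (H10 Omega) a phi.

Let phiH k : H10 Omega (phi k). Proof. by case: phiB. Qed.

Let phi_norm k : L2_norm Omega (grad Omega (phi k)) = 1.
Proof.
case: phiB => _ /(_ k k) + _; rewrite eqxx /H10_dot /L2_norm => ->.
by rewrite sqrtr1.
Qed.

Let gradW f : H10 Omega f -> sq_integrable mu Omega f /\ is_weak_grad Omega f (grad Omega f).
Proof. by move=> /H10_H1/(H1_grad oO). Qed.

Lemma orthonormal_neq0 k : ~ (phi k = 0 %[ae mu in Omega]).
Proof.
move=> p0; have [Hp _] := gradW (phiH k).
have := H10_inj oO OL (phiH k) (int_mul_ae0 oO Hp p0).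
by case: phiB => _ -> _; rewrite eqxx => /eqP; rewrite oner_eq0.
Qed.

Let weak_grad_sum (s : seq I) (c : I -> R) :
  sq_integrable mu Omega (\sum_(i <- s) c i *: phi i) /\
  is_weak_grad Omega (\sum_(i <- s) c i *: phi i) (\sum_(i <- s) c i *: grad Omega (phi i)).
Proof.
elim: s => [|i s [Hs ws]].
  rewrite !big_nil; split; first exact: sL.1.
  have [H0 w0] := gradW (H10_subspace oO L0 OL).1.
  by have := weak_gradB oO OL H0 H0 w0 w0; rewrite !subrr.
rewrite !big_cons; have [Hi wi] := gradW (phiH i); split; first exact: sL.2.
exact: (weak_grad_linear oO OL (c i) Hi Hs wi ws).
Qed.

(** The gradient is an isometry from H^1_0 onto its image, and the normalising
    factors are all 1. *)
Lemma orthonormal_basis_grad : orthonormal_basis (grad_H10 Omega) (Hcurl_dot Omega)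
  (fun k => (L2_norm Omega (grad Omega (phi k)))^-1 *: grad Omega (phi k)).
Proof.
have gE k : (L2_norm Omega (grad Omega (phi k)))^-1 *: grad Omega (phi k) = grad Omega (phi k).
  by rewrite phi_norm invr1 scale1r.
rewrite (funext gE); case: (phiB) => _ orth dense.
have gG k : gradient_field Omega (grad Omega (phi k)).
  by have [? ?] := gradW (phiH k); exists (phi k).
split=> [i|i j|v [f hf wv] e e0].
- by exists (phi i) => //; have [] := gradW (phiH i).
- by rewrite (Hcurl_dot_gradient hn oO L0 OL) // -orth.
have [s [c /= h]] := dense f hf e e0; exists s, c => /=.
have [Hs ws] := weak_grad_sum s c; have [Hf _] := gradW hf.
pose p := \sum_(i <- s) c i *: phi i.
pose q := \sum_(i <- s) c i *: grad Omega (phi i).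
have HB := subspaceB sL Hf Hs.
have wB : is_weak_grad Omega (f - p) (v - q) :=
  weak_gradB oO OL Hf Hs wv ws.
have gB : gradient_field Omega (v - q) by exists (f - p).
have E : Hcurl_dot Omega (v - q) (v - q) = a (f - p) (f - p).
  by rewrite (Hcurl_dot_gradient hn oO L0 OL) // -(H10_dotE oO OL HB HB wB wB).
by rewrite E.
Qed.

End gradients_of_basis.

Lemma bounded_coord (R : realType) n (A : set 'rV[R]_n) : bounded_set A ->
  exists2 L : R, 0 < L & forall x, A x -> forall i, `|x 0 i| < L.
Proof.
move=> [M [_ hM]]; exists (Num.max M 0 + 2); first by rewrite ltr_wpDl // le_max lexx orbT.
move=> x Ax i; apply: le_lt_trans (coord_le_norm x i) _.
apply: (@le_lt_trans _ _ (Num.max M 0 + 1)); last by rewrite ltrD2l ltr1n.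
by apply: (hM _ _ x Ax); rewrite ltr_pwDr // le_max lexx.
Qed.

Theorem proposition3p1 (R : realType) (n : nat) (Omega : set 'rV[R]_n)
    (hn : n = 2%N \/ n = 3%N)
    (Omega_domain : is_domain Omega)
    (Omega_bounded : bounded_set Omega)
    (Omega_simply_connected : simply_connected Omega)
    (Omega_lipschitz : lipschitz_domain Omega) :
  exists (I : countType) (phi : I -> ('rV[R]_n -> R)),
    [/\ orthonormal_basis (H10 Omega) (H10_dot Omega) phi,
        forall k, dirichlet_eigenvector Omega (phi k) /\
          ~ (phi k = 0 %[ae lebesgue_rV R n in Omega]),
        grad_H10 Omega `<=` Hcurl0 Omega &
        orthonormal_basis (grad_H10 Omega) (Hcurl_dot Omega)
          (fun k => (L2_norm Omega (grad Omega (phi k)))^-1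
                      *: grad Omega (phi k))].
Proof.
have [oO _ _] := Omega_domain; have [L L0 OL] := bounded_coord Omega_bounded.
have n0 : (0 < n)%N by case: hn => ->.
have [I [phi [phiB phiE]]] := H10_eigenbasis oO L0 OL n0.
exists I, phi; split=> //.
- move=> k; split; last exact: (orthonormal_neq0 oO OL phiB).
  by split; [case: phiB|exact: phiE].
- exact: (grad_H10_Hcurl0 hn oO L0 OL).
- exact: (orthonormal_basis_grad hn oO L0 OL phiB).
Qed.
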